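(* Let $-1<a<1$. For $u\in L^2(\mathbb G)$ and $y>0$ set $$v(\cdot,y):=\phi\big(\theta y^{1-a}\mathcal L^{(1-a)/2}\big)u:=\int_0^\infty\phi\big(\theta y^{1-a}\lambda^{(1-a)/2}\big)\,dE(\lambda)u,\qquad \theta:=(1-a)^{a-1},$$ and define the ''Poisson kernel'' $$P_{\mathbb G}(\cdot,y):=C_a\,y^{1-a}\int_0^\infty t^{(a-3)/2}e^{-\frac{y^2}{4t}}\,h(t,\cdot)\,dt,\qquad C_a=\frac{2^{a-1}}{\Gamma((1-a)/2)}.$$ Then for every $y>0$ one has $P_{\mathbb G}(\cdot,y)\ge0$ and $$v(\cdot,y)=u\ast P_{\mathbb G}(\cdot,y).$$
   Context: $\mathbb G$ is a Carnot group of step $\kappa$: a connected, simply connected Lie group whose Lie algebra has a stratification $\mathfrak g=V_1\oplus\cdots\oplus V_\kappa$ with $[V_1,V_i]=V_{i+1}$, $V_\kappa\ne\{0\}$, $V_i=\{0\}$ for $i>\kappa$. It is identified via exponential coordinates with $\mathbb R^n$, and its Haar measure is Lebesgue measure. $X_1,\dots,X_m$ is a fixed basis of left-invariant vector fields of the first layer $V_1$. The sub-Laplacian $\mathcal L=-\sum_{j=1}^m X_j^2$ is a positive self-adjoint operator in $L^2(\mathbb G)$, with spectral resolution $\{E(\lambda)\}$. $h=h(t,x)$ is the fundamental solution of $\partial_t+\mathcal L$, i.e. $h(t,\cdot)$, $t>0$, is the heat kernel: $e^{-t\mathcal L}u=u\ast h(t,\cdot)$. Group convolution: $f\ast g(x)=\int_{\mathbb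 G}f(y)g(y^{-1}x)\,dy$. Function $\phi$: put $\alpha=-\frac{2a}{1-a}$ and $k=\frac{2-\alpha}{2}=\frac1{1-a}$. Then $\phi:[0,\infty)\to\mathbb R$ is the solution of $-t^\alpha\phi''+\phi=0$ on $(0,\infty)$, $\phi(0)=1$, $\lim_{t\to+\infty}\phi(t)=0$, given by $$\phi(t)=c_\alpha t^{1/2}K_{1/(2k)}(k^{-1}t^k),\qquad c_\alpha=2^{1-\frac1{2k}}\,\Gamma\big(\tfrac1{2k}\big)^{-1}k^{-\frac1{2k}},$$ where $K_\nu$ is the modified Bessel function of the second kind. It is continuous and bounded on $[0,\infty)$, so $v(\cdot,y)\in L^2(\mathbb G)$ is well defined. *)

(* Defs.v *)
From HB Require Import structures.
From mathcomp Require Import all_boot all_order all_algebra.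
From mathcomp Require Import all_classical all_reals all_analysis.

Set Implicit Arguments.
Unset Strict Implicit.
Unset Printing Implicit Defensive.

Import Order.TTheory GRing.Theory Num.Theory.
Import numFieldNormedType.Exports.

Local Open Scope classical_set_scope.
Local Open Scope ring_scope.

(** * Lebesgue measure on R^n *)

Definition rV_display : measure_display -> measure_display.
Proof. exact. Qed.

Section measurable_rV.
Context {d} {T : measurableType d}.
Variable n : nat.

Let coors : 'I_n -> 'rV[T]_n -> T := fun i v => v ord0 i.

Let rV_set0 : g_sigma_preimage coors set0.
Proof. exact: sigma_algebra0. Qed.

Let rV_setC A : g_sigma_preimage coors A -> g_sigma_preimage coors (~` A).
Proof. exact: sigma_algebraC. Qed.

Let rV_bigcup (F : _^nat) : (forall i, g_sigma_preimage coors (F i)) ->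
  g_sigma_preimage coors (\bigcup_i (F i)).
Proof. exact: sigma_algebra_bigcup. Qed.

(* The product sigma-algebra, i.e. the Borel one when T is R. *)
HB.instance Definition _ := @isMeasurable.Build (rV_display d)
  'rV[T]_n (g_sigma_preimage coors) rV_set0 rV_setC rV_bigcup.

End measurable_rV.

Lemma measurable_coord d (T : measurableType d) n (i : 'I_n) :
  measurable_fun [set: 'rV[T]_n] (fun v : 'rV[T]_n => v ord0 i).
Proof.
move=> _ Y mY; rewrite setTI; apply: sub_sigma_algebra => /=.
rewrite -bigcup_seq/=; exists i => /=; first by rewrite mem_index_enum.
by exists Y => //; rewrite setTI.
Qed.

Lemma measurable_fun_coordP d1 d2 (T1 : measurableType d1)
    (T2 : measurableType d2) n (f : T1 -> 'rV[T2]_n) :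
  (forall i, measurable_fun [set: T1] (fun x => f x ord0 i)) ->
  measurable_fun [set: T1] f.
Proof.
move=> mf.
suff S : @measurable _ 'rV[T2]_n `<=` [set B | measurable (f @^-1` B)].
  by move=> _ B mB; rewrite setTI; exact: S.
apply: smallest_sub.
  split => /= [|B mB|F mF].
  - by rewrite preimage_set0.
  - by rewrite setTD preimage_setC; exact: measurableC.
  - by rewrite preimage_bigcup; exact: bigcup_measurable.
move=> B; rewrite -bigcup_seq => -[i _ [C mC <-]] /=.
by rewrite setTI -comp_preimage -[X in measurable X]setTI; exact: mf.
Qed.

Section lebesgue_rV.
Context (R : realType).

Definition rV_snoc n (p : 'rV[R]_n * measurableTypeR R) : 'rV[R]_(1 + n) :=
  row_mx (\row_(_ < 1) p.2) p.1.

Lemma measurable_rV_snoc n :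
  measurable_fun [set: 'rV[R]_n * measurableTypeR R] (@rV_snoc n).
Proof.
apply: measurable_fun_coordP => i; rewrite /rV_snoc.
case: (split_ordP i) => j ->.
  under eq_fun do rewrite row_mxEl mxE.
  exact: (@measurable_snd _ _ 'rV[R]_n (measurableTypeR R)).
under eq_fun do rewrite row_mxEr.
exact: (measurableT_comp (measurable_coord j) measurable_fst).
Qed.

HB.instance Definition _ n := isMeasurableFun.Build _ _ _ _ (@rV_snoc n)
  (@measurable_rV_snoc n).

Definition leb_step n (m : {measure set 'rV[R]_n -> \bar R}) :
    set 'rV[R]_(1 + n) -> \bar R :=
  pushforward (m \x @lebesgue_measure R)%E (@rV_snoc n).

Section leb_step_measure.
Variables (n : nat) (m : {measure set 'rV[R]_n -> \bar R}).

Let leb_step0 : leb_step m set0 = 0%E.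
Proof. exact: measure0. Qed.

Let leb_step_ge0 A : (0 <= leb_step m A)%E.
Proof. exact: measure_ge0. Qed.

Let leb_step_sigma_additive : semi_sigma_additive (leb_step m).
Proof. exact: measure_semi_sigma_additive. Qed.

HB.instance Definition _ := isMeasure.Build _ _ _ (leb_step m)
  leb_step0 leb_step_ge0 leb_step_sigma_additive.

End leb_step_measure.

Fixpoint leb (n : nat) : {measure set 'rV[R]_n -> \bar R} :=
  if n is n'.+1 then [the measure _ _ of leb_step (leb n')]
  else [the measure _ _ of \d_(0 : 'rV[R]_0)].

End lebesgue_rV.

Lemma leb_box (R : realType) n (A : 'I_n -> set (measurableTypeR R)) :
  (forall i, measurable (A i)) ->
  leb R n [set v | forall i, A i (v ord0 i)] =
  (\prod_(i < n) lebesgue_measure (A i))%E.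
Proof.
elim: n A => [|n IH] A mA.
  rewrite big_ord0 /= diracE mem_set//= => -[].
  by [].
rewrite big_ord_recl muleC -IH//.
rewrite /= /leb_step /pushforward -product_measure1E//; last first.
  rewrite [X in measurable X](_ : _ = \bigcap_(i in [set: 'I_n])
      ((fun v : 'rV[R]_n => v ord0 i) @^-1` A (lift ord0 i))).
    apply: fin_bigcap_measurable => // i _.
    by rewrite -[X in measurable X]setTI; apply: measurable_coord => //; exact: mA.
  by apply/seteqP; split => [v /= H i _|v H i /=]; exact: H.
congr (_ _); apply/seteqP.
have snocr (v : 'rV[R]_n) (x : R) i :
    rV_snoc (v, x) ord0 (lift ord0 i) = v ord0 i.
  have -> : lift ord0 i = rshift 1 i by exact/val_inj.
  by rewrite /rV_snoc [LHS]row_mxEr.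
have snocl (v : 'rV[R]_n) (x : R) : rV_snoc (v, x) ord0 ord0 = x.
  have -> : (ord0 : 'I_n.+1) = lshift n (ord0 : 'I_1) by exact/val_inj.
  by rewrite /rV_snoc [LHS]row_mxEl mxE.
split => -[v x] /=.
  move=> H; split=> [i|]; first by have := H (lift ord0 i); rewrite snocr.
  by have := H ord0; rewrite snocl.
move=> [Hv Hx] i; case: (unliftP ord0 i) => [j|] ->; first by rewrite snocr.
by rewrite snocl.
Qed.

(** * Smooth functions *)

Section smooth.
Context (R : realType) (V W : normedModType R).

Definition iter_derive (vs : seq V) (f : V -> W) : V -> W :=
  foldr (fun v g x => 'D_v g x) f vs.

(* C^oo on an open set U of a finite-dimensional V: all iterated directional
   derivatives exist and are continuous at the points of U. *)
Definition smooth_on (U : set V) (f : V -> W) : Prop :=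
  forall vs : seq V, forall x, U x ->
    {for x, continuous (iter_derive vs f)} /\
    forall v, derivable (iter_derive vs f) x v.

End smooth.

Definition test_function (R : realType) n (f : 'rV[R]_n -> R) : Prop :=
  smooth_on setT (f : 'rV[R]_n -> R^o) /\ compact (closure [set x | f x != 0]).

(** * Real L^2 spaces *)

Section L2.
Context d (T : measurableType d) (R : realType).
Variable mu : {measure set T -> \bar R}.

Definition L2 (u : T -> R) : Prop := u \in Lfun mu 2%:E.

Definition normL2 (u : T -> R) : \bar R := 'N[mu]_2%:E[EFin \o u]%E.

Definition dotL2 (u v : T -> R) : R := \int[mu]_x (u x * v x).

End L2.

(** * Carnot groups in exponential coordinates *)

Section left_invariant.
Context (R : realType) (n : nat).
Variable op : 'rV[R]_n -> 'rV[R]_n -> 'rV[R]_n.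

(* The value at x of the left-invariant vector field that equals v at 0. *)
Definition left_field (v x : 'rV[R]_n) : 'rV[R]_n := 'D_v (op x) 0.

(* The value at 0 of the commutator of these vector fields. *)
Definition lie_bracket (v w : 'rV[R]_n) : 'rV[R]_n :=
  'D_v (left_field w) 0 - 'D_w (left_field v) 0.

Definition bracket_space (U V W : {vspace 'rV[R]_n}) : Prop :=
  (forall v w, v \in U -> w \in V -> lie_bracket v w \in W) /\
  (forall Z : {vspace 'rV[R]_n},
    (forall v w, v \in U -> w \in V -> lie_bracket v w \in Z) -> (W <= Z)%VS).

(* The left-invariant vector field of v acting on functions:
   f |-> d/ds f (x * exp (s v)) at s = 0. *)
Definition lie_derive (v : 'rV[R]_n) (f : 'rV[R]_n -> R) (x : 'rV[R]_n) : R :=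
  'D_v (fun z => f (op x z) : R^o) 0.

End left_invariant.

(* A Carnot group identified with R^n by exponential coordinates: the exponential
   map is the identity exactly when the lines s |-> s *: x are the one-parameter
   subgroups; in particular the inverse of x is - x. That Lebesgue measure is a
   Haar measure is part of the setting. *)
Record carnot_group (R : realType) (n : nat) := CarnotGroup {
  cg_op :> 'rV[R]_n -> 'rV[R]_n -> 'rV[R]_n;
  cg_step : nat;
  cg_layer : nat -> {vspace 'rV[R]_n};
  cg_smooth : smooth_on setT
    (fun p : 'rV[R]_n * 'rV[R]_n => cg_op p.1 p.2);
  cg_opA : associative cg_op;
  cg_op0l : left_id 0 cg_op;
  cg_op0r : right_id 0 cg_op;
  cg_exp : forall (x : 'rV[R]_n) (s t : R),
    cg_op (s *: x) (t *: x) = (s + t) *: x;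
  cg_step_gt0 : (0 < cg_step)%N;
  cg_directv : directv (\sum_(i < cg_step) cg_layer i.+1);
  cg_sumv : (\sum_(i < cg_step) cg_layer i.+1 = fullv)%VS;
  cg_bracket : forall i, (0 < i)%N ->
    bracket_space cg_op (cg_layer 1) (cg_layer i) (cg_layer i.+1);
  cg_layer_step : cg_layer cg_step != 0%VS;
  cg_layer_gt : forall i, (cg_step < i)%N -> cg_layer i = 0%VS;
  cg_haar : forall (x : 'rV[R]_n) (A : set 'rV[R]_n), measurable A ->
    leb R n (cg_op x @^-1` A) = leb R n A }.

Section convolution.
Context (R : realType) (n : nat) (G : carnot_group R n).
Local Open Scope ereal_scope.

(* With the library's convention +oo - oo = -oo, the integral is finite only if
   it converges absolutely. *)
Definition convolution (f g : 'rV[R]_n -> \bar R) (x : 'rV[R]_n) : \bar R :=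
  \int[leb R n]_y (f y * g (G (- y)%R x)).

End convolution.

(** * The sub-Laplacian *)

Section sublaplacian.
Context (R : realType) (n m : nat) (G : carnot_group R n).
Variable X : m.-tuple 'rV[R]_n.

Definition sublap (f : 'rV[R]_n -> R) (x : 'rV[R]_n) : R :=
  - \sum_(j < m) lie_derive G (tnth X j) (lie_derive G (tnth X j) f) x.

(* The graph of the self-adjoint operator in L^2: the closure of the
   sub-Laplacian on test functions (where it is essentially self-adjoint). *)
Definition sublap_graph (u w : 'rV[R]_n -> R) : Prop :=
  [/\ L2 (leb R n) u, L2 (leb R n) w &
    exists f : nat -> 'rV[R]_n -> R,
    [/\ forall k, test_function (f k),
      normL2 (leb R n) (f k \- u) @[k --> \oo] --> 0%E &
      normL2 (leb R n) (sublap (f k) \- w) @[k --> \oo] --> 0%E]].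

End sublaplacian.

(** * Spectral resolutions in a real L^2 space *)

Section spectral.
Context d (T : measurableType d) (R : realType).
Variable mu : {measure set T -> \bar R}.

(* A resolution of the identity of L^2(mu) carried by [0, +oo[: an increasing,
   strongly right-continuous family of orthogonal projections. *)
Record spectral_family := SpectralFamily {
  sf_proj :> R -> (T -> R) -> (T -> R);
  sf_L2 : forall l u, L2 mu u -> L2 mu (sf_proj l u);
  sf_linear : forall l c u v, L2 mu u -> L2 mu v ->
    sf_proj l (fun x => c * u x + v x) =
      (fun x => c * sf_proj l u x + sf_proj l v x) %[ae mu];
  sf_sym : forall l u v, L2 mu u -> L2 mu v ->
    dotL2 mu (sf_proj l u) v = dotL2 mu u (sf_proj l v);
  sf_mul : forall l k u, L2 mu u ->
    sf_proj l (sf_proj k u) = sf_proj (Num.min l k) u %[ae mu];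
  sf_rcont : forall l u, L2 mu u ->
    normL2 mu (sf_proj k u \- sf_proj l u) @[k --> l^'+] --> 0%E;
  sf_neg : forall l u, l < 0 -> L2 mu u ->
    sf_proj l u = cst 0 %[ae mu];
  sf_top : forall u, L2 mu u ->
    normL2 mu (sf_proj l u \- u) @[l --> +oo] --> 0%E }.

(* The unfolding of lebesgue_stieltjes_measure, which wants F to come with
   proofs that it is nondecreasing and right-continuous. *)
Definition stieltjes (F : R -> R) : set (measurableTypeR R) -> \bar R :=
  mu_ext (wlength F).

Lemma stieltjesE (F : cumulative R R) :
  stieltjes F = lebesgue_stieltjes_measure F.
Proof. by []. Qed.

Variable E : spectral_family.

(* The measure d<E(l)u, u>. *)
Definition spectral_measure (u : T -> R) : set (measurableTypeR R) -> \bar R :=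
  stieltjes (fun l => dotL2 mu (E l u) u).

Definition spectral_dom (f : R -> R) (u : T -> R) : Prop :=
  L2 mu u /\
  (\int[spectral_measure u]_(l in `[0%R, +oo[) ((f l) ^+ 2)%:E < +oo)%E.

(* v is the integral of f(l) dE(l)u over [0, +oo[, i.e. <v, w> is the integral of
   f(l) d<E(l)u, w> for all w in the (dense) domain; the measure d<E(l)u, w> is
   (d<E(l)(u + w), u + w> - d<E(l)(u - w), u - w>) / 4. *)
Definition spectral_integral (f : R -> R) (u v : T -> R) : Prop :=
  [/\ spectral_dom f u, L2 mu v &
    forall w, spectral_dom f w ->
      (4 * dotL2 mu v w)%:E =
        (\int[spectral_measure (u \+ w)%R]_(l in `[0%R, +oo[) (f l)%:E -
         \int[spectral_measure (u \- w)%R]_(l in `[0%R, +oo[) (f l)%:E)%E].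

(* The function f(L)u, for the operator L resolved by E. *)
Definition spectral_apply (f : R -> R) (u : T -> R) : T -> R :=
  xget (cst 0) [set v | spectral_integral f u v].

Definition spectral_resolution_of (L : (T -> R) -> (T -> R) -> Prop) : Prop :=
  forall u v, L u v <-> spectral_integral id u v.

End spectral.

(** * The heat kernel, the function phi and the Poisson kernel *)

Definition heat_kernel (R : realType) (n m : nat) (G : carnot_group R n)
    (X : m.-tuple 'rV[R]_n) (E : spectral_family (leb R n))
    (h : R -> 'rV[R]_n -> R) : Prop :=
  [/\ smooth_on [set p : R^o * 'rV[R]_n | 0 < p.1]
        (fun p => h p.1 p.2 : R^o),
    forall t x, 0 < t -> derive1 (fun s => h s x : R^o) t + sublap G X (h t) x = 0 &
    forall t u, 0 < t -> L2 (leb R n) u ->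
      EFin \o spectral_apply E (fun l => expR (- t * l)) u =
      convolution G (EFin \o u) (EFin \o h t) %[ae leb R n]].

Section kernels.
Context (R : realType).

Definition Gamma (s : R) : R :=
  \int[lebesgue_measure]_(t in `]0%R, +oo[) (t `^ (s - 1) * expR (- t)).

(* The modified Bessel function of the second kind, for z > 0:
   the integral over s > 0 of exp (- z cosh s) cosh (nu s). *)
Definition besselK (nu z : R) : R :=
  let cosh s := (expR s + expR (- s)) / 2 in
  \int[lebesgue_measure]_(s in `]0%R, +oo[) (expR (- z * cosh s) * cosh (nu * s)).

Definition alpha (a : R) : R := - (2 * a / (1 - a)).

Definition kexp (a : R) : R := (2 - alpha a) / 2.

Definition calpha (a : R) : R :=
  let k := kexp a in
  2 `^ (1 - (2 * k)^-1) * (Gamma (2 * k)^-1)^-1 * k `^ (- (2 * k)^-1).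

(* At t = 0, where besselK is singular, the value is the limit 1. *)
Definition phi (a t : R) : R :=
  let k := kexp a in
  if t == 0 then 1
  else calpha a * t `^ 2^-1 * besselK (2 * k)^-1 (k^-1 * t `^ k).

Definition theta (a : R) : R := (1 - a) `^ (a - 1).

Definition poisson_const (a : R) : R := 2 `^ (a - 1) / Gamma ((1 - a) / 2).

Definition poisson_kernel n (h : R -> 'rV[R]_n -> R) (a y : R)
    (x : 'rV[R]_n) : \bar R :=
  ((poisson_const a * y `^ (1 - a))%:E *
   \int[lebesgue_measure]_(t in `]0%R, +oo[)
     (t `^ ((a - 3) / 2) * expR (- (y ^+ 2 / (4 * t))) * h t x)%:E)%E.

End kernels.

(* Main.v *)
(** Writing s = (1 - a) / 2, an integral representation of K_s turns the multiplier phi into a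
    Laplace transform: phi (theta * y^(1-a) * l^s) = C_a y^(1-a) int_0^oo t^(-1-s) e^(-y^2/4t)
    e^(-tl) dt for l >= 0. Hence v is an average of the functions e^(-tL) u = u * h t, and
    Tonelli's theorem, applied after pairing with an arbitrary L2 function, exchanges this average
    with the convolution.

    Tonelli needs h >= 0. By right invariance of Haar measure and second difference quotients
    along one-parameter subgroups, <L f, min (f, 0)> >= 0 for test functions f, hence on the
    domain of L; so (1 + e L)^-1 preserves positivity, and so does
    e^(-tL) = lim_n (1 + (t/n) L)^-n. *)

Require Import Defs.
From HB Require Import structures.
From mathcomp Require Import all_boot all_order all_algebra.
From mathcomp Require Import all_classical all_reals all_analysis.
From mathcomp Require Import measurable_realfun.
From mathcomp Require Import ring lra.

Set Implicit Arguments.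
Unset Strict Implicit.
Unset Printing Implicit Defensive.

Import Order.TTheory GRing.Theory Num.Theory.
Import numFieldNormedType.Exports.

Local Open Scope classical_set_scope.
Local Open Scope ring_scope.

(** * The Laplace representation of phi *)

(** [spectral_apply] picks a value by choice, so it says nothing until a vector with the right
    pairings is known to exist. For e^(-tl) and (1 + e l)^-1 the superlevel sets are half-lines;
    such a multiplier is a uniform limit of positive combinations of indicators of ]-oo, s], whose
    operators are the projections E(s). For the Poisson multiplier the witness is the convolution
    itself. The measures d<E(l)u, w> are signed and l is unbounded, so identities between them are
    written with nonnegative terms on both sides, checked on half-lines and extended to all
    nonnegative functions.

    The negative part of a test function is not differentiable in general; integration by parts is
    replaced by a discrete version in which only the monotonicity of r -> min (r, 0) enters.
    Positivity of e^(-tL)u holds almost everywhere, and becomes pointwise positivity of h by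
    continuity, tested on indicators of small boxes. For u >= 0 the convolution with the Poisson
    kernel is a priori only [0, +oo]-valued; that it is finite almost everywhere and in L2 follows
    from the bound 1 on the multiplier, applied to truncations. *)

Section change_of_variables.
Context (R : realType).
Local Notation mu := (@lebesgue_measure R).
Implicit Types (G f : R -> R) (c : R).

Lemma bigcup_sym_itv : \bigcup_n `[(- n%:R : R), n%:R]%classic = [set: R].
Proof.
rewrite -subTset => x _; exists (Num.bound `|x|) => //=.
by rewrite in_itv/= -ler_norml ltW// (archi_boundP (normr_ge0 x)).
Qed.

Lemma bigcup_expR_itv :
  \bigcup_n `[expR (- n%:R : R), expR n%:R]%classic = `]0, +oo[%classic.
Proof.
apply/seteqP; split => [x [n _]|x]/=; rewrite !in_itv/= ?andbT.
  by move=> /andP[+ _]; apply: lt_le_trans; exact: expR_gt0.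
move=> /expR_total[z <-]; have : setT z by [].
rewrite -bigcup_sym_itv => -[n _]/=; rewrite in_itv/= => /andP[nz zn].
by exists n => //=; rewrite in_itv/= !ler_expR nz zn.
Qed.

(** The substitution t = e^x is made on the compact intervals [-n, n], and monotone convergence on
    both sides lets n tend to infinity. *)
Lemma integral_expR G : {in `]0, +oo[, continuous G} ->
    (forall x, 0 < x -> 0 <= G x) ->
  (\int[mu]_(t in `]0%R, +oo[) (G t)%:E =
   \int[mu]_x (G (expR x) * expR x)%:E)%E.
Proof.
move=> cG G0.
have mG : measurable_fun (`]0%R, +oo[%classic : set R) G.
  apply: open_continuous_measurable_fun => //.
  by move=> x /set_mem; exact: cG.
have cGE : continuous (fun x => G (expR x) * expR x).
  move=> x; apply: cvgM; last exact: continuous_expR.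
  apply: (@cvg_comp _ _ _ expR G); first exact: continuous_expR.
  by apply: cG; rewrite in_itv/= expR_gt0.
have mGE : measurable_fun setT (fun x => G (expR x) * expR x).
  exact: continuous_measurable_fun.
rewrite -bigcup_expR_itv -bigcup_sym_itv.
have cvg1 := @ge0_nondecreasing_set_cvg_integral _ (measurableTypeR R) R
  (fun n => `[expR (- n%:R : R), expR n%:R]%classic) (fun x => (G x)%:E) mu.
have cvg2 := @ge0_nondecreasing_set_cvg_integral _ (measurableTypeR R) R
  (fun n => `[(- n%:R : R), n%:R]%classic) (fun x => (G (expR x) * expR x)%:E) mu.
have subE n : `[expR (- n%:R : R), expR n%:R]%classic `<=` `]0, +oo[%classic.
  move=> x /=; rewrite !in_itv/= andbT => /andP[+ _].
  by apply: lt_le_trans; exact: expR_gt0.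
have {}cvg1 := cvg1 _ _ _ _; have {}cvg2 := cvg2 _ _ _ _.
rewrite -(cvg_lim _ (cvg1 _ _ _ _))//; first last.
- by move=> n x /subE/=; rewrite in_itv/= andbT lee_fin => /G0.
- by move=> n; apply/measurable_EFinP; apply: measurable_funS mG.
- move=> i j ij; apply/subsetPset => x/=; rewrite !in_itv/= => /andP[h1 h2].
  rewrite (le_trans _ h1)/= ?(le_trans h2)// ler_expR ?lerN2 ler_nat//.
rewrite -(cvg_lim _ (cvg2 _ _ _ _))//; first last.
- by move=> n x _; rewrite lee_fin mulr_ge0 ?expR_ge0// G0// expR_gt0.
- by move=> n; apply/measurable_EFinP; exact: measurable_funTS.
- move=> i j ij; apply/subsetPset => x/=; rewrite !in_itv/= => /andP[h1 h2].
  rewrite (le_trans _ h1)/= ?(le_trans h2)// ?lerN2 ler_nat//.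
congr (limn _); apply/funext => n.
have DE : derive1 (@expR R) = @expR R.
  by apply/funext => x; rewrite derive1E derive_val.
rewrite (@integration_by_substitution_increasing _ expR G (- n%:R) n%:R).
- by apply: eq_integral => x _; rewrite /= DE.
- by rewrite lerNl (le_trans (y := 0))// oppr_le0.
- by move=> x y _ _; rewrite ltr_expR.
- by move=> x _; rewrite DE; exact: continuous_expR.
- by rewrite DE; apply/cvg_ex; exists (expR (- n%:R)); apply: cvg_at_right_filter;
  exact: continuous_expR.
- by rewrite DE; apply/cvg_ex; exists (expR n%:R); apply: cvg_at_left_filter;
  exact: continuous_expR.
- split; first by move=> x _; exact: derivable_expR.
    by apply: cvg_at_right_filter; exact: continuous_expR.
  by apply: cvg_at_left_filter; exact: continuous_expR.
- apply: continuous_in_subspaceT => x /set_mem/subE xE.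
  by apply: cG.
Qed.

(** Folding the line at 0 produces the cosh of the Bessel integral, and in the Gamma integral it
    pairs each point with its mirror image so that both are dominated by the same exponential. *)
Lemma integral_fold f : continuous f -> (forall x, 0 <= f x) ->
  (\int[mu]_x (f x)%:E = \int[mu]_(x in `[0%R, +oo[) (f x + f (- x)%R)%:E)%E.
Proof.
move=> cf f0.
have mf : measurable_fun setT f by exact: continuous_measurable_fun.
have mfN : measurable_fun setT (fun x : R => f (- x)).
  by apply: measurableT_comp => //; exact: measurable_oppr.
have <- : `]-oo, 0%R]%classic `|` `]0%R, +oo[%classic = [set: R].
  by rewrite -setCitvl setUv.
rewrite ge0_integral_setU//=; last 3 first.
- by apply/measurable_EFinP; exact: measurable_funTS.
- by move=> x _; rewrite lee_fin.
- apply/disj_set2P; rewrite -subset0 => x []/=; rewrite !in_itv/= andbT.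
  by move=> x0 /(le_lt_trans x0); rewrite ltxx.
rewrite integral_itv_obnd_cbnd; last by apply/measurable_EFinP; exact: measurable_funTS.
have := @ge0_integration_by_substitutionNy R f 0; rewrite oppr0 => ->//; first last.
  exact: continuous_subspaceT.
under [RHS]eq_integral do rewrite EFinD.
rewrite ge0_integralD//; first by rewrite addeC.
- by move=> x _; rewrite lee_fin.
- by apply/measurable_EFinP; exact: measurable_funTS.
- by move=> x _; rewrite lee_fin.
- by apply/measurable_EFinP; exact: measurable_funTS.
Qed.

Lemma integral_reflect f : continuous f -> (forall x, 0 <= f x) ->
  (\int[mu]_x (f (- x)%R)%:E = \int[mu]_x (f x)%:E)%E.
Proof.
move=> cf f0; rewrite [RHS]integral_fold// integral_fold//.
  by apply: eq_integral => x _; rewrite opprK addrC.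
by move=> x; apply: (@cvg_comp _ _ _ -%R f); [exact: opp_continuous|exact: cf].
Qed.

Lemma integral_translate f c : continuous f -> (forall x, 0 <= f x) ->
  (\int[mu]_x (f (x + c)%R)%:E = \int[mu]_x (f x)%:E)%E.
Proof.
move=> cf f0.
have DE : derive1 (fun x : R => x + c) = cst 1 :> (R -> R).
  by apply/funext => x; rewrite derive1E derive_val addr0.
rewrite [RHS](@increasing_ge0_integration_by_substitutionT _ (fun x => x + c)).
- by apply: eq_integral => x _; rewrite /= DE mulr1.
- by move=> x y; rewrite ltrD2r.
- by rewrite DE; exact: cst_continuous.
- by rewrite DE; exact: is_cvg_cst.
- by rewrite DE; exact: is_cvg_cst.
- by [].
- apply: cvg_addrr_Ny.
- apply: cvg_addrr.
- exact: cf.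
- exact: f0.
Qed.

End change_of_variables.

(** * The Gamma integral in logarithmic coordinates *)

Section gamma_bessel.
Context (R : realType).
Local Notation mu := (@lebesgue_measure R).

Lemma continuous_powR (r : R) : {in `]0, +oo[, continuous (@powR R ^~ r)}.
Proof.
move=> x x0; apply: differentiable_continuous; apply/derivable1_diffP.
exact: derivable_powR.
Qed.

Lemma expR_powR (r x : R) : (expR x) `^ r = expR (r * x).
Proof. by rewrite mulrC expRM. Qed.

(** The integrand of Gamma (s) in the variable x = ln t, Jacobian included. *)
Definition gamma_log (s x : R) : R := expR (s * x) * expR (- expR x).

Lemma continuous_gamma_log s : continuous (gamma_log s).
Proof.
move=> x; apply: cvgM.
  apply: continuous_comp; last exact: continuous_expR.
  exact: mulrl_continuous.
apply: continuous_comp; last exact: continuous_expR.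
by apply: cvgN; exact: continuous_expR.
Qed.

Lemma gamma_log_ge0 s x : 0 <= gamma_log s x.
Proof. by rewrite mulr_ge0// expR_ge0. Qed.

Lemma integral_gamma_log s :
  (\int[mu]_(t in `]0%R, +oo[) (t `^ (s - 1) * expR (- t))%:E =
   \int[mu]_x (gamma_log s x)%:E)%E.
Proof.
rewrite (@integral_expR R (fun t => t `^ (s - 1) * expR (- t))).
- apply: eq_integral => x _; congr EFin; rewrite /gamma_log.
  by rewrite expR_powR -!expRD; congr expR; ring.
- move=> x x0; apply: cvgM; first exact: continuous_powR.
  by apply: continuous_comp; [exact: opp_continuous|exact: continuous_expR].
- by move=> x x0; rewrite mulr_ge0 ?powR_ge0 ?expR_ge0.
Qed.

Lemma integral_expRN (s : R) : 0 < s ->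
  (\int[mu]_(x in `[0%R, +oo[) (expR (- s * x))%:E = (s^-1)%:E)%E.
Proof.
move=> s0; have := integral_exponential_pdf s0.
have -> : (\int[mu]_x (exponential_pdf s x)%:E =
    \int[mu]_(x in `[0%R, +oo[) (s * expR (- s * x))%:E)%E.
  rewrite [RHS]integral_mkcond; apply: eq_integral => x _.
  by rewrite /exponential_pdf !patchE; case: ifPn.
under eq_integral do rewrite EFinM.
rewrite ge0_integralZl//; first last.
- by rewrite lee_fin ltW.
- apply/measurable_EFinP; apply: measurable_funTS.
  apply: (measurableT_comp (@measurable_expR R)).
  exact: measurable_funM.
move=> H.
have -> : (s^-1)%:E = (s^-1%:E * 1)%E by rewrite mule1.
by rewrite -H muleA -EFinM mulVf ?gt_eqF// mul1e.
Qed.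

(** Each of the two terms is at most e^(-sx): the first because 2 s x <= 2 x <= e^x, the second
    because its double exponential factor is at most 1. *)
Lemma gamma_log_fold_le s x : 0 < s -> s < 1 -> 0 <= x ->
  gamma_log s x + gamma_log s (- x) <= 2 * expR (- s * x).
Proof.
move=> s0 s1 x0; rewrite (_ : 2 = 1 + 1)// mulrDl mul1r lerD//.
- rewrite /gamma_log -expRD ler_expR.
  (* e^x is the square of e^(x/2) >= 1 + x/2, and (1 + x/2)^2 - 2x is the square of 1 - x/2. *)
  have e2 : 2 * x <= expR x.
    have -> : expR x = expR (x / 2) ^+ 2 by rewrite -expRM_natr; congr expR; field.
    have h := expR_ge1Dx (x / 2).
    apply: (@le_trans _ _ ((1 + x / 2) ^+ 2)).
      by rewrite -subr_ge0 (_ : _ - _ = (1 - x / 2) ^+ 2) ?sqr_ge0//; field.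
    by rewrite ler_sqr ?nnegrE// ?expR_ge0//; nra.
  by nra.
- rewrite /gamma_log mulrN mulNr ger_pMr ?expR_gt0//.
Qed.

Lemma gamma_log_fold_ge s x : 0 <= x ->
  expR (- 1) * expR (- s * x) <= gamma_log s x + gamma_log s (- x).
Proof.
move=> x0; rewrite -[leLHS]add0r lerD ?gamma_log_ge0//.
rewrite /gamma_log mulrN mulNr mulrC ler_pM2l ?expR_gt0// ler_expR lerN2.
by rewrite -[leRHS]expR0 ler_expR oppr_le0.
Qed.

(** [Gamma] is the real part of an extended integral and means something only once that integral is
    finite. The exponential bounds on the folded integrand give finiteness, and also the positivity
    needed to divide by [Gamma]; the range 0 < s < 1 is that of (1 - a) / 2. *)
Lemma GammaE s : 0 < s < 1 ->
  (\int[mu]_x (gamma_log s x)%:E = (Gamma s)%:E)%E /\ 0 < Gamma s.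
Proof.
move=> /andP[s0 s1].
have mg : measurable_fun setT (gamma_log s).
  by apply: continuous_measurable_fun; exact: continuous_gamma_log.
have mgN : measurable_fun setT (fun x : R => gamma_log s (- x)).
  by apply: measurableT_comp.
have mf : measurable_fun (`[0, +oo[%classic : set R)
    (fun x => (gamma_log s x + gamma_log s (- x))%:E).
  by apply/measurable_EFinP; apply: measurable_funTS; exact: measurable_funD.
have me (c : R) : measurable_fun (`[0, +oo[%classic : set R)
    (fun x => (c * expR (- s * x))%:E).
  apply/measurable_EFinP; apply: measurable_funTS; apply: measurable_funM => //.
  apply: (measurableT_comp (@measurable_expR R)).
  exact: measurable_funM.
have ie (c : R) : 0 <= c ->
    (\int[mu]_(x in `[0%R, +oo[) (c * expR (- s * x))%:E = (c / s)%:E)%E.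
  move=> c0; under eq_integral do rewrite EFinM.
  rewrite ge0_integralZl//; first by rewrite integral_expRN.
  - apply/measurable_EFinP; apply: measurable_funTS.
    apply: (measurableT_comp (@measurable_expR R)).
    exact: measurable_funM.
have up : (\int[mu]_x (gamma_log s x)%:E <= (2 / s)%:E)%E.
  rewrite integral_fold//; [|exact: continuous_gamma_log|exact: gamma_log_ge0].
  rewrite -ie//; apply: ge0_le_integral => //.
  - by move=> x _; rewrite lee_fin addr_ge0 ?gamma_log_ge0.
  - exact: me.
  - move=> x /=; rewrite in_itv/= andbT => x0.
    by rewrite lee_fin gamma_log_fold_le.
have lo : ((expR (- 1) / s)%:E <= \int[mu]_x (gamma_log s x)%:E)%E.
  rewrite integral_fold//; [|exact: continuous_gamma_log|exact: gamma_log_ge0].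
  rewrite -ie ?expR_ge0//; apply: ge0_le_integral => //.
  - exact: me.
  - move=> x /=; rewrite in_itv/= andbT => x0.
    by rewrite lee_fin gamma_log_fold_ge.
have E : (\int[mu]_x (gamma_log s x)%:E = (Gamma s)%:E)%E.
  rewrite /Gamma /Rintegral integral_gamma_log fineK//.
  by rewrite ge0_fin_numE ?(le_lt_trans up) ?ltry//; apply: integral_ge0 => x _;
    rewrite lee_fin gamma_log_ge0.
split => //; rewrite -lte_fin -E (lt_le_trans _ lo)// lte_fin divr_gt0// expR_gt0.
Qed.

End gamma_bessel.

(** * The Laplace transform of the Poisson weight *)

Section laplace.
Context (R : realType).
Local Notation mu := (@lebesgue_measure R).
Variables (a y : R).
Hypotheses (ha : -1 < a < 1) (hy : 0 < y).

Definition poisson_weight (t : R) : R :=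
  t `^ ((a - 3) / 2) * expR (- (y ^+ 2 / (4 * t))).

Lemma poisson_weight_ge0 t : 0 <= poisson_weight t.
Proof. by rewrite mulr_ge0 ?powR_ge0 ?expR_ge0. Qed.

Lemma continuous_poisson_weight : {in `]0, +oo[, continuous poisson_weight}.
Proof.
move=> t /[dup] t0; rewrite in_itv/= andbT => t_gt0.
apply: cvgM; first exact: continuous_powR.
apply: continuous_comp; last exact: continuous_expR.
apply: cvgN; apply: cvgM; first exact: cvg_cst.
apply: cvgV; first by rewrite mulf_neq0// gt_eqF.
exact: mulrl_continuous.
Qed.

Let s := (1 - a) / 2.
Let s01 : 0 < s < 1. Proof. by move: ha => /andP[h1 h2]; apply/andP; split; rewrite /s; lra. Qed.

Let laplace_log (l x : R) : R :=
  expR (- s * x) * expR (- (y ^+ 2 / 4 * expR (- x))) * expR (- expR x * l).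

Let continuous_laplace_log l : continuous (laplace_log l).
Proof.
have cE (c : R) : continuous (fun x : R => expR (c * x)).
  move=> x; apply: continuous_comp; last exact: continuous_expR.
  exact: mulrl_continuous.
move=> x; apply: cvgM; first apply: cvgM; first exact: cE.
- apply: continuous_comp; last exact: continuous_expR.
  apply: cvgN; apply: cvgM; first exact: cvg_cst.
  by apply: continuous_comp; [exact: opp_continuous|exact: continuous_expR].
- apply: continuous_comp; last exact: continuous_expR.
  apply: cvgM; last exact: cvg_cst.
  by apply: cvgN; exact: continuous_expR.
Qed.

Let laplace_log_ge0 l x : 0 <= laplace_log l x.
Proof. by rewrite !mulr_ge0// expR_ge0. Qed.

Let laplaceE l :
  (\int[mu]_(t in `]0%R, +oo[) (poisson_weight t * expR (- t * l))%:E =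
   \int[mu]_x (laplace_log l x)%:E)%E.
Proof.
rewrite (@integral_expR R (fun t => poisson_weight t * expR (- t * l))).
- apply: eq_integral => x _; congr EFin; rewrite /laplace_log /poisson_weight.
  rewrite expR_powR mulrAC; congr (_ * _).
  by rewrite invfM -expRN mulrA -!expRD; congr expR; rewrite /s; field.
- move=> t t0; apply: cvgM; first exact: continuous_poisson_weight.
  apply: continuous_comp; last exact: continuous_expR.
  by apply: cvgM; [apply: cvgN; exact: cvg_id|exact: cvg_cst].
- by move=> t t0; rewrite mulr_ge0 ?poisson_weight_ge0 ?expR_ge0.
Qed.

(** The substitution r = y^2 / (4t), a reflection followed by a translation in logarithmic
    coordinates, gives Gamma (s) (y^2/4)^(-s). This is the origin of C_a: it normalises the total
    mass to 1. *)
Lemma integral_poisson_weight :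
  (\int[mu]_(t in `]0%R, +oo[) (poisson_weight t)%:E =
   ((poisson_const a * y `^ (1 - a))^-1)%:E)%E.
Proof.
have [GE G0] := GammaE s01.
transitivity (\int[mu]_(t in `]0%R, +oo[) (poisson_weight t * expR (- t * 0))%:E)%E.
  by apply: eq_integral => t _; rewrite mulr0 expR0 mulr1.
rewrite laplaceE.
have c0 : 0 < y ^+ 2 / 4 by rewrite divr_gt0// exprn_gt0.
set c := y ^+ 2 / 4 in c0 *.
have -> : (\int[mu]_x (laplace_log 0 x)%:E =
    \int[mu]_x ((c `^ (- s)) * gamma_log s (- x + ln c))%:E)%E.
  apply: eq_integral => x _; congr EFin.
  rewrite /laplace_log /gamma_log -/c mulr0 expR0 mulr1.
  rewrite -{2}(lnK c0) expR_powR expRD lnK// mulrA [expR (- x) * c]mulrC.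
  by rewrite -!expRD; congr expR; ring.
under eq_integral do rewrite EFinM.
have cg : continuous (fun x => gamma_log s (x + ln c)).
  move=> x; apply: (@cvg_comp _ _ _ (fun x => x + ln c) (gamma_log s)).
    by apply: cvgD; [exact: cvg_id|exact: cvg_cst].
  exact: continuous_gamma_log.
rewrite ge0_integralZl//; first last.
- by rewrite lee_fin powR_ge0.
- by move=> x _; rewrite lee_fin gamma_log_ge0.
- apply/measurable_EFinP; apply: continuous_measurable_fun => x.
  apply: (@cvg_comp _ _ _ -%R (fun x => gamma_log s (x + ln c))).
    exact: opp_continuous.
  exact: cg.
rewrite (@integral_reflect R (fun x => gamma_log s (x + ln c)))//; last first.
  by move=> x; exact: gamma_log_ge0.
rewrite integral_translate//; [|exact: continuous_gamma_log|exact: gamma_log_ge0].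
rewrite GE -EFinM /poisson_const -/s; congr EFin.
rewrite {}/c in c0 cg *.
(* Writing y = e^Y and 2 = e^B turns every real power into an exponential, and the identity becomes
   one between linear exponents. *)
have [Y yE] := expR_total hy; have [B BE] := @expR_total R 2 ltac:(by []).
have -> : y ^+ 2 / 4 = expR (2 * Y - 2 * B).
  by rewrite expRB !expRM_natl yE BE -natrX.
have e1 : 2 `^ (a - 1) = expR ((a - 1) * B) by rewrite -BE expR_powR.
rewrite e1 -yE !expR_powR mulrAC -expRD invfM invrK -expRN.
by congr (expR _ * _); rewrite /s; field.
Qed.

Let lt_laplace l : 0 <= l ->
  (\int[mu]_(t in `]0%R, +oo[) (poisson_weight t * expR (- t * l))%:E < +oo)%E.
Proof.
move=> l0; apply: (@le_lt_trans _ _ (\int[mu]_(t in `]0%R, +oo[) (poisson_weight t)%:E)%E).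
  have mw : measurable_fun (`]0, +oo[%classic : set R) poisson_weight.
    apply: open_continuous_measurable_fun => //.
    by move=> x /set_mem; exact: continuous_poisson_weight.
  apply: ge0_le_integral => //.
  - by move=> t _; rewrite lee_fin mulr_ge0 ?poisson_weight_ge0 ?expR_ge0.
  - apply/measurable_EFinP; apply: measurable_funM => //; apply: measurable_funTS.
    apply: (measurableT_comp (@measurable_expR R)).
    by apply: measurable_funM => //; apply: measurableT_comp.
  - by apply/measurable_EFinP.
  - move=> t /=; rewrite in_itv/= andbT => t0; rewrite lee_fin.
    rewrite ler_piMr ?poisson_weight_ge0//.
    by rewrite -[leRHS]expR0 ler_expR mulNr oppr_le0 mulr_ge0// ltW.
by rewrite integral_poisson_weight ltry.
Qed.

Let laplace_bessel l : 0 < l ->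
  (\int[mu]_(t in `]0%R, +oo[) (poisson_weight t * expR (- t * l))%:E =
   (2 * (y / (2 * l `^ 2^-1)) `^ (- s) * besselK s (y * l `^ 2^-1))%:E)%E.
Proof.
move=> l0.
have [Y yE] := expR_total hy; have [B BE] := @expR_total R 2 ltac:(by []).
have [L lE] := expR_total l0.
(* x0 = ln (y / (2 sqrt l)) is the point where y^2/4 e^(-x) and l e^x are equal, both to z/2 with z
   = y sqrt l. Centred there, their sum is z cosh x, and folding turns e^(-sx) into 2 cosh (sx). *)
pose x0 := Y - B - L / 2; pose z := expR (Y + L / 2).
have -> : y * l `^ 2^-1 = z.
  by rewrite -yE -lE expR_powR -expRD; congr expR; rewrite /z; field.
have -> : (y / (2 * l `^ 2^-1)) `^ (- s) = expR (- s * x0).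
  rewrite -yE -lE expR_powR -[X in _ / (X * _)]BE -expRD -expRB expR_powR.
  by congr expR; rewrite /x0; field.
pose I (x : R) := expR (- z * ((expR x + expR (- x)) / 2)) *
  ((expR (s * x) + expR (- (s * x))) / 2).
have cE (c : R) : continuous (fun x : R => expR (c * x)).
  move=> x; apply: continuous_comp; last exact: continuous_expR.
  exact: mulrl_continuous.
have cEN : continuous (fun x : R => expR (- x)).
  by move=> x; apply: continuous_comp; [exact: opp_continuous|exact: continuous_expR].
have cch : continuous (fun x : R => expR (- z * ((expR x + expR (- x)) / 2))).
  move=> x; apply: continuous_comp; last exact: continuous_expR.
  apply: cvgM; first exact: cvg_cst.
  apply: cvgM; last exact: cvg_cst.
  by apply: cvgD; [exact: continuous_expR|exact: cEN].
have cEm : continuous (fun x : R => expR (- (s * x))).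
  have -> : (fun x => expR (- (s * x))) = (fun x => expR (- s * x)).
    by apply/funext => u; rewrite mulNr.
  exact: cE.
have cI : continuous I.
  move=> x; apply: cvgM; first exact: cch.
  apply: cvgM; last exact: cvg_cst.
  apply: cvgD; first exact: cE.
  exact: cEm.
have I0 x : 0 <= I x by rewrite !mulr_ge0 ?expR_ge0// addr_ge0 ?expR_ge0.
have zE : z / 2 = expR (Y + L / 2 - B) by rewrite expRB BE.
have E1 : (\int[mu]_(t in `]0%R, +oo[) (poisson_weight t * expR (- t * l))%:E =
    (2 * expR (- s * x0))%:E * \int[mu]_(x in `]0%R, +oo[) (I x)%:E)%E.
  rewrite laplaceE -(@integral_translate R _ x0)//.
  have -> : (\int[mu]_x (laplace_log l (x + x0))%:E =
    \int[mu]_x (expR (- s * x0) * (expR (- s * x) * expR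
      (- z * ((expR x + expR (- x)) / 2))))%:E)%E.
    apply: eq_integral => x _; congr EFin; rewrite /laplace_log.
    rewrite mulrA -!expRD; congr expR.
    have -> : y ^+ 2 / 4 * expR (- (x + x0)) = z / 2 * expR (- x).
      have -> : y ^+ 2 / 4 = expR (2 * Y - 2 * B).
        by rewrite expRB !expRM_natl yE BE -natrX.
      by rewrite zE -!expRD; congr expR; rewrite /x0; field.
    have -> : - expR (x + x0) * l = - (z / 2 * expR x).
      rewrite mulNr -lE -expRD zE -expRD; congr (- expR _).
      by rewrite /x0; field.
    by field.
  under eq_integral do rewrite EFinM.
  have cf : continuous (fun x : R => expR (- s * x) * expR (- z * ((expR x + expR (- x)) / 2))).
    by move=> x; apply: cvgM; [exact: cE|exact: cch].
  rewrite ge0_integralZl//; first last.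
  - by apply/measurable_EFinP; exact: continuous_measurable_fun.
  rewrite integral_fold//.
  rewrite [X in (_ = _ * X)%E]integral_itv_obnd_cbnd; last first.
    by apply/measurable_EFinP; apply: measurable_funTS; exact: continuous_measurable_fun.
  rewrite [(2 * _)%R]mulrC EFinM -muleA; congr (_ * _)%E.
  rewrite -ge0_integralZl//; first last.
  - by move=> x _; rewrite lee_fin.
  - by apply/measurable_EFinP; apply: measurable_funTS; exact: continuous_measurable_fun.
  apply: eq_integral => x _; congr EFin; rewrite /I opprK.
  rewrite [expR (- x) + _]addrC mulrNN (_ : - s * x = - (s * x)); last by ring.
  by field.
rewrite E1 [RHS]EFinM; congr (_ * _)%E.
rewrite /besselK /Rintegral fineK//.
rewrite ge0_fin_numE; last by apply: integral_ge0 => x _; rewrite lee_fin.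
(* Finiteness of the Bessel integral is read off from the Laplace integral, of which it is a
   positive multiple. *)
have := lt_laplace (ltW l0); rewrite E1 !ltey; apply: contraNneq => ->.
by rewrite gt0_muley// lte_fin mulr_gt0// expR_gt0.
Qed.

(** Here 1 / (2k) = s, and theta is the constant for which k^-1 t^k at the argument of phi equals y
    sqrt l; the remaining constants agree by comparing exponents. At l = 0 the value 1 in the
    definition of phi is the normalisation of the total mass. *)
Lemma phi_laplace l : 0 <= l ->
  ((phi a (theta a * y `^ (1 - a) * l `^ ((1 - a) / 2)))%:E =
   (poisson_const a * y `^ (1 - a))%:E *
   \int[mu]_(t in `]0%R, +oo[) (poisson_weight t * expR (- t * l))%:E)%E.
Proof.
have [_ G0] := GammaE s01.
have a1 : 0 < 1 - a by move: ha => /andP[? ?]; lra.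
rewrite le_eqVlt => /predU1P[<-|l0].
  rewrite powR0 ?gt_eqF ?(andP s01).1// mulr0 /phi eqxx.
  under eq_integral do rewrite mulr0 expR0 mulr1.
  rewrite integral_poisson_weight -EFinM mulfV// mulf_neq0//.
    by rewrite /poisson_const gt_eqF// divr_gt0// powR_gt0.
  by rewrite gt_eqF// powR_gt0.
rewrite laplace_bessel// -EFinM; congr EFin.
rewrite /phi ifF; last by rewrite gt_eqF// !mulr_gt0// powR_gt0.
have sE : (2 * kexp a)^-1 = s by rewrite /kexp /alpha /s; field; lra.
rewrite sE /calpha sE /poisson_const -/s.
have kE : kexp a = (1 - a)^-1 by rewrite /kexp /alpha; field; lra.
have [Y yE] := expR_total hy; have [B BE] := @expR_total R 2 ltac:(by []).
have [L lE] := expR_total l0; have [A aE] := expR_total a1.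
have TE : theta a * y `^ (1 - a) * l `^ s = expR ((a - 1) * A + (1 - a) * Y + s * L).
  by rewrite /theta -yE -lE -aE !expR_powR -!expRD.
rewrite TE kE.
have -> : (1 - a)^-1^-1 * expR ((a - 1) * A + (1 - a) * Y + s * L) `^ (1 - a)^-1 = y * l `^ 2^-1.
  rewrite invrK expR_powR -{1}aE -yE -lE expR_powR -!expRD; congr expR.
  by rewrite /s; field; lra.
rewrite mulrA; congr (_ * _).
have e1 : 2 `^ (1 - s) = expR ((1 - s) * B) by rewrite -BE expR_powR.
have e2 : (1 - a)^-1 `^ (- s) = expR (s * A).
  by rewrite -aE -expRN expR_powR; congr expR; ring.
have e3 : 2 `^ (a - 1) = expR ((a - 1) * B) by rewrite -BE expR_powR.
have e4 : y `^ (1 - a) = expR ((1 - a) * Y) by rewrite -yE expR_powR.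
have e5 : (y / (2 * l `^ 2^-1)) `^ (- s) = expR (- s * (Y - B - L / 2)).
  rewrite -yE -lE expR_powR -[X in _ / (X * _)]BE -expRD -expRB expR_powR.
  by congr expR; field.
rewrite e1 e2 e3 e4 e5 expR_powR -[X in _ = _ * (X * _)]BE.
have aux g p q r : expR p * g * expR q * expR r = g * expR (p + q + r) :> R.
  by rewrite !expRD; ring.
by rewrite mulrA !aux -mulrA -expRD; congr (_ * expR _); rewrite /s; field.
Qed.

End laplace.

(** * Square-integrable functions *)

Section L2_theory.
Context d (T : measurableType d) (R : realType).
Variable mu : {measure set T -> \bar R}.
Implicit Types u v w : T -> R.
Local Notation L2 := (L2 mu).
Local Notation dot := (dotL2 mu).

Lemma normL2_powR2 u :
  (\int[mu]_x (`|(EFin \o u) x| `^ 2) = \int[mu]_x (u x ^+ 2)%:E)%E.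
Proof.
apply: eq_integral => x _ /=.
by rewrite powR_mulrn// real_normK// num_real.
Qed.

Lemma normL2E u : normL2 mu u = ((\int[mu]_x (u x ^+ 2)%:E) `^ 2^-1)%E.
Proof. by rewrite /normL2 unlock normL2_powR2. Qed.

Lemma L2P u : L2 u <->
  measurable_fun setT u /\ (\int[mu]_x (u x ^+ 2)%:E < +oo)%E.
Proof.
split=> [hu|[mf fu]].
  have /integrableP[_ i] := Lfun2_integrable_sqr hu.
  split; first by move: hu; rewrite /Defs.L2 inE => /andP[/[!inE]].
  apply: le_lt_trans i; rewrite le_eqVlt; apply/orP; left; apply/eqP.
  by apply: eq_integral => x _ /=; rewrite ger0_norm// sqr_ge0.
rewrite /Defs.L2 inE; apply/andP; split; first by rewrite inE.
by rewrite inE/= /finite_norm -/(normL2 mu u) normL2E poweR_lty.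
Qed.

Lemma L2_measurable u : L2 u -> measurable_fun setT u.
Proof. by move=> /L2P[]. Qed.

Lemma L2_le u v : measurable_fun setT u -> (forall x, `|u x| <= `|v x|) ->
  L2 v -> L2 u.
Proof.
move=> mu1 uv /L2P[mv v2]; apply/L2P; split => //; apply: le_lt_trans v2.
apply: ge0_le_integral => //.
- by move=> x _; rewrite lee_fin sqr_ge0.
- by apply/measurable_EFinP; apply: measurable_funX.
- by apply/measurable_EFinP; apply: measurable_funX.
- by move=> x _; rewrite lee_fin -[u x ^+ 2]real_normK ?num_real// -[v x ^+ 2]real_normK
  ?num_real// ler_sqr ?nnegrE.
Qed.

Lemma L2_integrableM u v : L2 u -> L2 v ->
  mu.-integrable setT (EFin \o (fun x => u x * v x)).
Proof. by move=> hu hv; apply/Lfun1_integrable; exact: Lfun2_mul_Lfun1. Qed.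

Lemma L2_lin (c : R) u v : L2 u -> L2 v -> L2 (fun x => c * u x + v x).
Proof.
move=> hu hv; have [mu1 _] := (L2P u).1 hu; have [mv _] := (L2P v).1 hv.
apply/L2P; split; first by apply: measurable_funD => //; exact: measurable_funM.
have iu := L2_integrableM hu hu; have iv := L2_integrableM hv hv.
have ib : mu.-integrable setT (EFin \o (fun x => 2 * c ^+ 2 * (u x * u x) + 2 * (v x * v x))).
  rewrite (_ : _ \o _ = (fun x => (2 * c ^+ 2)%:E * (EFin \o (fun x => (u x * u x)%R)) x) \+
    (fun x => 2%:E * (EFin \o (fun x => (v x * v x)%R)) x))%E//.
  by apply: integrableD => //; exact: integrableZl.
have /integrableP[mb] := ib; apply: le_lt_trans.
apply: ge0_le_integral => //.
- by move=> x _; rewrite lee_fin sqr_ge0.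
- apply/measurable_EFinP; apply: measurable_funX.
  by apply: measurable_funD => //; exact: measurable_funM.
- exact: measurableT_comp.
- move=> x _; rewrite lee_fin ler_normr; apply/orP; left.
  rewrite -subr_ge0 (_ : _ - _ = (c * u x - v x) ^+ 2) ?sqr_ge0//; ring.
Qed.

Lemma L2_0 : L2 (cst 0).
Proof.
apply/L2P; split => //; under eq_integral do rewrite expr0n.
by rewrite integral0.
Qed.

Lemma L2Z (c : R) u : L2 u -> L2 (fun x => c * u x).
Proof.
move=> hu; have := L2_lin c hu L2_0.
by congr (L2 _); apply/funext => x; rewrite addr0.
Qed.

Lemma L2D u v : L2 u -> L2 v -> L2 (u \+ v).
Proof.
move=> hu hv; have := L2_lin 1 hu hv.
by congr (L2 _); apply/funext => x; rewrite mul1r.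
Qed.

Lemma L2B u v : L2 u -> L2 v -> L2 (u \- v).
Proof.
move=> hu hv; have := L2_lin (-1) hv hu.
by congr (L2 _); apply/funext => x /=; rewrite mulN1r addrC.
Qed.

Lemma dotL2E u v : L2 u -> L2 v -> (dot u v)%:E = (\int[mu]_x (u x * v x)%:E)%E.
Proof.
move=> hu hv; rewrite /dotL2 /Rintegral fineK//.
exact: (integrable_fin_num measurableT (L2_integrableM hu hv)).
Qed.

Lemma dotL2C u v : dot u v = dot v u.
Proof. by rewrite /dotL2; apply: eq_Rintegral => x _; rewrite mulrC. Qed.

Lemma dotL2_lin c u v w : L2 u -> L2 v -> L2 w ->
  dot (fun x => c * u x + v x) w = c * dot u w + dot v w.
Proof.
move=> hu hv hw; rewrite /dotL2.
have iu := L2_integrableM hu hw; have iv := L2_integrableM hv hw.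
under eq_Rintegral do rewrite mulrDl -mulrA.
rewrite RintegralD//; last first.
  rewrite (_ : _ \o _ = (fun x => c%:E * (EFin \o (fun x => (u x * w x)%R)) x)%E)//.
  exact: integrableZl.
by rewrite RintegralZl.
Qed.

Lemma dotL2_ae u v w : L2 u -> L2 v -> L2 w -> u = v %[ae mu] ->
  dot u w = dot v w.
Proof.
move=> hu hv hw uv; rewrite /dotL2 /Rintegral; congr fine.
apply: ae_eq_integral => //.
- by apply/measurable_EFinP; apply: measurable_funM; apply: L2_measurable.
- by apply/measurable_EFinP; apply: measurable_funM; apply: L2_measurable.
- by apply: filterS uv => x h _; rewrite /= h.
Qed.

Lemma dotL2_0l w : dot (cst 0) w = 0.
Proof.
rewrite /dotL2; under eq_Rintegral do rewrite mul0r.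
by rewrite /Rintegral integral0.
Qed.

Lemma dotL2D u v w : L2 u -> L2 v -> L2 w -> dot (u \+ v) w = dot u w + dot v w.
Proof.
move=> hu hv hw; rewrite -[dot u w]mul1r -dotL2_lin//.
by congr (dot _ w); apply/funext => x; rewrite mul1r.
Qed.

Lemma dotL2Z c u w : L2 u -> L2 w -> dot (fun x => c * u x) w = c * dot u w.
Proof.
move=> hu hw; rewrite -[RHS]addr0 -(dotL2_0l w) -dotL2_lin//; last exact: L2_0.
by congr (dot _ w); apply/funext => x; rewrite addr0.
Qed.

Lemma dotL2B u v w : L2 u -> L2 v -> L2 w -> dot (u \- v) w = dot u w - dot v w.
Proof.
move=> hu hv hw; rewrite addrC -mulN1r -dotL2_lin//.
by congr (dot _ w); apply/funext => x; rewrite /= mulN1r addrC.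
Qed.

Lemma dotL2_sqr_ge0 u : 0 <= dot u u.
Proof. by apply: Rintegral_ge0 => x _; rewrite -expr2 sqr_ge0. Qed.

Lemma dotL2_sqrB u v : L2 u -> L2 v ->
  dot (u \- v) (u \- v) = dot u u + dot v v - 2 * dot u v.
Proof.
move=> hu hv; have huv := L2B hu hv.
rewrite dotL2B// [dot u (_ \- _)]dotL2C dotL2B// [dot v (_ \- _)]dotL2C dotL2B//.
by rewrite [dot v u]dotL2C; ring.
Qed.

Lemma dotL2_sqrD u v : L2 u -> L2 v ->
  dot (u \+ v) (u \+ v) = dot u u + dot v v + 2 * dot u v.
Proof.
move=> hu hv; have huv := L2D hu hv.
rewrite dotL2D// [dot u (_ \+ _)]dotL2C dotL2D// [dot v (_ \+ _)]dotL2C dotL2D//.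
by rewrite [dot v u]dotL2C; ring.
Qed.

Lemma dotL2_polar u v : L2 u -> L2 v ->
  4 * dot u v = dot (u \+ v) (u \+ v) - dot (u \- v) (u \- v).
Proof. by move=> hu hv; rewrite dotL2_sqrD// dotL2_sqrB//; ring. Qed.

Lemma cauchy_schwarz u v : L2 u -> L2 v ->
  dot u v ^+ 2 <= dot u u * dot v v.
Proof.
move=> hu hv; have u0 := dotL2_sqr_ge0 u; have v0 := dotL2_sqr_ge0 v.
have key c : 0 <= c ^+ 2 * dot u u + 2 * c * dot u v + dot v v.
  have hw := L2_lin c hu hv; have := dotL2_sqr_ge0 (fun x => c * u x + v x).
  set w := (fun x => _) in hw *; rewrite {1}/w dotL2_lin//.
  rewrite [dot u w]dotL2C [dot v w]dotL2C !dotL2_lin// [dot v u]dotL2C.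
  by congr (_ <= _); ring.
have [uu0|uu0] := eqVneq (dot u u) 0.
  have [->|uv0] := eqVneq (dot u v) 0; first by rewrite expr0n mulr_ge0.
  (* When the quadratic coefficient vanishes, this value of c makes the remaining affine expression
     equal to -1. *)
  have := key (- (dot v v + 1) / (2 * dot u v)); rewrite uu0 mulr0 add0r.
  rewrite (_ : 2 * _ * _ = - (dot v v + 1)); last by field.
  by lra.
have := key (- dot u v / dot u u).
rewrite -(pmulr_rge0 _ (_ : 0 < dot u u)) ?lt_neqAle 1?eq_sym ?uu0//.
rewrite (_ : dot u u * (_ + _) = dot u u * dot v v - dot u v ^+ 2); last by field.
by rewrite subr_ge0.
Qed.

Lemma dotL2_eq0 u : L2 u -> dot u u = 0 -> u = cst 0 %[ae mu].
Proof.
move=> hu u0; have mu1 := L2_measurable hu.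
have : (\int[mu]_x `|(u x * u x)%:E| = 0)%E.
  transitivity ((dot u u)%:E); last by rewrite u0.
  rewrite dotL2E//; apply: eq_integral => x _.
  by rewrite gee0_abs// lee_fin -expr2 sqr_ge0.
move=> /ae_eq_integral_abs => /(_ measurableT) H.
have : ae_eq mu setT (fun x => (u x * u x)%:E) (cst 0%E).
  by apply: H; apply/measurable_EFinP; exact: measurable_funM.
apply: filterS => x /(_ I)[] /eqP; rewrite mulf_eq0 orbb => /eqP -> _//.
Qed.

Lemma dotL2_inj u v : L2 u -> L2 v -> (forall w, L2 w -> dot u w = dot v w) ->
  u = v %[ae mu].
Proof.
move=> hu hv uv; have huv := L2B hu hv.
have : dot (u \- v) (u \- v) = 0 by rewrite dotL2B// uv// subrr.
move=> /(dotL2_eq0 huv); apply: filterS => x /(_ I)/= /eqP.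
by rewrite subr_eq0 => /eqP.
Qed.

(** The test vector is the negative part n of u: <n, n> = - <u, n> <= 0 forces n = 0 almost
    everywhere. *)
Lemma dotL2_ge0_ae u : L2 u ->
  (forall w, L2 w -> (forall x, 0 <= w x) -> 0 <= dot u w) ->
  {ae mu, forall x, 0 <= u x}.
Proof.
move=> hu u0; have mu1 := L2_measurable hu.
pose n x := Num.max (- u x) 0.
have mn : measurable_fun setT n.
  by apply: measurable_maxr => //; exact: measurableT_comp.
have hn : L2 n.
  apply: (L2_le (v := u)) => // x; rewrite /n.
  case: (lerP (- u x) 0) => h; first by rewrite normr0.
  by rewrite normrN.
have n0 x : 0 <= n x by rewrite /n le_max lexx orbT.
have E : dot n n = - dot u n.
  rewrite -[RHS]mulN1r -dotL2Z// /dotL2; apply: eq_Rintegral => x _.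
  by rewrite /n; case: (lerP (- u x) 0) => h; rewrite ?mulr0// mulN1r.
have : dot n n = 0.
  by apply/eqP; rewrite eq_le dotL2_sqr_ge0 E oppr_le0 u0.
move=> /(dotL2_eq0 hn); apply: filterS => x /(_ I)/=.
rewrite /n; case: (lerP (- u x) 0) => h; first by rewrite -oppr_le0.
by move=> e; move: h; rewrite e ltxx.
Qed.

End L2_theory.

Section ae_nonneg.
Context d (T : measurableType d) (R : realType) (mu : {measure set T -> \bar R}).

Lemma dotL2_ae_ge0 (u v : T -> R) : measurable_fun setT u -> measurable_fun setT v ->
  {ae mu, forall x, 0 <= u x} -> (forall x, 0 <= v x) -> 0 <= dotL2 mu u v.
Proof.
move=> mf mv u0 v0; rewrite /dotL2 /Rintegral fine_ge0//.
have -> : (\int[mu]_x (u x * v x)%:E = \int[mu]_x `|(u x * v x)%:E|)%E.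
  have muv : measurable_fun setT (fun x => (u x * v x)%:E).
    by apply/measurable_EFinP; exact: measurable_funM.
  apply: ae_eq_integral => //; first exact: measurableT_comp.
  by apply: filterS u0 => x u0 _; rewrite gee0_abs// lee_fin mulr_ge0.
exact: integral_ge0.
Qed.

End ae_nonneg.

Create HintDb l2.
#[global] Hint Resolve sf_L2 L2D L2B L2_lin L2Z L2_0 : l2.
#[global] Hint Extern 0 (Defs.L2 _ _) => solve [auto with l2 nocore] : core.

(** * Convergence and completeness in L2 *)

Section L2_convergence.
Context d (T : measurableType d) (R : realType).
Variable mu : {measure set T -> \bar R}.
Implicit Types u v w : T -> R.
Local Notation L2 := (L2 mu).
Local Notation dot := (dotL2 mu).

Lemma normL2_dot u : L2 u -> normL2 mu u = (Num.sqrt (dot u u))%:E.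
Proof.
move=> hu; by rewrite normL2E -powR12_sqrt ?dotL2_sqr_ge0// -poweR_EFin dotL2E.
Qed.

Lemma normL2_lty_L2 u : measurable_fun setT u -> (normL2 mu u < +oo)%E -> L2 u.
Proof.
move=> mf h; apply/L2P; split => //; move: h; rewrite normL2E !ltey.
by apply: contraNneq => ->; rewrite poweRyr.
Qed.

Lemma normL2_cvg0 (I : Type) (F : set_system I) (FF : Filter F) (u_ : I -> T -> R) :
  (forall i, L2 (u_ i)) ->
  normL2 mu (u_ i) @[i --> F] --> 0%E <->
  dot (u_ i) (u_ i) @[i --> F] --> (0 : R).
Proof.
move=> hu; split => H.
  have {}H : Num.sqrt (dot (u_ i) (u_ i)) @[i --> F] --> (0 : R).
    have : (Num.sqrt (dot (u_ i) (u_ i)))%:E @[i --> F] --> (0 : R)%:E.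
      by move: H; under eq_fun do rewrite normL2_dot//.
    by move/fine_cvg.
  have -> : (fun i => dot (u_ i) (u_ i)) =
      (fun i => Num.sqrt (dot (u_ i) (u_ i)) * Num.sqrt (dot (u_ i) (u_ i))).
    by apply/funext => i; rewrite -expr2 sqr_sqrtr ?dotL2_sqr_ge0.
  by rewrite -[X in _ --> X](mulr0 (0 : R)); apply: cvgM.
under eq_fun do rewrite normL2_dot//.
apply: cvg_EFin; first by near=> i.
rewrite -(@sqrtr0 R).
by apply: (@cvg_comp _ _ _ (fun i => dot (u_ i) (u_ i)) (@Num.sqrt R));
  [exact: H|exact: sqrt_continuous].
Unshelve. all: by end_near. Qed.

Lemma dotL2_cvg (I : Type) (F : set_system I) (FF : ProperFilter F)
    (u_ v_ : I -> T -> R) u v :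
  (forall i, L2 (u_ i)) -> (forall i, L2 (v_ i)) -> L2 u -> L2 v ->
  dot (u_ i \- u) (u_ i \- u) @[i --> F] --> (0 : R) ->
  dot (v_ i \- v) (v_ i \- v) @[i --> F] --> (0 : R) ->
  dot (u_ i) (v_ i) @[i --> F] --> dot u v.
Proof.
move=> hu_ hv_ hu hv cu cv.
have CS a b : L2 a -> L2 b -> `|dot a b| <= Num.sqrt (dot a a) * Num.sqrt (dot b b).
  move=> ha hb; rewrite -sqrtrM ?dotL2_sqr_ge0// -sqrtr_sqr ler_sqrt ?mulr_ge0 ?dotL2_sqr_ge0//.
  exact: cauchy_schwarz.
have E i : dot (u_ i) (v_ i) - dot u v =
    dot (u_ i \- u) (v_ i \- v) + dot (u_ i \- u) v + dot u (v_ i \- v).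
  have h1 := L2B (hu_ i) hu; have h2 := L2B (hv_ i) hv.
  rewrite [dot u (_ \- _)]dotL2C !dotL2B//.
  rewrite [dot u (_ \- _)]dotL2C [dot (u_ i) (_ \- _)]dotL2C !dotL2B//.
  by rewrite [dot (v_ i) (u_ i)]dotL2C [dot v (u_ i)]dotL2C [dot (v_ i) u]dotL2C [dot v u]dotL2C;
    ring.
have sq0 (x_ : I -> R) : x_ i @[i --> F] --> (0 : R) -> Num.sqrt (x_ i) @[i --> F] --> (0 : R).
  move=> h; rewrite -(@sqrtr0 R).
  by apply: (@cvg_comp _ _ _ x_ (@Num.sqrt R)); [exact: h|exact: sqrt_continuous].
apply: cvg_sub0; last exact: cvg_cst.
pose B i := Num.sqrt (dot (u_ i \- u) (u_ i \- u)) * Num.sqrt (dot (v_ i \- v) (v_ i \- v))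
  + Num.sqrt (dot (u_ i \- u) (u_ i \- u)) * Num.sqrt (dot v v)
  + Num.sqrt (dot u u) * Num.sqrt (dot (v_ i \- v) (v_ i \- v)).
have B0 : B i @[i --> F] --> (0 : R).
  have -> : (0 : R) = 0 * 0 + 0 * Num.sqrt (dot v v) + Num.sqrt (dot u u) * 0.
    by rewrite !mulr0 mul0r !addr0.
  apply: cvgD; first apply: cvgD.
  - by apply: cvgM; exact: sq0.
  - by apply: cvgM; [exact: sq0|exact: cvg_cst].
  - by apply: cvgM; [exact: cvg_cst|exact: sq0].
apply: norm_cvg0; apply: (squeeze_cvgr _ (cvg_cst 0) B0).
near=> i; rewrite normr_ge0/= -[X in `|X|]/(dot (u_ i) (v_ i) - dot u v) E.
have h1 := L2B (hu_ i) hu; have h2 := L2B (hv_ i) hv.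
by rewrite (le_trans (ler_normD _ _))// lerD ?(le_trans (ler_normD _ _))// ?lerD// CS.
Unshelve. all: by end_near. Qed.

Lemma dotL2_cvgl (I : Type) (F : set_system I) (FF : ProperFilter F)
    (u_ : I -> T -> R) u w :
  (forall i, L2 (u_ i)) -> L2 u -> L2 w ->
  dot (u_ i \- u) (u_ i \- u) @[i --> F] --> (0 : R) ->
  dot (u_ i) w @[i --> F] --> dot u w.
Proof.
move=> hu_ hu hw cu; apply: dotL2_cvg => //.
have -> : (fun=> dot (w \- w) (w \- w)) = (fun _ : I => 0 : R); last exact: cvg_cst.
by apply/funext => i; rewrite dotL2_sqrB//; ring.
Qed.

(* A subsequence with summable increments converges almost everywhere. *)
Let L2_complete_fast (u_ : nat -> T -> R) : (forall n, L2 (u_ n)) ->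
  (forall n, dot (u_ n.+1 \- u_ n) (u_ n.+1 \- u_ n) <= (16^-1) ^+ n) ->
  exists2 u : T -> R, measurable_fun setT u &
    {ae mu, forall x, u_ n x @[n --> \oo] --> u x}.
Proof.
move=> hu cu.
pose D n := u_ n.+1 \- u_ n.
have hD n : L2 (D n) by exact: L2B.
(* The weights 4^n are small enough for G to be integrable, since 4^n 16^-n is summable, and large
   enough that G x < +oo forces |D n x| <= sqrt (G x) 2^-n. Only squares are integrated, so the
   measure may be infinite. *)
pose G x := (\sum_(0 <= n <oo) (4 ^+ n * (D n x * D n x))%:E)%E.
have mD n : measurable_fun setT (D n) by exact: L2_measurable (hD n).
have mg n : measurable_fun setT (fun x => (4 ^+ n * (D n x * D n x))%:E).
  by apply/measurable_EFinP; apply: measurable_funM => //; exact: measurable_funM.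
have g0 n x : (0 <= (4 ^+ n * (D n x * D n x))%:E)%E.
  by rewrite lee_fin mulr_ge0 ?exprn_ge0// -expr2 sqr_ge0.
have mG : measurable_fun setT G.
  by apply: ge0_emeasurable_sum => // k x _ _; exact: g0.
have iG : (\int[mu]_x G x < +oo)%E.
  rewrite integral_nneseries//.
  apply: (@le_lt_trans _ _ (\sum_(0 <= n <oo) ((4^-1) ^+ n)%:E)%E).
    apply: lee_nneseries => [n _ _|n _]; first by apply: integral_ge0 => x _; exact: g0.
    under eq_integral do rewrite EFinM.
    rewrite ge0_integralZl//; first last.
    - by move=> x _; rewrite lee_fin -expr2 sqr_ge0.
    - by apply/measurable_EFinP; exact: measurable_funM.
    rewrite -dotL2E// -EFinM lee_fin.
    rewrite (le_trans (ler_wpM2l _ (cu n))) ?exprn_ge0// -exprMn.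
    by rewrite (_ : 4 * 16^-1 = 4^-1 :> R)//; field.
  rewrite (_ : (fun n => _) = EFin \o (series (geometric 1 (4^-1)))); last first.
    by apply/funext => n /=; rewrite sumEFin /series/=; congr EFin; apply: eq_bigr => i _;
      rewrite mul1r.
  rewrite EFin_lim ?ltry//; apply: is_cvg_geometric_series.
  by rewrite ger0_norm// invf_lt1// ltr1n.
have fG : {ae mu, forall x, (G x < +oo)%E}.
  have iG' : mu.-integrable setT G.
    apply/integrableP; split => //; apply: le_lt_trans iG.
    rewrite le_eqVlt; apply/orP; left; apply/eqP; apply: eq_integral => x _.
    by rewrite gee0_abs//; apply: nneseries_ge0 => n _ _; exact: g0.
  by have := integrable_ae measurableT iG'; apply: filterS => x /(_ I);
    rewrite fin_numE => /andP[_]; rewrite ltey.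
pose A := [set x | (G x < +oo)%E].
have mA : measurable A by rewrite -[A]setTI; exact: emeasurable_fun_infty_o.
have cvgA x : A x -> cvgn (fun n => u_ n x).
  move=> Ax.
  have Gfin : G x \is a fin_num.
    by rewrite ge0_fin_numE//; apply: nneseries_ge0 => n _ _; exact: g0.
  have bD n : `|D n x| <= Num.sqrt (fine (G x)) * (2^-1) ^+ n.
    have : (4 ^+ n * (D n x * D n x) <= fine (G x)).
      rewrite -lee_fin fineK//.
      apply: le_trans (nneseries_lim_ge n.+1 _) => //.
      by rewrite big_nat_recr//= leeDr// sume_ge0.
    move=> h; have S0 : 0 <= fine (G x).
      by rewrite fine_ge0//; apply: nneseries_ge0 => k _ _; exact: g0.
    rewrite -ler_sqr ?nnegrE ?mulr_ge0 ?sqrtr_ge0 ?exprn_ge0// exprMn sqr_sqrtr//.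
    rewrite real_normK ?num_real//.
    have -> : D n x ^+ 2 = (4 ^+ n * (D n x * D n x)) * (2^-1 ^+ n) ^+ 2.
      rewrite exprAC mulrAC -exprMn (_ : 4 * 2^-1 ^+ 2 = 1 :> R); last by field.
      by rewrite expr1n mul1r expr2.
    by rewrite ler_wpM2r// exprn_ge0// exprn_ge0.
  have cs : cvgn (series (D ^~ x)).
    apply: normed_cvg; apply: (@series_le_cvg _ _ (geometric (Num.sqrt (fine (G x))) (2^-1))).
    - by move=> n; exact: normr_ge0.
    - by move=> n; rewrite /geometric/= mulr_ge0 ?sqrtr_ge0// exprn_ge0.
    - by move=> n; exact: bD.
    - by apply: is_cvg_geometric_series; rewrite ger0_norm// invf_lt1// ltr1n.
  have -> : (fun n => u_ n x) = (fun n => u_ 0%N x + series (D ^~ x) n).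
    apply/funext => n; rewrite /series/= /D telescope_sumr//.
    by rewrite addrC subrK.
  by apply: is_cvgD => //; exact: is_cvg_cst.
(* Cutting to the measurable set where G is finite makes the sequence converge at every point, so
   the limit is measurable. *)
exists (fun x => limn (fun n => (u_ n \_ A) x)).
  apply: (@measurable_fun_cvg _ _ _ _ (fun n => u_ n \_ A)) => [n|x _].
    by apply/(measurable_restrictT _ mA); apply: measurable_funTS; exact: L2_measurable.
  have [xA|xA] := pselect (A x).
    rewrite /patch mem_set//; exact: cvgA.
  by rewrite /patch memNset//; exact: is_cvg_cst.
apply: filterS fG => x Ax.
rewrite /patch mem_set//; exact: cvgA.
Qed.

Theorem L2_complete (u_ : nat -> T -> R) : (forall n, L2 (u_ n)) ->
  (forall e, 0 < e -> exists N, forall m n, (N <= m)%N -> (N <= n)%N ->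
    dot (u_ m \- u_ n) (u_ m \- u_ n) <= e) ->
  exists2 u, L2 u & dot (u_ n \- u) (u_ n \- u) @[n --> \oo] --> (0 : R).
Proof.
move=> hu cu.
have /choice[N hN] k : exists N, forall m n, (N <= m)%N -> (N <= n)%N ->
    dot (u_ m \- u_ n) (u_ m \- u_ n) <= (16^-1) ^+ k.
  by apply: cu; rewrite exprn_gt0.
(* The sum makes M nondecreasing and at least N; the term k makes it tend to infinity. *)
pose M k := (\sum_(i < k.+1) N i + k)%N.
have NM k : (N k <= M k)%N by rewrite /M big_ord_recr/= -addnA addnCA leq_addr.
have MS k : (M k <= M k.+1)%N.
  by rewrite /M [in leqRHS]big_ord_recr/= leq_add// leq_addr.
have [u mu1 cvu] : exists2 u : T -> R, measurable_fun setT u &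
    {ae mu, forall x, u_ (M n) x @[n --> \oo] --> u x}.
  apply: L2_complete_fast => // n; apply: hN => //.
  by rewrite (leq_trans (NM n)).
have M_ge k : (k <= M k)%N by rewrite leq_addl.
(* Fatou's lemma along the subsequence replaces one index of the Cauchy estimate by the pointwise
   limit. *)
have key e m : 0 < e -> (forall n, (m <= n)%N ->
    dot (u_ n \- u_ m) (u_ n \- u_ m) <= e) ->
    (\int[mu]_x ((u x - u_ m x) ^+ 2)%:E <= e%:E)%E.
  move=> e0 he.
  pose f n x := (((u_ (M n) x - u_ m x) ^+ 2)%:E : \bar R).
  have mf n : measurable_fun setT (f n).
    apply/measurable_EFinP; apply: measurable_funX; apply: measurable_funB; exact: L2_measurable.
  have f0 n x : (0 <= f n x)%E by rewrite lee_fin sqr_ge0.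
  have h1 : (\int[mu]_x ((u x - u_ m x) ^+ 2)%:E = \int[mu]_x limn_einf (f^~ x))%E.
    apply: ae_eq_integral => //.
    - apply/measurable_EFinP; apply: measurable_funX; apply: measurable_funB => //;
      exact: L2_measurable.
    - apply: measurableT_comp => //; apply: measurable_fun_limn_esup => n.
      exact: measurableT_comp.
    - apply: filterS cvu => x cx _.
      suff : f n x @[n --> \oo] --> ((u x - u_ m x) ^+ 2)%:E.
        by move=> /cvg_limn_einf_sup[-> _].
      apply: cvg_EFin; first by near=> n.
      apply: (@cvg_comp _ _ _ (fun n => u_ (M n) x - u_ m x)
          (fun z : R => z ^+ 2) _ (nbhs (u x - u_ m x))).
        by apply: cvgB => //; exact: cvg_cst.
      exact: exprn_continuous.
  rewrite h1; apply: le_trans (fatou mu measurableT mf _) _ => //.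
  rewrite limn_einf_lim; apply: lime_le; first exact: is_cvg_einfs.
  near=> n; apply: (@le_trans _ _ (\int[mu]_x f n x)%E).
    by apply: ereal_inf_lbound; exists n => /=.
  have -> : (\int[mu]_x f n x = (dot (u_ (M n) \- u_ m) (u_ (M n) \- u_ m))%:E)%E.
    by rewrite dotL2E; [apply: eq_integral => x _; rewrite /f expr2|exact: L2B|exact: L2B].
  rewrite lee_fin he// (leq_trans _ (M_ge n))//.
  by near: n; exists m.
have hdiff m e : 0 < e -> (forall n, (m <= n)%N ->
    dot (u_ n \- u_ m) (u_ n \- u_ m) <= e) -> L2 (u \- u_ m).
  move=> e0 he; apply/L2P; split; first by apply: measurable_funB => //; exact: L2_measurable.
  by rewrite (le_lt_trans (key _ _ e0 he))// ltry.
have L2u : L2 u.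
  have [K hK] := cu 1 ltr01.
  have : L2 (u \- u_ K) by apply: (hdiff _ 1) => // n Kn; exact: hK.
  move=> /L2D/(_ (hu K)); congr (L2 _); apply/funext => x /=; rewrite subrK//.
exists u => //; apply/cvgr0Pnorm_le => e e0; have [K hK] := cu e e0.
near=> n; rewrite ger0_norm ?dotL2_sqr_ge0//.
have Kn : (K <= n)%N by near: n; exists K.
rewrite -lee_fin; have := key e n e0 (fun p np => hK _ _ (leq_trans Kn np) Kn).
apply: le_trans; rewrite dotL2E; [|exact: L2B|exact: L2B].
rewrite le_eqVlt; apply/orP; left; apply/eqP; apply: eq_integral => x _ /=.
by congr EFin; ring.
Unshelve. all: by end_near. Qed.

End L2_convergence.

(** * Spectral integrals *)

Section density.
Context d (T : measurableType d) (R : realType).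
Variables (m : {measure set T -> \bar R}) (r : T -> R).
Hypotheses (mr : measurable_fun setT r) (r0 : forall x, 0 <= r x).
Local Open Scope ereal_scope.

(** The measure r dm. Both proofs are arguments so that the measure structure can be attached to the
    term [mdensity mr r0]. *)
Definition mdensity of measurable_fun setT r & (forall x, (0 <= r x)%R) :=
  fun A : set T => \int[m]_(x in A) (r x)%:E.

Let nu := mdensity mr r0.

Let mdensity0 : nu set0 = 0.
Proof. by rewrite /nu /mdensity integral_set0. Qed.

Let mdensity_ge0 A : 0 <= nu A.
Proof. by apply: integral_ge0 => x _; rewrite lee_fin. Qed.

Let mdensity_sigma_additive : semi_sigma_additive nu.
Proof.
move=> /= F mF tF mUF; rewrite /nu /mdensity; apply: cvg_toP.
  apply: ereal_nondecreasing_is_cvgn => i j ij.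
  by apply: lee_sum_nneg_natr => // k _ _; exact: mdensity_ge0.
rewrite ge0_integral_bigcup//=.
- by apply/measurable_funTS/measurableT_comp.
- by move=> x _; rewrite lee_fin.
Qed.

HB.instance Definition _ := isMeasure.Build _ _ _ (mdensity mr r0)
  mdensity0 mdensity_ge0 mdensity_sigma_additive.

Import HBNNSimple.

Let integral_mdensity_nnsfun (h : {nnsfun T >-> R}) :
  \int[nu]_x (h x)%:E = \int[m]_x (h x * r x)%:E.
Proof.
under [LHS]eq_integral do rewrite fimfunE -fsumEFin//.
rewrite [LHS]ge0_integral_fsum//; last 2 first.
  - by move=> z; exact/measurable_EFinP/measurableT_comp.
  - by move=> n x _; rewrite EFinM nnfun_muleindic_ge0.
under [RHS]eq_integral.
  move=> x _; rewrite EFinM fimfunE -fsumEFin// ge0_mule_fsuml; last first.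
    by move=> z; rewrite EFinM nnfun_muleindic_ge0.
  over.
rewrite [RHS]ge0_integral_fsum//; last 2 first.
  - by move=> z; apply: emeasurable_funM; exact/measurable_EFinP/measurableT_comp.
  - move=> n x _; apply: mule_ge0; last by rewrite lee_fin.
    by rewrite EFinM nnfun_muleindic_ge0.
apply: eq_fsbigr => z _.
rewrite integralZl_indic_nnsfun//= integral_indic// setIT /nu /mdensity.
have [z0|z0] := ltP z 0%R.
  have -> : h @^-1` [set z] = set0.
    rewrite -subset0 => x /= hz; have : (0 <= h x)%R by exact: fun_ge0.
    by rewrite hz leNgt z0.
  rewrite measure0 mule0 integral0_eq// => x _.
  by rewrite indicE in_set0 mulr0 mul0e.
rewrite -[X in _ * X]/(\int[m]_(x in h @^-1` [set z]) (r x)%:E).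
rewrite [X in _ * X]integral_mkcond -ge0_integralZl//; last 2 first.
- apply/measurable_restrict => //; apply: measurable_funTS.
  exact/measurable_EFinP.
- by move=> x _; apply: erestrict_ge0 => ? _; rewrite lee_fin.
apply: eq_integral => x _; rewrite patchE indicE.
by case: ifPn => _; [rewrite mulr1|rewrite mulr0 mul0e mule0].
Qed.

Lemma integral_mdensity (f : T -> \bar R) : measurable_fun setT f ->
  (forall x, 0 <= f x) -> \int[nu]_x f x = \int[m]_x (f x * (r x)%:E).
Proof.
move=> mf f0; pose f_ := nnsfun_approx measurableT mf.
transitivity (limn (fun n => \int[nu]_x (f_ n x)%:E)).
  rewrite -monotone_convergence//=.
  - apply: eq_integral => x _; apply/esym/cvg_lim => //=.
    exact: cvg_nnsfun_approx.
  - by move=> n; apply: measurableT_comp.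
  - by move=> n x _; rewrite lee_fin.
  - by move=> x _ a b ab; rewrite lee_fin//; exact/lefP/nd_nnsfun_approx.
under eq_fun do rewrite integral_mdensity_nnsfun.
rewrite -monotone_convergence//=.
- apply: eq_integral => x _; apply/cvg_lim => //=.
  under eq_fun do rewrite EFinM.
  apply: cvgeZr; first by [].
  exact: cvg_nnsfun_approx.
- by move=> n; apply/measurable_EFinP; exact: measurable_funM.
- by move=> n x _; rewrite lee_fin mulr_ge0.
- by move=> x _ a b ab; rewrite lee_fin ler_wpM2r//; exact/lefP/nd_nnsfun_approx.
Qed.

End density.

(** * Finite measures determined by half-lines *)

Section half_lines.
Context (R : realType).
Local Open Scope ereal_scope.
Local Notation T := (measurableTypeR R).

(** Finiteness allows ]a, b] to be measured as a difference of two half-lines, and such intervals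
    form a semiring that generates the Borel sets. *)
Lemma half_line_measure_unique (m1 m2 : {measure set T -> \bar R}) :
  m1 setT < +oo -> m2 setT < +oo ->
  (forall s : R, m1 `]-oo, s]%classic = m2 `]-oo, s]%classic) ->
  forall A, measurable A -> m1 A = m2 A.
Proof.
move=> f1 f2 m12.
have fin (m : {measure set T -> \bar R}) (B : set T) : m setT < +oo -> measurable B -> m B < +oo.
  by move=> fm mB; apply: le_lt_trans fm; apply: le_measure; rewrite ?inE.
have oc (m : {measure set T -> \bar R}) (a b : R) : m setT < +oo -> (a <= b)%R ->
    m `]a, b]%classic = m `]-oo, b]%classic - m `]-oo, a]%classic.
  move=> fm ab; have -> : (`]-oo, b]%classic : set T) = `]-oo, a]%classic `|` `]a, b]%classic.
    apply/seteqP; split => x /=; rewrite !in_itv/=.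
      by move=> ->; rewrite andbT; case: (leP x a) => _; [left|right].
    by move=> [/le_trans|/andP[]//]; apply.
  rewrite measureU//; last first.
    rewrite -subset0 => x []/=; rewrite !in_itv/= => xa /andP[ax _].
    by move: (lt_le_trans ax xa); rewrite ltxx.
  rewrite -[X in _ = X - _]/(m `]-oo, a]%classic + m `]a, b]%classic) addeAC.
  by rewrite subee ?add0e// ge0_fin_numE// fin.
apply: (@measure_unique _ _ T (@ocitv R) (fun n => `](- n%:R)%R, n%:R]%classic)).
- by [].
- exact: ocitvI.
- by move=> n; exact: is_ocitv.
- apply/seteqP; split => // x _; exists (Num.bound `|x|).+1 => //=.
  have h : (`|x| < (Num.bound `|x|)%:R)%R by exact: archi_boundP.
  rewrite in_itv/=; apply/andP; split.
    rewrite ltrNl (le_lt_trans (ler_norm _))// normrN (lt_le_trans h)// ler_nat//.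
  by rewrite (le_trans (ler_norm _))// (le_trans (ltW h))// ler_nat.
- move=> A /ocitvP[->|[[a b]/= ab ->]]; first by rewrite !measure0.
  by rewrite !oc ?m12 ?ltW.
- by move=> n; exact: fin.
Qed.

(** An identity between signed measures with densities, its negative parts moved across so that it
    makes sense for every f >= 0, even where the integrals are infinite. The densities are bounded
    so that both sides are finite measures, as uniqueness from half-lines requires. *)
Lemma four_measures (m1 m2 m3 m4 : {measure set T -> \bar R})
    (r1 r2 r3 r4 : T -> R) (C : R) :
  (forall x, 0 <= r1 x <= C)%R -> (forall x, 0 <= r2 x <= C)%R ->
  (forall x, 0 <= r3 x <= C)%R -> (forall x, 0 <= r4 x <= C)%R ->
  measurable_fun setT r1 -> measurable_fun setT r2 ->
  measurable_fun setT r3 -> measurable_fun setT r4 ->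
  m1 setT < +oo -> m2 setT < +oo -> m3 setT < +oo -> m4 setT < +oo ->
  (forall s : R,
    \int[m1]_(x in `]-oo, s]) (r1 x)%:E + \int[m2]_(x in `]-oo, s]) (r2 x)%:E =
    \int[m3]_(x in `]-oo, s]) (r3 x)%:E + \int[m4]_(x in `]-oo, s]) (r4 x)%:E) ->
  forall f : T -> \bar R, measurable_fun setT f -> (forall x, 0 <= f x) ->
    \int[m1]_x (f x * (r1 x)%:E) + \int[m2]_x (f x * (r2 x)%:E) =
    \int[m3]_x (f x * (r3 x)%:E) + \int[m4]_x (f x * (r4 x)%:E).
Proof.
move=> b1 b2 b3 b4 mr1 mr2 mr3 mr4 f1 f2 f3 f4 E f mf f0.
have p1 x : (0 <= r1 x)%R by case/andP: (b1 x).
have p2 x : (0 <= r2 x)%R by case/andP: (b2 x).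
have p3 x : (0 <= r3 x)%R by case/andP: (b3 x).
have p4 x : (0 <= r4 x)%R by case/andP: (b4 x).
rewrite -(integral_mdensity _ mr1 p1)// -(integral_mdensity _ mr2 p2)//.
rewrite -(integral_mdensity _ mr3 p3)// -(integral_mdensity _ mr4 p4)//.
rewrite -!ge0_integral_measure_add//.
have fin (m : {measure set T -> \bar R}) (r : T -> R) (mr : measurable_fun setT r)
    (p : forall x, (0 <= r x)%R) :
    (forall x, 0 <= r x <= C)%R -> m setT < +oo -> mdensity m mr p setT < +oo.
  move=> b fm; apply: (@le_lt_trans _ _ (\int[m]_x (cst C%:E x))).
    apply: ge0_le_integral => //.
    - by move=> x _; rewrite lee_fin.
    - exact/measurable_EFinP.
    - by move=> x _; rewrite lee_fin; case/andP: (b x).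
  rewrite integral_cst// lte_mul_pinfty// lee_fin.
  by have /andP[/le_trans] := b 0%R; apply.
apply: eq_measure_integral => A mA _; apply: half_line_measure_unique => //.
- rewrite -[X in X < _]/(measure_add (mdensity m1 mr1 p1) (mdensity m2 mr2 p2) setT).
  by rewrite measure_addE lte_add_pinfty// fin.
- rewrite -[X in X < _]/(measure_add (mdensity m3 mr3 p3) (mdensity m4 mr4 p4) setT).
  by rewrite measure_addE lte_add_pinfty// fin.
- move=> s; rewrite -[LHS]/(measure_add (mdensity m1 mr1 p1) (mdensity m2 mr2 p2) _).
  rewrite -[RHS]/(measure_add (mdensity m3 mr3 p3) (mdensity m4 mr4 p4) _).
  by rewrite !measure_addE; exact: E.
Qed.

End half_lines.

(** * Spectral measures *)

Section spectral_calculus.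
Context d (T : measurableType d) (R : realType).
Variable mu : {measure set T -> \bar R}.
Variable E : spectral_family mu.
Implicit Types (u v w q : T -> R) (f g : R -> R) (s l C : R).
Local Notation L2 := (L2 mu).
Local Notation dot := (dotL2 mu).
Local Notation TR := (measurableTypeR R).

Lemma dot_projC l u w : L2 u -> L2 w -> dot (E l u) w = dot (E l w) u.
Proof. by move=> hu hw; rewrite sf_sym// dotL2C. Qed.

Lemma dot_proj_lin l c u v w : L2 u -> L2 v -> L2 w ->
  dot (E l (fun x => c * u x + v x)) w = c * dot (E l u) w + dot (E l v) w.
Proof.
move=> hu hv hw; rewrite -dotL2_lin//.
by apply: dotL2_ae => //; exact: sf_linear.
Qed.

Lemma dot_projD l u v w : L2 u -> L2 v -> L2 w ->
  dot (E l (u \+ v)) w = dot (E l u) w + dot (E l v) w.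
Proof.
move=> hu hv hw; rewrite -[dot (E l u) w]mul1r -dot_proj_lin//.
by congr (dot (E l _) w); apply/funext => x; rewrite mul1r.
Qed.

Lemma dot_projB l u v w : L2 u -> L2 v -> L2 w ->
  dot (E l (u \- v)) w = dot (E l u) w - dot (E l v) w.
Proof.
move=> hu hv hw; rewrite addrC -mulN1r -dot_proj_lin//.
by congr (dot (E l _) w); apply/funext => x; rewrite /= mulN1r addrC.
Qed.

Lemma dot_proj2 l k u w : L2 u -> L2 w ->
  dot (E l u) (E k w) = dot (E (Num.min l k) u) w.
Proof.
move=> hu hw; rewrite -sf_sym//; rewrite minC.
by apply: dotL2_ae => //; exact: sf_mul.
Qed.

Definition proj_sqr u l := dot (E l u) u.

(** Pythagoras for nested projections. It makes the distribution function l -> <E(l)u, u>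
    nondecreasing, and turns strong right continuity of E into right continuity of that function. *)
Lemma proj_sqrB u l k : L2 u -> l <= k ->
  dot (E k u \- E l u) (E k u \- E l u) = proj_sqr u k - proj_sqr u l.
Proof.
move=> hu lk; rewrite dotL2_sqrB// !dot_proj2// !minxx (min_r lk) /proj_sqr.
ring.
Qed.

Lemma proj_sqr_nd u : L2 u -> {homo proj_sqr u : l k / l <= k}.
Proof. by move=> hu l k lk; rewrite -subr_ge0 -proj_sqrB// dotL2_sqr_ge0. Qed.

Lemma proj_sqr_rc u : L2 u -> right_continuous (proj_sqr u).
Proof.
move=> hu l.
have hEk k : L2 (E k u \- E l u) by [].
have := sf_rcont E l hu; rewrite normL2_cvg0// => H.
have : proj_sqr u k - proj_sqr u l @[k --> l^'+] --> (0 : R).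
  apply: cvg_trans H; apply: near_eq_cvg; near=> k.
  by rewrite proj_sqrB// ltW//; near: k; exact: nbhs_right_gt.
by move=> /cvg_sub0; apply; exact: cvg_cst.
Unshelve. all: by end_near. Qed.

Lemma proj_sqr_neg u l : L2 u -> l < 0 -> proj_sqr u l = 0.
Proof.
move=> hu l0; rewrite -(dotL2_0l mu u).
by apply: dotL2_ae => //; exact: sf_neg.
Qed.

Lemma proj_sqr_top u : L2 u -> proj_sqr u n%:R @[n --> \oo] --> dot u u.
Proof.
move=> hu; apply: dotL2_cvgl => //.
have hEk k : L2 (E k u \- u) by [].
have := sf_top E hu; rewrite normL2_cvg0// => H.
apply: (@cvg_comp _ _ _ (fun n : nat => n%:R : R) (fun k => dot (E k u \- u) (E k u \- u))) H.
exact: cvgr_idn.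
Qed.

Definition spec_cumulative u (hu : L2 u) : cumulative R R :=
  HB.pack (proj_sqr u) (isCumulative.Build R _ R (proj_sqr u)
    (proj_sqr_nd hu) (proj_sqr_rc hu)).

(** The spectral measure as a bundled measure. Outside L2 it is the zero measure, so that it is
    total and finite for every u. *)
Definition specm u : {measure set TR -> \bar R} :=
  if pselect (L2 u) is left hu
  then lebesgue_stieltjes_measure (spec_cumulative hu) else mzero.

Lemma spectral_measureE u : L2 u -> spectral_measure E u = specm u.
Proof. by move=> hu; rewrite /specm; case: pselect. Qed.

Lemma specm_oc u a b : L2 u -> a <= b ->
  specm u `]a, b]%classic = (proj_sqr u b - proj_sqr u a)%:E.
Proof.
move=> hu ab; rewrite /specm; case: pselect => // hu'.
rewrite /= /lebesgue_stieltjes_measure /measure_extension measurable_mu_extE/=;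
  last exact: is_ocitv.
by rewrite wlength_itv_bnd.
Qed.

(** A Stieltjes measure determines its distribution function up to a constant; here the constant is
    0 because E(l)u vanishes for l < 0. *)
Lemma specm_half u s : L2 u -> specm u `]-oo, s]%classic = (proj_sqr u s)%:E.
Proof.
move=> hu.
have c1 : specm u `](- n%:R)%R, s]%classic @[n --> \oo] -->
    specm u (\bigcup_n `](- n%:R)%R, s]%classic).
  apply: nondecreasing_cvg_mu => //; first exact: bigcupT_measurable.
  move=> i j ij; apply/subsetPset => x /=; rewrite !in_itv/= => /andP[+ ->].
  by rewrite andbT; apply: le_lt_trans; rewrite lerN2 ler_nat.
have c2 : specm u `](- n%:R)%R, s]%classic @[n --> \oo] --> (proj_sqr u s)%:E.
  apply: cvg_near_cst; near=> n.
  rewrite specm_oc//.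
    rewrite [proj_sqr u (- _)]proj_sqr_neg ?subr0//.
    by rewrite oppr_lt0 ltr0n; near: n; exists 1%N.
  rewrite lerNl; near: n; exact: nbhs_infty_ger.
rewrite -(cvg_unique _ c1 c2)//; congr (specm u _).
apply/seteqP; split => x /=; last by move=> [n _]/=; rewrite !in_itv/= => /andP[].
rewrite in_itv/= => xs; exists (Num.bound `|x|) => //=.
rewrite in_itv/= xs andbT ltrNl (le_lt_trans (ler_norm _))// normrN.
exact: archi_boundP.
Unshelve. all: by end_near. Qed.

Lemma specmT u : L2 u -> specm u setT = (dot u u)%:E.
Proof.
move=> hu.
have c1 : specm u `]-oo, n%:R]%classic @[n --> \oo] -->
    specm u (\bigcup_n `]-oo, n%:R]%classic).
  apply: nondecreasing_cvg_mu => //; first exact: bigcupT_measurable.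
  move=> i j ij; apply/subsetPset => x /=; rewrite !in_itv/= => /le_trans; apply.
  by rewrite ler_nat.
have c2 : specm u `]-oo, n%:R]%classic @[n --> \oo] --> (dot u u)%:E.
  under eq_fun do rewrite specm_half//.
  by apply: cvg_EFin; [near=> n|exact: proj_sqr_top].
rewrite -(cvg_unique _ c1 c2)//; congr (specm u _).
apply/seteqP; split => x // _; exists (Num.bound `|x|) => //=.
by rewrite in_itv/= (le_trans (ler_norm _))// ltW// archi_boundP.
Unshelve. all: by end_near. Qed.

Lemma specm_lty u : (specm u setT < +oo)%E.
Proof.
have [hu|hu] := pselect (L2 u); first by rewrite specmT// ltry.
by rewrite /specm; case: pselect => //= _; exact: ltry.
Qed.

(** The half-line is open because an atom at 0 is possible. This is what allows multipliers to be
    cut to [0, +oo[. *)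
Lemma specm_neg u : specm u `]-oo, 0[%classic = 0%E.
Proof.
have [hu|hu] := pselect (L2 u); last by rewrite /specm; case: pselect.
have c1 : specm u `]-oo, - n.+1%:R^-1]%classic @[n --> \oo] -->
    specm u (\bigcup_n `]-oo, - n.+1%:R^-1]%classic).
  apply: nondecreasing_cvg_mu => //; first exact: bigcupT_measurable.
  move=> i j ij; apply/subsetPset => x /=; rewrite !in_itv/= => /le_trans; apply.
  by rewrite lerN2 lef_pV2 ?posrE// ler_nat.
have c2 : specm u `]-oo, - n.+1%:R^-1]%classic @[n --> \oo] --> 0%E.
  apply: cvg_near_cst; near=> n.
  by rewrite specm_half// proj_sqr_neg// oppr_lt0 invr_gt0.
rewrite -(cvg_unique _ c1 c2)//; congr (specm u _).
apply/seteqP; split => x /=; last first.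
  by move=> [n _]/=; rewrite !in_itv/= => /le_lt_trans; apply; rewrite oppr_lt0 invr_gt0.
rewrite in_itv/= => x0; exists (Num.bound (- x)^-1) => //=.
rewrite in_itv/= lerNr -[leRHS]invrK lef_pV2 ?posrE ?invr_gt0 ?oppr_gt0//.
rewrite (@le_trans _ _ (Num.bound (- x)^-1)%:R) ?ler_nat//.
by rewrite ltW// archi_boundP// invr_ge0 oppr_ge0 ltW.
Unshelve. all: by end_near. Qed.

End spectral_calculus.

(** * Bounded multipliers as bilinear forms *)

Section spectral_forms.
Context d (T : measurableType d) (R : realType).
Variable mu : {measure set T -> \bar R}.
Variable E : spectral_family mu.
Implicit Types (u v w q : T -> R) (f g : R -> R) (s l C : R).
Local Notation L2 := (L2 mu).
Local Notation dot := (dotL2 mu).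
Local Notation TR := (measurableTypeR R).

(** Nonnegativity keeps every spectral integral within Tonelli and monotone convergence; boundedness
    makes it finite for every vector. *)
Definition bounded_ge0 C g :=
  measurable_fun setT g /\ forall x, 0 <= g x <= C.

Lemma bounded_ge0M C C' f g : bounded_ge0 C f -> bounded_ge0 C' g ->
  bounded_ge0 (C * C') (fun x => f x * g x).
Proof.
move=> [mf fC] [mg gC]; split; first exact: measurable_funM.
move=> x; have /andP[f0 f1] := fC x; have /andP[g0 g1] := gC x.
by rewrite mulr_ge0//= ler_pM.
Qed.

Definition below s : R -> R := \1_(`]-oo, s]%classic).

Lemma bounded_ge0_below s : bounded_ge0 1 (below s).
Proof.
split => [|x]; first exact: measurable_indic.
by rewrite /below indicE; case: (_ \in _); rewrite /= ?lexx ?ler01.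
Qed.

Definition spec_int g q : R := fine (\int[specm E q]_x (g x)%:E).

Lemma integral_spec_le C g q : bounded_ge0 C g ->
  (\int[specm E q]_x (g x)%:E <= C%:E * specm E q setT)%E.
Proof.
move=> [mg gC]; rewrite -integral_cst//; apply: ge0_le_integral => //.
- by move=> x _; rewrite lee_fin; case/andP: (gC x).
- exact/measurable_EFinP.
- by move=> x _; rewrite lee_fin; case/andP: (gC x).
Qed.

Lemma spec_intE C g q : bounded_ge0 C g ->
  (\int[specm E q]_x (g x)%:E = (spec_int g q)%:E)%E.
Proof.
move=> hg; have [mg gC] := hg; rewrite /spec_int fineK// ge0_fin_numE.
  apply: (le_lt_trans (integral_spec_le q hg)).
  rewrite lte_mul_pinfty ?specm_lty// lee_fin.
  by have /andP[/le_trans] := gC 0; apply.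
by apply: integral_ge0 => x _; rewrite lee_fin; case/andP: (gC x).
Qed.

Lemma spec_int_ge0 g q : (forall x, 0 <= g x) -> 0 <= spec_int g q.
Proof.
move=> g0; rewrite /spec_int fine_ge0//.
by apply: integral_ge0 => x _; rewrite lee_fin.
Qed.

Lemma spec_int_le C g q : bounded_ge0 C g -> L2 q -> spec_int g q <= C * dot q q.
Proof.
move=> hg hq; rewrite -lee_fin -(spec_intE q hg) EFinM -(specmT E)//.
exact: integral_spec_le.
Qed.

Lemma spec_int_lin C C' (c : R) f g q : 0 <= c -> bounded_ge0 C f -> bounded_ge0 C' g ->
  spec_int (fun x => c * f x + g x) q = c * spec_int f q + spec_int g q.
Proof.
move=> c0 hf hg; apply: EFin_inj; have [mf fC] := hf; have [mg gC] := hg.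
have f0 x : 0 <= f x by case/andP: (fC x).
have g0 x : 0 <= g x by case/andP: (gC x).
rewrite EFinD EFinM -(spec_intE q hf) -(spec_intE q hg).
rewrite -(@spec_intE (c * C + C')); last first.
  split; first by apply: measurable_funD => //; exact: measurable_funM.
  move=> x; rewrite addr_ge0 ?mulr_ge0//=.
  have /andP[_ ?] := fC x; have /andP[_ ?] := gC x.
  by rewrite lerD// ler_wpM2l.
under eq_integral do rewrite EFinD EFinM.
rewrite ge0_integralD//.
- rewrite ge0_integralZl//; first exact/measurable_EFinP.
  by move=> x _; rewrite lee_fin.
- by move=> x _; rewrite -EFinM lee_fin mulr_ge0.
- by apply: emeasurable_funM => //; exact/measurable_EFinP.
- by move=> x _; rewrite lee_fin.
- exact/measurable_EFinP.
Qed.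

Lemma integral_below_half l s q : L2 q ->
  (\int[specm E q]_(x in `]-oo, l]) (below s x)%:E =
   (proj_sqr E q (Num.min l s))%:E)%E.
Proof.
move=> hq; rewrite integral_indic// -specm_half//; congr (specm E q _).
apply/seteqP; split => x /=; rewrite !in_itv/= le_min; first by move=> [-> ->].
by move=> /andP[].
Qed.

Lemma spec_int_below s q : L2 q -> spec_int (below s) q = proj_sqr E q s.
Proof.
move=> hq; rewrite /spec_int integral_indic// setIT specm_half//.
Qed.

Lemma spec_int1 q : L2 q -> spec_int (fun=> 1) q = dot q q.
Proof. by move=> hq; rewrite /spec_int integral_cst// mul1e specmT. Qed.

(* The integral of g against the signed measure d<E(l)u, w>. *)
Definition spec_form g u w : R := (spec_int g (u \+ w) - spec_int g (u \- w)) / 4.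

Lemma spec_form_lin C C' (c : R) f g u w : 0 <= c -> bounded_ge0 C f -> bounded_ge0 C' g ->
  spec_form (fun x => c * f x + g x) u w = c * spec_form f u w + spec_form g u w.
Proof. by move=> c0 hf hg; rewrite /spec_form !(spec_int_lin _ c0 hf hg); ring. Qed.

Lemma proj_sqr_polar u w s : L2 u -> L2 w ->
  proj_sqr E (u \+ w) s - proj_sqr E (u \- w) s = 4 * dot (E s u) w.
Proof.
move=> hu hw; rewrite /proj_sqr dot_projD// dot_projB//.
rewrite dot_projC// dot_projD// [dot (E s w) (_ \+ _)]dot_projC// dot_projD//.
rewrite [dot (E s u) (_ \- _)]dot_projC// dot_projB//.
rewrite [dot (E s w) (_ \- _)]dot_projC// dot_projB//.
by rewrite [dot (E s w) u]dot_projC//; ring.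
Qed.

Lemma proj_sqr_parallelogram u w s : L2 u -> L2 w ->
  proj_sqr E (u \+ w) s + proj_sqr E (u \- w) s =
  2 * proj_sqr E u s + 2 * proj_sqr E w s.
Proof.
move=> hu hw; rewrite /proj_sqr dot_projD// dot_projB//.
rewrite dot_projC// dot_projD// [dot (E s w) (_ \+ _)]dot_projC// dot_projD//.
rewrite [dot (E s u) (_ \- _)]dot_projC// dot_projB//.
rewrite [dot (E s w) (_ \- _)]dot_projC// dot_projB//.
by rewrite [dot (E s w) u]dot_projC//; ring.
Qed.

Lemma spec_form_below s u w : L2 u -> L2 w -> spec_form (below s) u w = dot (E s u) w.
Proof.
move=> hu hw; rewrite /spec_form !spec_int_below// proj_sqr_polar//.
by field.
Qed.

Lemma spec_form1 u w : L2 u -> L2 w -> spec_form (fun=> 1) u w = dot u w.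
Proof.
by move=> hu hw; rewrite /spec_form !spec_int1// -dotL2_polar//; field.
Qed.

(** Both integrals are nonnegative and at most C |u + w|^2 and C |u - w|^2, hence at most 2 C (|u|^2
    + |w|^2). The arithmetic mean of the squared norms needs no bilinearity of the form; where a
    sharper bound is wanted, w is rescaled. *)
Lemma spec_form_bound C g u w : bounded_ge0 C g -> L2 u -> L2 w ->
  `|spec_form g u w| <= C * (dot u u + dot w w) / 2.
Proof.
move=> hg hu hw; have [mg gC] := hg.
have C0 : 0 <= C by have /andP[/le_trans] := gC 0; apply.
have g0 x : 0 <= g x by case/andP: (gC x).
have h1 : spec_int g (u \+ w) <= C * dot (u \+ w) (u \+ w) by exact: spec_int_le.
have h2 : spec_int g (u \- w) <= C * dot (u \- w) (u \- w) by exact: spec_int_le.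
have p1 := spec_int_ge0 (u \+ w) g0; have p2 := spec_int_ge0 (u \- w) g0.
have e1 := dotL2_sqrD hu hw; have e2 := dotL2_sqrB hu hw.
have q1 := dotL2_sqr_ge0 mu (u \+ w); have q2 := dotL2_sqr_ge0 mu (u \- w).
rewrite /spec_form ler_norml; apply/andP; split; rewrite ?e1 ?e2 in h1 h2 q1 q2; nra.
Qed.

Let quarter_diff (a b c e : R) : a - b = 4 * ((c - e) / 4) -> a + e = b + c.
Proof. lra. Qed.

Let swap_add (a b c e : R) : a + b = c + e -> a - c = e - b.
Proof. lra. Qed.

Let swap_sub (a b c e : R) : a - b = c - e -> a + e = b + c.
Proof. lra. Qed.

Local Open Scope ereal_scope.

(** The spectral measure is quadratic in its vector. Infinite integrals are allowed, so with f = l^2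
    this also shows that the domain of L is closed under sums and differences. *)
Lemma spec_parallelogram u w (f : TR -> \bar R) : L2 u -> L2 w ->
  measurable_fun setT f -> (forall x, 0 <= f x) ->
  \int[specm E (u \+ w)%R]_x f x + \int[specm E (u \- w)%R]_x f x =
  2%:E * \int[specm E u]_x f x + 2%:E * \int[specm E w]_x f x.
Proof.
move=> hu hw mf f0.
have := @four_measures R (specm E (u \+ w)%R) (specm E (u \- w)%R) (specm E u) (specm E w)
  (fun=> 1%R) (fun=> 1%R) (fun=> 2%R) (fun=> 2%R) 2%R.
have b1 (x : R) : (0 <= (1 : R) <= 2)%R by rewrite ler01 ler1n.
have b2 (x : R) : (0 <= (2 : R) <= 2)%R by rewrite ler0n lexx.
move=> /(_ b1 b1 b2 b2) /(_ (@measurable_cst _ _ _ _ _ _) (@measurable_cst _ _ _ _ _ _)).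
move=> /(_ (@measurable_cst _ _ _ _ _ _) (@measurable_cst _ _ _ _ _ _)).
move=> /(_ (specm_lty _ _) (specm_lty _ _) (specm_lty _ _) (specm_lty _ _)) H.
have {}H := H _ f mf f0.
rewrite -!ge0_integralZl//.
transitivity (\int[specm E (u \+ w)%R]_x (f x * 1) + \int[specm E (u \- w)%R]_x (f x * 1)).
  by congr (_ + _); apply: eq_integral => x _; rewrite mule1.
rewrite H; first by congr (_ + _); apply: eq_integral => x _; rewrite muleC.
move=> s; rewrite !integral_cst//= !mul1e !specm_half//.
by rewrite -!EFinM -!EFinD; congr EFin; exact: proj_sqr_parallelogram.
Qed.

(** On the half-line ]-oo, l] this is E(l) E(s) = E(min (l, s)): a projection in the second argument
    multiplies the signed measure by the indicator of ]-oo, s]. *)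
Lemma spec_form_proj C g u w s : bounded_ge0 C g -> L2 u -> L2 w ->
  spec_form g u (E s w) = spec_form (fun x => g x * below s x)%R u w.
Proof.
move=> hg hu hw; have [mg gC] := hg.
have g0 x : (0 <= g x)%R by case/andP: (gC x).
have h1 : L2 (u \+ E s w)%R by [].
have h2 : L2 (u \- E s w)%R by [].
have := @four_measures R (specm E (u \+ E s w)%R) (specm E (u \- w)%R)
  (specm E (u \- E s w)%R) (specm E (u \+ w)%R)
  (fun=> 1%R) (below s) (fun=> 1%R) (below s) 1%R.
have b1 (x : R) : (0 <= (1 : R) <= 1)%R by rewrite ler01 lexx.
have [mb bb] := bounded_ge0_below s.
move=> /(_ b1 bb b1 bb (@measurable_cst _ _ _ _ _ _) mb (@measurable_cst _ _ _ _ _ _) mb).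
move=> /(_ (specm_lty _ _) (specm_lty _ _) (specm_lty _ _) (specm_lty _ _)) H.
have {}H := H _ (fun x => (g x)%:E) ((measurable_EFinP _ _).2 mg) _.
have {}H : (spec_int g (u \+ E s w) + spec_int (fun x => g x * below s x) (u \- w) =
   spec_int g (u \- E s w) + spec_int (fun x => g x * below s x) (u \+ w))%R.
  apply: EFin_inj; have hgb := bounded_ge0M hg (bounded_ge0_below s).
  rewrite !EFinD -!(spec_intE _ hg) -!(spec_intE _ hgb).
  under [X in X + _ = _]eq_integral do rewrite -[(g _)%:E]mule1.
  under [X in _ = X + _]eq_integral do rewrite -[(g _)%:E]mule1.
  apply: H => [l|x]; last by rewrite lee_fin.
  rewrite !integral_cst//= !mul1e !specm_half// !integral_below_half//.
  rewrite -!EFinD; congr EFin.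
  have e1 := proj_sqr_polar l hu (sf_L2 E s hw).
  have e2 := proj_sqr_polar (Num.min l s) hu hw.
  by rewrite dot_proj2// -e2 in e1; exact: swap_sub e1.
by rewrite /spec_form; congr (_ / 4)%R; exact: swap_add H.
Qed.

(* For v = r(L)u this is d<E(l)v, w> = r(l) d<E(l)u, w>. Both sides are differences of positive
   measures, and the negative parts are moved across because their integrals may be infinite. *)
Lemma spec_form_density r u v w (f : TR -> \bar R) : bounded_ge0 1 r ->
  L2 u -> L2 v -> L2 w ->
  (forall w', L2 w' -> dot v w' = spec_form r u w') ->
  measurable_fun setT f -> (forall x, 0 <= f x) ->
  \int[specm E (v \+ w)%R]_x f x + \int[specm E (u \- w)%R]_x (f x * (r x)%:E) =
  \int[specm E (v \- w)%R]_x f x + \int[specm E (u \+ w)%R]_x (f x * (r x)%:E).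
Proof.
move=> hr hu hv hw vE mf f0; have [mr rC] := hr.
have r0 x : (0 <= r x)%R by case/andP: (rC x).
have := @four_measures R (specm E (v \+ w)%R) (specm E (u \- w)%R)
  (specm E (v \- w)%R) (specm E (u \+ w)%R)
  (fun=> 1%R) r (fun=> 1%R) r 1%R.
have b1 (x : R) : (0 <= (1 : R) <= 1)%R by rewrite ler01 lexx.
move=> /(_ b1 rC b1 rC (@measurable_cst _ _ _ _ _ _) mr (@measurable_cst _ _ _ _ _ _) mr).
move=> /(_ (specm_lty _ _) (specm_lty _ _) (specm_lty _ _) (specm_lty _ _)) H.
have {}H := H _ f mf f0.
under [X in X + _ = _]eq_integral do rewrite -[f _]mule1.
under [X in _ = X + _]eq_integral do rewrite -[f _]mule1.
apply: H => l.
have hrb := bounded_ge0M hr (bounded_ge0_below l).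
have rE q : \int[specm E q]_(x in `]-oo, l]) (r x)%:E =
    (spec_int (fun x => r x * below l x) q)%:E.
  rewrite -(spec_intE _ hrb) integral_mkcond; apply: eq_integral => x _.
  by rewrite patchE /below indicE; case: ifPn => _; rewrite ?mulr1// mulr0.
rewrite !integral_cst//= !mul1e !specm_half// !rE -!EFinD; congr EFin.
have e1 := proj_sqr_polar l hv hw.
have e2 : dot (E l v) w = spec_form (fun x => r x * below l x)%R u w.
  by rewrite sf_sym// vE// (spec_form_proj _ hr).
by rewrite e2 in e1; exact: quarter_diff e1.
Qed.

End spectral_forms.

(** * Bounded functions of the operator *)

Section spectral_integrals.
Context d (T : measurableType d) (R : realType).
Variable mu : {measure set T -> \bar R}.
Variable E : spectral_family mu.
Implicit Types (u v w q : T -> R) (f g r : R -> R) (s l C : R).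
Local Notation L2 := (L2 mu).
Local Notation dot := (dotL2 mu).
Local Notation TR := (measurableTypeR R).
Local Notation D := (`[0, +oo[%classic : set R).

Lemma spectral_measure_cut f q : L2 q ->
  (\int[spectral_measure E q]_(l in `[0%R, +oo[) (f l)%:E =
   \int[specm E q]_l ((f \_ D) l)%:E)%E.
Proof.
move=> hq; rewrite spectral_measureE// integral_mkcond.
by apply: eq_integral => x _; rewrite !patchE; case: ifPn.
Qed.

Lemma spec_int_cut C g q : bounded_ge0 C g ->
  spec_int E (g \_ D) q = spec_int E g q.
Proof.
move=> [mg gC]; rewrite /spec_int; congr fine.
transitivity (\int[specm E q]_(x in D) (g x)%:E)%E.
  rewrite [RHS]integral_mkcond.
  by apply: eq_integral => x _; rewrite !patchE; case: ifPn.
have g0 x : 0 <= g x by case/andP: (gC x).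
have DE : (D : set TR) = ~` `]-oo, 0[%classic by rewrite setCitvl.
have mD : measurable (`]-oo, 0[%classic : set TR) by [].
rewrite -[in RHS](setvU (`]-oo, 0[%classic : set TR)) ge0_integral_setU//.
- rewrite -DE [X in (_ + X)%E](_ : _ = 0%E) ?adde0//.
  apply: null_set_integral; [by []| |exact: specm_neg].
  by apply/measurable_EFinP; exact: measurable_funTS.
- exact: measurableC.
- by apply/measurable_EFinP; exact: measurable_funTS.
- by move=> x _; rewrite lee_fin.
- by apply/disj_set2P; rewrite setICl.
Qed.

Lemma spec_form_cut C g u w : bounded_ge0 C g ->
  spec_form E (g \_ D) u w = spec_form E g u w.
Proof. by move=> hg; rewrite /spec_form !(spec_int_cut _ hg). Qed.

Lemma bounded_ge0_cut C g : measurable_fun setT g -> 0 <= C ->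
  (forall x, 0 <= x -> 0 <= g x <= C) -> bounded_ge0 C (g \_ D).
Proof.
move=> mg C0 gC; split.
  by apply/(measurable_restrictT _ (measurable_itv _)); exact: measurable_funTS.
move=> x; rewrite patchE; case: ifPn => [|_]; last by rewrite lexx.
by rewrite inE/= in_itv/= andbT => /gC.
Qed.

Lemma spectral_dom_bounded C f u : bounded_ge0 C (f \_ D) ->
  spectral_dom E f u <-> L2 u.
Proof.
move=> hf; split => [[]//|hu]; split => //.
have [mf fC] := hf.
rewrite (spectral_measure_cut (fun l => f l ^+ 2))//.
rewrite (_ : _ \_ D = fun l => (f \_ D) l * (f \_ D) l).
  rewrite (spec_intE _ _ (bounded_ge0M hf hf)) ltry//.
by apply/funext => x; rewrite !patchE; case: ifPn => _; rewrite ?mulr0// expr2.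
Qed.

(** For a bounded multiplier the domain is all of L2, and the defining polarised identity is between
    finite numbers. *)
Lemma spectral_integralP C f u v : bounded_ge0 C (f \_ D) ->
  spectral_integral E f u v <->
  [/\ L2 u, L2 v & forall w, L2 w -> dot v w = spec_form E (f \_ D) u w].
Proof.
move=> hf; have domP w := spectral_dom_bounded w hf; split.
  move=> [/domP hu hv H]; split => // w hw.
  have := H w; rewrite domP => /(_ hw).
  rewrite [X in _ = (X - _)%E -> _](spectral_measure_cut f (L2D hu hw)).
  rewrite [X in _ = (_ - X)%E -> _](spectral_measure_cut f (L2B hu hw)).
  rewrite !(spec_intE _ _ hf) -EFinB => -[e].
  by rewrite /spec_form -e; field.
move=> [hu hv H]; split => [||w /domP hw]; [exact/domP|by []|].
rewrite [X in _ = (X - _)%E](spectral_measure_cut f (L2D hu hw)).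
rewrite [X in _ = (_ - X)%E](spectral_measure_cut f (L2B hu hw)).
rewrite !(spec_intE _ _ hf) -EFinB; congr EFin.
by rewrite H// /spec_form; field.
Qed.

(** The multiplicativity f(L) r(L) = (f r)(L) of the functional calculus, in weak form. *)
Lemma spec_form_density_bounded C r f u v w : bounded_ge0 1 r -> bounded_ge0 C f ->
  L2 u -> L2 v -> L2 w ->
  (forall w', L2 w' -> dot v w' = spec_form E r u w') ->
  spec_form E f v w = spec_form E (fun x => f x * r x) u w.
Proof.
move=> hr hf hu hv hw vE; have [mf fC] := hf.
have hfr := bounded_ge0M hf hr.
have := spec_form_density hr hu hv hw vE ((measurable_EFinP _ _).2 mf).
have f0 x : (0 <= (f x)%:E)%E by rewrite lee_fin; case/andP: (fC x).
move=> /(_ f0); under [X in (_ + X = _)%E -> _]eq_integral do rewrite -EFinM.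
under [X in (_ = _ + X)%E -> _]eq_integral do rewrite -EFinM.
rewrite !(spec_intE _ _ hf) !(spec_intE _ _ hfr) -!EFinD => -[e].
rewrite /spec_form; congr (_ / 4); move: e.
move: (spec_int _ _ _) (spec_int _ _ _) (spec_int _ _ _) (spec_int _ _ _).
by clear; move=> *; lra.
Qed.

Lemma spec_int_parallelogram C f u w : bounded_ge0 C f -> L2 u -> L2 w ->
  spec_int E f (u \+ w) + spec_int E f (u \- w) =
  2 * spec_int E f u + 2 * spec_int E f w.
Proof.
move=> hf hu hw; have [mf fC] := hf.
have f0 x : (0 <= (f x)%:E)%E by rewrite lee_fin; case/andP: (fC x).
have := spec_parallelogram E hu hw ((measurable_EFinP _ _).2 mf) f0.
by rewrite !(spec_intE _ _ hf) -!EFinM -!EFinD => -[].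
Qed.

(** The parallelogram identities for (u, w) and (w, u) have the same right-hand side, so the
    integrals for u - w and w - u agree. *)
Lemma spec_formC C f u w : bounded_ge0 C f -> L2 u -> L2 w ->
  spec_form E f u w = spec_form E f w u.
Proof.
move=> hf hu hw; rewrite /spec_form.
have e1 := spec_int_parallelogram hf hu hw.
have e2 := spec_int_parallelogram hf hw hu.
have e : w \+ u = u \+ w by apply/funext => x /=; rewrite addrC.
rewrite e in e2 *; congr ((_ - _) / 4); move: e1 e2.
move: (spec_int _ _ _) (spec_int _ _ _) (spec_int _ _ _) (spec_int _ _ _) (spec_int _ _ _).
by clear; move=> *; lra.
Qed.

Lemma spec_form_diag C f u : bounded_ge0 C f -> L2 u ->
  spec_form E f u u = spec_int E f u.
Proof.
move=> hf hu; have [mf fC] := hf.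
have e := spec_int_parallelogram hf hu hu.
have h : spec_int E f (u \- u) = 0.
  apply/eqP; rewrite eq_le spec_int_ge0 ?andbT; last by move=> x; case/andP: (fC x).
  rewrite (le_trans (spec_int_le _ hf _))// dotL2_sqrB//.
  by rewrite (_ : _ - _ = 0) ?mulr0//; ring.
rewrite /spec_form h; rewrite h in e; move: e.
move: (spec_int _ _ _) (spec_int _ _ _).
by clear; move=> *; lra.
Qed.

Let half_le (x y : R) : x <= (y + x) / 2 -> x <= y.
Proof. lra. Qed.

(* Uniform approximation of r by the step functions (1/N) * #{j <= N | j/N <= r}. *)
Let steps (c : R) (ss : seq R) : R -> R :=
  foldr (fun s g x => c * below s x + g x) (fun=> 0) ss.

Let step_vec u (c : R) (ss : seq R) : T -> R :=
  foldr (fun s v x => c * E s u x + v x) (cst 0) ss.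

Let bounded_ge0_steps c ss : 0 <= c -> exists C, bounded_ge0 C (steps c ss).
Proof.
move=> c0; elim: ss => [|s ss [C [mC hC]]].
  by exists 0; split => //= x; rewrite lexx.
have [mb bb] := bounded_ge0_below s.
exists (c + C); split => /=.
  by apply: measurable_funD => //; exact: measurable_funM.
move=> x; have /andP[? ?] := hC x; have /andP[? ?] := bb x.
by rewrite addr_ge0 ?mulr_ge0//= lerD// ler_piMr.
Qed.

Let step_vec_L2 u c ss : L2 u -> L2 (step_vec u c ss).
Proof. by move=> hu; elim: ss => [|s ss IH] //=; apply: L2_lin => //; exact: sf_L2. Qed.

Let dot_step_vec u c ss w : 0 <= c -> L2 u -> L2 w ->
  dot (step_vec u c ss) w = spec_form E (steps c ss) u w.
Proof.
move=> c0 hu hw; elim: ss => [|s ss IH] /=.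
  rewrite dotL2_0l /spec_form /spec_int integral0_eq// integral0_eq//=.
  by rewrite subrr mul0r.
have hv := step_vec_L2 c ss hu; have [C hC] := bounded_ge0_steps ss c0.
rewrite dotL2_lin//.
by rewrite IH (spec_form_lin _ _ _ c0 (bounded_ge0_below s) hC) spec_form_below.
Qed.

(** The count is min (N, floor x), so below the cap N it is within 1 of x. *)
Let count_below (N : nat) (x : R) : 0 <= x ->
  (N%:R <= x -> \sum_(j < N) (j.+1%:R <= x :> R)%R%:R = N%:R :> R) /\
  (x < N%:R -> x - 1 <= \sum_(j < N) (j.+1%:R <= x :> R)%R%:R <= x).
Proof.
move=> x0; elim: N => [|N [IH1 IH2]].
  by split => [_|]; [rewrite big_ord0|rewrite ltNge x0].
rewrite !big_ord_recr/=; split => h.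
  by rewrite h IH1 ?(le_trans _ h) ?ler_nat// natr1.
rewrite [N.+1%:R <= x]leNgt h addr0; have [h'|h'] := leP N%:R x; last exact: IH2.
by rewrite IH1//; move: h; rewrite -natr1 => h; apply/andP; split; lra.
Qed.

Lemma steps_map c (h : nat -> R) N x :
  steps c [seq h j | j <- iota 0 N] x = c * \sum_(j < N) below (h j) x.
Proof.
elim: N h => [|N IH] h; first by rewrite big_ord0 mulr0.
rewrite big_ord_recl mulrDr/= -[1%N]addn0 iotaDl -map_comp.
by rewrite -[steps _ _ _]/(steps c [seq (h \o S) j | j <- iota 0 N] x) IH.
Qed.

(** The hypothesis on levels says that r is nonincreasing on [0, +oo[ with closed superlevel sets.
    The step functions approximating r to within 1 / (N + 1) are then combinations of indicators of
    half-lines, which the calculus sends to combinations of the projections; these vectors are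
    Cauchy, and completeness of L2 gives v. *)
Lemma spectral_exists r u : L2 u -> bounded_ge0 1 (r \_ D) ->
  (forall c, 0 < c -> c <= 1 -> exists s, forall l, 0 <= l -> (c <= r l) = (l <= s)) ->
  exists2 v, L2 v & forall w, L2 w -> dot v w = spec_form E (r \_ D) u w.
Proof.
move=> hu hr lev; have [mr rC] := hr.
have /choice[S hS] (c : R) : exists s, 0 < c -> c <= 1 -> forall l, 0 <= l -> (c <= r l) = (l <= s).
  have [c0|] := ltP 0 c; last by exists 0.
  have [c1|] := leP c 1; last by exists 0.
  by have [s hs] := lev c c0 c1; exists s => _ _.
pose ss N := [seq S (j.+1%:R / N.+1%:R) | j <- iota 0 N.+1].
pose c N : R := N.+1%:R^-1.
have c0 N : 0 <= c N by rewrite invr_ge0.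
pose h N := steps (c N) (ss N) \_ D.
have hE' N x : 0 <= x -> 0 <= r x <= 1 -> 0 <= r x - steps (c N) (ss N) x <= c N.
  move=> x0 /andP[r0 r1]; rewrite steps_map.
  have N0 : 0 < N.+1%:R :> R by [].
  have y0 : 0 <= N.+1%:R * r x by rewrite mulr_ge0.
  have -> : \sum_(j < N.+1) below (S (j.+1%:R / N.+1%:R)) x =
      \sum_(j < N.+1) (j.+1%:R <= N.+1%:R * r x :> R)%R%:R.
    apply: eq_bigr => j _; rewrite /below indicE mem_setE; congr (_%:R).
    rewrite in_itv/= -hS// ?divr_gt0//; last by rewrite ler_pdivrMr// mul1r ler_nat.
    by rewrite ler_pdivrMr// mulrC.
  have [h1 h2] := count_below N.+1 y0.
  have [k|k] := leP N.+1%:R (N.+1%:R * r x).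
    have r1' : r x = 1 by apply/eqP; rewrite eq_le r1/=; move: k; rewrite ler_pMr.
    by rewrite h1// r1' mulVf// subrr lexx c0.
  have /andP[k1 k2] := h2 k; rewrite subr_ge0 lerBlDr.
  rewrite /c ler_pdivrMl// k2/= -{1}[N.+1%:R^-1]mulr1 -mulrDr ler_pdivlMl//.
  by rewrite addrC -lerBlDr.
have hb N : bounded_ge0 (c N) (fun x => (r \_ D) x - h N x).
  have [C [mC hC]] := bounded_ge0_steps (ss N) (c0 N).
  split.
    apply: measurable_funB => //; apply/(measurable_restrictT _ (measurable_itv _)).
    exact: measurable_funTS.
  move=> x; rewrite /h !patchE; case: ifPn => [|_]; last by rewrite subrr lexx c0.
  rewrite inE/= in_itv/= andbT => x0; apply: hE' => //.
  by have := rC x; rewrite patchE mem_set//= in_itv/= x0.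
pose v N := step_vec u (c N) (ss N).
have hv N : L2 (v N) by exact: step_vec_L2.
have key N w : L2 w -> `|dot (v N) w - spec_form E (r \_ D) u w| <= c N * (dot u u + dot w w) / 2.
  move=> hw; have [C hC] := bounded_ge0_steps (ss N) (c0 N).
  have hh : bounded_ge0 C (h N).
    have [mC hC'] := hC; apply: bounded_ge0_cut => //.
    by have /andP[/le_trans] := hC' 0; apply.
  have -> : spec_form E (r \_ D) u w = spec_form E (fun x => (r \_ D) x - h N x) u w + dot (v N) w.
    rewrite dot_step_vec// -(spec_form_cut _ _ hC) -[X in X + _]mul1r.
    rewrite -(spec_form_lin _ _ _ ler01 (hb N) hh).
    by congr (spec_form E _ u w); apply/funext => x; rewrite mul1r subrK.
  by rewrite opprD addrCA subrr addr0 normrN; exact: spec_form_bound.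
have cauchy M N : dot (v M \- v N) (v M \- v N) <= (c M + c N) ^+ 2 * dot u u.
  set q := v M \- v N; have hq : L2 q by exact: L2B.
  set e := c M + c N.
  have e0 : 0 < e by rewrite addr_gt0// invr_gt0.
  (* This scaling turns the mean bound into e^-1 |q|^2 <= (e |u|^2 + e^-1 |q|^2) / 2, from which
     |q|^2 <= e^2 |u|^2. *)
  pose w x := e^-1 * q x.
  have hw : L2 w by exact: L2Z.
  have k1 := key M w hw; have k2 := key N w hw.
  have : dot q w <= e * (dot u u + dot w w) / 2.
    rewrite /q dotL2B//; apply: le_trans (ler_norm _) _.
    rewrite -(subrK (spec_form E (r \_ D) u w) (dot (v M) w)) -addrA.
    rewrite (le_trans (ler_normD _ _))// /e mulrDl mulrDl lerD// distrC//.
  have -> : dot w w = e^-1 ^+ 2 * dot q q.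
    by rewrite dotL2Z// dotL2C dotL2Z// expr2 mulrA.
  rewrite dotL2C dotL2Z//.
  set Q := dot q q; set U := dot u u => H.
  have : e^-1 * Q <= e * U.
    move: H; rewrite mulrDr mulrA expr2 mulrA mulfV ?gt_eqF// mul1r.
    exact: half_le.
  by rewrite ler_pdivrMl// expr2 mulrA.
have cN_small e : 0 < e -> exists N0, forall N, (N0 <= N)%N -> c N <= e.
  move=> e0; exists (Num.bound e^-1) => N hN; rewrite -[e]invrK lef_pV2 ?posrE ?invr_gt0//.
  rewrite (@le_trans _ _ (Num.bound e^-1)%:R)//; last by rewrite ler_nat ltnW.
  by rewrite ltW// archi_boundP// invr_ge0 ltW.
have [v0 hv0 cv] : exists2 v0, L2 v0 & dot (v n \- v0) (v n \- v0) @[n --> \oo] --> (0 : R).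
  apply: L2_complete => // e e0.
  have U0 : 0 < dot u u + 1 by rewrite ltr_wpDl// dotL2_sqr_ge0.
  (* With z this minimum, both c m and c n are at most z / 4, so the square of their sum is at most
     z, and z |u|^2 <= e. *)
  have [N0 hN0] := cN_small (Num.min 1 (e / (dot u u + 1)) / 4)
    ltac:(by rewrite divr_gt0// lt_min ltr01 divr_gt0).
  exists N0 => m n hm hn; apply: (le_trans (cauchy m n)).
  have := hN0 _ hm; have := hN0 _ hn; have := c0 m; have := c0 n.
  set x := c m; set y := c n; set U := dot u u in U0 *; set z := Num.min _ _ => ? ? ? ?.
  have z1 : z <= 1 by rewrite ge_min lexx.
  have z2 : z * (U + 1) <= e by rewrite -ler_pdivlMr// ge_min lexx orbT.
  have Ug : 0 <= U by exact: dotL2_sqr_ge0.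
  have h1 : (x + y) ^+ 2 <= z by nra.
  nra.
exists v0 => // w hw.
have c1 : dot (v n) w @[n --> \oo] --> dot v0 w by exact: dotL2_cvgl.
have c2 : dot (v n) w @[n --> \oo] --> spec_form E (r \_ D) u w.
  apply/cvgrPdist_le => e e0; rewrite /=.
  have K0 : 0 < (dot u u + dot w w) / 2 + 1.
    by rewrite ltr_wpDl// divr_ge0// addr_ge0 ?dotL2_sqr_ge0.
  have [N0 hN0] := cN_small (e / ((dot u u + dot w w) / 2 + 1)) (divr_gt0 e0 K0).
  near=> n; rewrite distrC (le_trans (key n w hw))// -mulrA.
  have cn : c n <= e / ((dot u u + dot w w) / 2 + 1) by apply: hN0; near: n; exists N0.
  move: cn; rewrite ler_pdivlMr// mulrDr mulr1; have := c0 n; lra.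
exact: cvg_unique c1 c2.
Unshelve. all: by end_near. Qed.

End spectral_integrals.

(** * The semigroup and resolvent multipliers *)

Section resolvent.
Context d (T : measurableType d) (R : realType).
Variable mu : {measure set T -> \bar R}.
Variable E : spectral_family mu.
Implicit Types (u v w q : T -> R) (f g r : R -> R) (s l C t : R).
Local Notation L2 := (L2 mu).
Local Notation dot := (dotL2 mu).
Local Notation TR := (measurableTypeR R).
Local Notation D := (`[0, +oo[%classic : set R).

Lemma measurable_expRM t : measurable_fun setT (fun l : R => expR (- t * l)).
Proof.
apply: (measurableT_comp (@measurable_expR R)).
exact: measurable_funM.
Qed.

Lemma bounded_ge0_semigroup t : 0 <= t ->
  bounded_ge0 1 ((fun l => expR (- t * l)) \_ D).
Proof.
move=> t0; apply: bounded_ge0_cut => //; first exact: measurable_expRM.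
move=> x x0; rewrite expR_ge0/= -[leRHS]expR0 ler_expR mulNr oppr_le0.
exact: mulr_ge0.
Qed.

Lemma semigroup_exists t u : 0 < t -> L2 u ->
  exists2 v, L2 v & forall w, L2 w -> dot v w =
    spec_form E ((fun l => expR (- t * l)) \_ D) u w.
Proof.
move=> t0 hu; apply: spectral_exists => //.
  exact/bounded_ge0_semigroup/ltW.
move=> c c0 c1; exists (- ln c / t) => l l0.
by rewrite -{1}(lnK c0) ler_expR ler_pdivlMr// mulNr lerNr mulrC.
Qed.

Definition resolvent_mult (e l : R) := (1 + e * l)^-1.

Lemma measurable_resolvent_mult e : 0 < e ->
  measurable_fun D (resolvent_mult e).
Proof.
move=> e0; apply: (@subspace_continuous_measurable_fun _ D) => //.
apply: continuous_in_subspaceT => x /set_mem/=; rewrite in_itv/= andbT => x0.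
apply: cvgV; first by rewrite gt_eqF// ltr_pwDl// mulr_ge0// ltW.
by apply: cvgD; [exact: cvg_cst|exact: mulrl_continuous].
Qed.

Lemma bounded_ge0_resolvent e : 0 < e -> bounded_ge0 1 (resolvent_mult e \_ D).
Proof.
move=> e0; split.
  by apply/(measurable_restrictT _ (measurable_itv _)); exact: measurable_resolvent_mult.
move=> x; rewrite patchE; case: ifPn => [|_]; last by rewrite lexx ler01.
rewrite inE/= in_itv/= andbT => x0; rewrite /resolvent_mult.
have h : 1 <= 1 + e * x by rewrite lerDl mulr_ge0// ltW.
by rewrite invr_ge0 (le_trans ler01 h)/= invf_le1// (lt_le_trans ltr01 h).
Qed.

Lemma resolvent_exists e u : 0 < e -> L2 u ->
  exists2 v, L2 v & forall w, L2 w -> dot v w =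
    spec_form E (resolvent_mult e \_ D) u w.
Proof.
move=> e0 hu; apply: spectral_exists => //; first exact: bounded_ge0_resolvent.
move=> c c0 c1; exists ((c^-1 - 1) / e) => l l0; rewrite /resolvent_mult.
have h : 0 < 1 + e * l by rewrite ltr_pwDl// mulr_ge0// ltW.
by rewrite -[c in LHS]invrK lef_pV2 ?posrE ?invr_gt0// ler_pdivlMr// lerBrDl mulrC.
Qed.

Let id_le_sqr (x : R) : x <= 1 + x ^+ 2.
Proof. by rewrite -subr_ge0; have := sqr_ge0 (x - 1); have := sqr_ge0 x; nra. Qed.

Lemma spectral_dom_id q : spectral_dom E id q <->
  L2 q /\ (\int[specm E q]_x (((fun l => l ^+ 2) \_ D) x)%:E < +oo)%E.
Proof.
split => -[hq]; first by rewrite (spectral_measure_cut E (fun l => l ^+ 2)).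
by split => //; rewrite (spectral_measure_cut E (fun l => l ^+ 2)).
Qed.

Let mid : measurable_fun setT ((@id R) \_ D).
Proof. by apply/(measurable_restrictT _ (measurable_itv _)); exact: measurable_funTS. Qed.

Let msqr : measurable_fun setT ((fun l : R => l ^+ 2) \_ D).
Proof.
apply/(measurable_restrictT _ (measurable_itv _)); apply: measurable_funTS.
exact: measurable_funX.
Qed.

Let id_ge0 x : 0 <= ((@id R) \_ D) x.
Proof.
by rewrite patchE; case: ifPn => //; rewrite inE/= in_itv/= andbT.
Qed.

Let sqr_D_ge0 x : 0 <= ((fun l : R => l ^+ 2) \_ D) x.
Proof. by rewrite patchE; case: ifPn => // _; rewrite sqr_ge0. Qed.

Let spectral_dom_id_lty q : spectral_dom E id q ->
  (\int[specm E q]_x (((@id R) \_ D) x)%:E < +oo)%E.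
Proof.
move=> /spectral_dom_id[hq q2].
apply: (@le_lt_trans _ _ (\int[specm E q]_x (1 + (((fun l => l ^+ 2) \_ D) x)%:E))%E).
  apply: ge0_le_integral => //.
  - by move=> x _; rewrite lee_fin.
  - exact/measurable_EFinP.
  - by apply: emeasurable_funD => //; exact/measurable_EFinP.
  - move=> x _; rewrite -EFinD lee_fin !patchE; case: ifPn => // _.
    by rewrite addr0 ler01.
rewrite ge0_integralD//; last 2 first.
- by move=> x _; rewrite lee_fin.
- exact/measurable_EFinP.
rewrite integral_cst// mul1e lte_add_pinfty//; exact: specm_lty.
Qed.

Let spectral_dom_idDB q w : spectral_dom E id q -> spectral_dom E id w ->
  spectral_dom E id (q \+ w) /\ spectral_dom E id (q \- w).
Proof.
move=> /spectral_dom_id[hq q2] /spectral_dom_id[hw w2].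
have f0 x : (0 <= (((fun l : R => l ^+ 2) \_ D) x)%:E)%E by rewrite lee_fin.
have := spec_parallelogram E hq hw ((measurable_EFinP _ _).2 msqr) f0.
set A := (\int[_]_x _)%E; set B := (\int[_]_x _)%E => H.
have A0 : (0 <= A)%E by apply: integral_ge0 => x _; exact: f0.
have B0 : (0 <= B)%E by apply: integral_ge0 => x _; exact: f0.
have AB : (A + B < +oo)%E by rewrite H lte_add_pinfty// lte_mul_pinfty// lee_fin.
split; apply/spectral_dom_id; split; [by []| |by []|].
- by apply: le_lt_trans AB; rewrite leeDl.
- by apply: le_lt_trans AB; rewrite leeDr.
Qed.

(* The resolvent maps into the domain: the measure of w is r^2 times that of g,
   and l^2 r(l)^2 is bounded. *)
Let resolvent_dom (e : R) (g w : T -> R) : 0 < e -> L2 g -> L2 w ->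
  (forall w', L2 w' -> dot w w' = spec_form E (resolvent_mult e \_ D) g w') ->
  spectral_dom E id w.
Proof.
move=> e0 hg hw wE; apply/spectral_dom_id; split => //.
have hr := bounded_ge0_resolvent e0.
(* Truncating l^2 to [0, n] brings it into the bounded calculus; monotone convergence in n restores
   it. *)
pose f (n : nat) : R -> R := (fun l : R => l ^+ 2) \_ `[0, n%:R]%classic.
have hf n : bounded_ge0 (n%:R ^+ 2) (f n).
  split.
    apply/(measurable_restrictT _ (measurable_itv _)); apply: measurable_funTS.
    exact: measurable_funX.
  move=> x; rewrite /f patchE; case: ifPn => [|_]; last by rewrite lexx sqr_ge0.
  by rewrite inE/= in_itv/= => /andP[x0 xn]; rewrite sqr_ge0/= ler_sqr ?nnegrE.
have key n : spec_int E (f n) w <= (e^-1) ^+ 2 * dot g g.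
  rewrite -(spec_form_diag _ (hf n))//.
  rewrite (spec_form_density_bounded hr (hf n) hg hw hw wE).
  have hfr := bounded_ge0M (hf n) hr.
  (* Symmetry brings the remaining [w] into the first argument, where it too is replaced by [g] at
     the cost of a second factor r. *)
  rewrite (spec_formC _ hfr)// (spec_form_density_bounded hr hfr hg hw hg wE).
  have hfrr : bounded_ge0 (e^-1 ^+ 2) (fun x => f n x * (resolvent_mult e \_ D) x *
    (resolvent_mult e \_ D) x).
    have [m1 b1] := bounded_ge0M hfr hr; split => // x.
    have /andP[-> _] /= := b1 x.
    rewrite /f !patchE; case: ifPn => [|_]; last by rewrite !mul0r exprn_ge0// invr_ge0 ltW.
    rewrite inE/= in_itv/= => /andP[x0 _]; rewrite mem_set/= ?in_itv/= ?x0//.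
    rewrite -mulrA -expr2 -exprMn ler_sqr ?nnegrE ?invr_ge0 ?(ltW e0)//; last first.
      by rewrite mulr_ge0// invr_ge0 addr_ge0// mulr_ge0// ltW.
    rewrite /resolvent_mult -[e^-1]mul1r ler_pdivrMr; last by rewrite ltr_pwDl// mulr_ge0// ltW.
    by rewrite mul1r mulrDr mulr1 mulrA mulVf ?gt_eqF// mul1r lerDr invr_ge0 ltW.
  rewrite (spec_form_diag _ hfrr)//; exact: spec_int_le.
apply: (@le_lt_trans _ _ ((e^-1) ^+ 2 * dot g g)%:E); last exact: ltry.
have -> : (\int[specm E w]_x (((fun l => l ^+ 2) \_ D) x)%:E =
    limn (fun n => \int[specm E w]_x (f n x)%:E))%E.
  rewrite -monotone_convergence//.
  - apply: eq_integral => x _; apply/esym/cvg_lim => //; apply: cvg_near_cst.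
    near=> n; congr EFin; rewrite /f !patchE.
    have [x0|x0] := leP 0 x.
      rewrite !mem_set//= in_itv/= ?x0//=.
      by near: n; exact: nbhs_infty_ger.
    by rewrite !memNset//= in_itv/= leNgt x0.
  - by move=> n; apply/measurable_EFinP; case: (hf n).
  - by move=> n x _; rewrite lee_fin; have [_ /(_ x)/andP[]] := hf n.
  - move=> x _ m n mn; rewrite lee_fin /f !patchE; case: ifPn => [|_].
      rewrite inE/= in_itv/= => /andP[x0 xm].
      by rewrite mem_set//= in_itv/= x0 (le_trans xm)// ler_nat.
    by case: ifPn => // _; exact: sqr_ge0.
apply: lime_le.
  apply: ereal_nondecreasing_is_cvgn => m n mn; apply: ge0_le_integral => //.
  - by move=> x _; rewrite lee_fin; have [_ /(_ x)/andP[]] := hf m.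
  - by apply/measurable_EFinP; case: (hf m).
  - by apply/measurable_EFinP; case: (hf n).
  - move=> x _; rewrite lee_fin /f !patchE; case: ifPn => [|_].
      rewrite inE/= in_itv/= => /andP[x0 xm].
      by rewrite mem_set//= in_itv/= x0 (le_trans xm)// ler_nat.
    by case: ifPn => // _; exact: sqr_ge0.
by near=> n; rewrite (spec_intE _ _ (hf n)) lee_fin.
Unshelve. all: by end_near. Qed.

Let resolvent_identity (e a b p m G W : R) : e != 0 ->
  a + m = b + p -> e * ((p - m) / 4) + W = G ->
  4 * (e^-1 * (G - W)) = a - b.
Proof. by move=> e0 h <-; have -> : a = b + p - m by [lra]; field. Qed.

(** With r(l) = (1 + e l)^-1 the source is the identity e l r(l) + r(l) = 1. The density relation
    trades the unbounded l against the measures of w for the bounded l r(l) against those of g,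
    which yields L w = (g - w) / e, that is, (1 + e L) w = g. *)
Lemma resolvent_spectral_integral (e : R) (g w : T -> R) : 0 < e -> L2 g -> L2 w ->
  (forall w', L2 w' -> dot w w' = spec_form E (resolvent_mult e \_ D) g w') ->
  spectral_integral E id w (fun x => e^-1 * (g x - w x)).
Proof.
move=> e0 hg hw wE; have hr := bounded_ge0_resolvent e0.
have dw := resolvent_dom e0 hg hw wE.
have hz : L2 (fun x => e^-1 * (g x - w x)) by apply: L2Z; exact: L2B.
split => // w' dw'; have [hw' _] := dw'.
have [dD dB] := spectral_dom_idDB dw dw'.
have fD := spectral_dom_id_lty dD; have fB := spectral_dom_id_lty dB.
rewrite [X in _ = (X - _)%E](spectral_measure_cut E id (L2D hw hw')).
rewrite [X in _ = (_ - X)%E](spectral_measure_cut E id (L2B hw hw')).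
have i0 x : (0 <= (((@id R) \_ D) x)%:E)%E by rewrite lee_fin.
have := spec_form_density hr hg hw hw' wE ((measurable_EFinP _ _).2 mid) i0.
have hir : bounded_ge0 e^-1 (fun x => ((@id R) \_ D) x * (resolvent_mult e \_ D) x).
  have [mr rC] := hr; split; first exact: measurable_funM.
  move=> x; have := rC x; rewrite !patchE; case: ifPn => [|_]; last first.
    by move=> _; rewrite -[point]/(0 : R) mul0r lexx invr_ge0 ltW.
  rewrite inE/= in_itv/= andbT => x0 /andP[r0 _]; rewrite mulr_ge0//=.
  rewrite /resolvent_mult -[e^-1]mul1r ler_pdivrMr; last by rewrite ltr_pwDl// mulr_ge0// ltW.
  by rewrite mul1r mulrDr mulr1 mulrA mulVf ?gt_eqF// mul1r lerDr invr_ge0 ltW.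
under [X in (_ + X = _)%E -> _]eq_integral do rewrite -EFinM.
under [X in (_ = _ + X)%E -> _]eq_integral do rewrite -EFinM.
rewrite !(spec_intE _ _ hir).
set A := (\int[_]_x _)%E in fD *; set B := (\int[_]_x _)%E in fB *.
have A0 : (0 <= A)%E by apply: integral_ge0 => x _; exact: i0.
have B0 : (0 <= B)%E by apply: integral_ge0 => x _; exact: i0.
rewrite -(fineK (_ : A \is a fin_num)) ?ge0_fin_numE//.
rewrite -(fineK (_ : B \is a fin_num)) ?ge0_fin_numE//.
rewrite -!EFinD => -[AB]; congr EFin.
have F1 : spec_form E (fun x => e * (((@id R) \_ D) x * (resolvent_mult e \_ D) x)
    + (resolvent_mult e \_ D) x) g w' = dot g w'.
  rewrite -(spec_form1 E hg hw').
  have h1 : bounded_ge0 1 (fun _ : R => 1 : R) by split => // x; rewrite ler01 lexx.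
  rewrite -(spec_form_cut _ _ _ h1); congr (spec_form E _ g w').
  apply/funext => x; rewrite !patchE; case: ifPn => [|_]; last by rewrite !mul0r mulr0 addr0.
  rewrite inE/= in_itv/= andbT => x0.
  have h : 1 + e * x != 0 by rewrite gt_eqF// ltr_pwDl// mulr_ge0// ltW.
  by rewrite /resolvent_mult; field.
rewrite (spec_form_lin _ _ _ (ltW e0) hir hr) -wE// in F1.
have -> : dot (fun x => e^-1 * (g x - w x)) w' = e^-1 * (dot g w' - dot w w').
  by rewrite -(dotL2B hg hw hw') -dotL2Z//; exact: L2B.
by apply: (resolvent_identity _ AB F1); rewrite gt_eqF.
Qed.

End resolvent.

(** * From the resolvent to the semigroup *)

Section semigroup.
Context d (T : measurableType d) (R : realType).
Variable mu : {measure set T -> \bar R}.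
Variable E : spectral_family mu.
Implicit Types (u v w q g : T -> R) (e t : R).
Local Notation L2 := (L2 mu).
Local Notation dot := (dotL2 mu).
Local Notation TR := (measurableTypeR R).
Local Notation D := (`[0, +oo[%classic : set R).

(** With y = t x / (n + 1), the power lies between e^(-tx) and e^(-tx / (1 + y)). Both bounds are 1
    + z <= e^z, at z = y and at z = - y / (1 + y). *)
Lemma resolvent_mult_pow_cvg t (x : R) : 0 <= t -> 0 <= x ->
  resolvent_mult (t / n.+1%:R) x ^+ n.+1 @[n --> \oo] --> expR (- t * x).
Proof.
move=> t0 x0; pose y n : R := t * x / n.+1%:R.
have y0 n : 0 <= y n by rewrite divr_ge0// mulr_ge0.
have yn n : y n * n.+1%:R = t * x by rewrite /y divfK.
have E1 n : resolvent_mult (t / n.+1%:R) x = (1 + y n)^-1.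
  by rewrite /resolvent_mult /y mulrAC.
have ycvg : y n @[n --> \oo] --> (0 : R).
  rewrite -[X in _ --> X](mulr0 (t * x)); apply: cvgM; first exact: cvg_cst.
  exact: cvg_harmonic.
apply: (@squeeze_cvgr _ _ _ _ (fun=> expR (- t * x)) (fun n => expR (- (t * x) / (1 + y n)))).
- near=> n; rewrite E1; apply/andP; split.
    have -> : expR (- t * x) = (expR (y n))^-1 ^+ n.+1.
      by rewrite -expRN -expRM_natr !mulNr yn.
    rewrite lerXn2r ?nnegrE ?invr_ge0 ?expR_ge0 ?addr_ge0//.
    by rewrite lef_pV2 ?posrE ?expR_gt0 ?ltr_pwDl// expR_ge1Dx.
  have -> : expR (- (t * x) / (1 + y n)) = expR (- (y n / (1 + y n))) ^+ n.+1.
    by rewrite -expRM_natr -(yn n); congr expR; rewrite !mulNr mulrAC.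
  rewrite lerXn2r ?nnegrE ?invr_ge0 ?expR_ge0 ?addr_ge0//.
  have h : 1 + y n != 0 by rewrite gt_eqF// ltr_pwDl.
  have e : (1 + y n)^-1 = 1 + - (y n / (1 + y n)) by field.
  rewrite [leLHS]e; exact: expR_ge1Dx.
- exact: cvg_cst.
- have c : - (t * x) / (1 + y n) @[n --> \oo] --> - (t * x).
    have e : - (t * x) = - (t * x) / (1 + 0) by rewrite addr0 divr1.
    rewrite [X in _ --> X]e.
    apply: cvgM; first exact: cvg_cst.
    apply: cvgV; first by rewrite addr0 oner_neq0.
    by apply: cvgD => //; exact: cvg_cst.
  have -> : - t * x = - (t * x) by rewrite mulNr.
  apply: (@cvg_comp _ _ _ (fun n => - (t * x) / (1 + y n)) (@expR R) _ (nbhs (- (t * x))) _ c).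
  exact: continuous_expR.
Unshelve. all: by end_near. Qed.

Lemma spec_int_cvg (f_ : nat -> R -> R) (f : R -> R) q :
  (forall n, bounded_ge0 1 (f_ n)) -> bounded_ge0 1 f ->
  (forall x, f_ n x @[n --> \oo] --> f x) ->
  spec_int E (f_ n) q @[n --> \oo] --> spec_int E f q.
Proof.
move=> hf_ hf cf; apply: fine_cvg.
rewrite -(spec_intE _ _ hf); apply: (@dominated_cvg _ _ _ _ _ _ _ _ (cst 1%E)) => //.
- by move=> n; apply/measurable_EFinP; case: (hf_ n).
- by move=> x _; apply: cvg_EFin; [near=> n|exact: cf].
- apply/integrableP; split => //; under eq_integral do rewrite abse1.
  by rewrite integral_cst// mul1e specm_lty.
- move=> n x _; rewrite lee_fin; have [_ /(_ x)/andP[? ?]] := hf_ n.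
  by rewrite ger0_norm.
Unshelve. all: by end_near. Qed.

Lemma spec_form_cvg (f_ : nat -> R -> R) (f : R -> R) u w :
  (forall n, bounded_ge0 1 (f_ n)) -> bounded_ge0 1 f ->
  (forall x, f_ n x @[n --> \oo] --> f x) ->
  spec_form E (f_ n) u w @[n --> \oo] --> spec_form E f u w.
Proof.
move=> hf_ hf cf; apply: cvgM; last exact: cvg_cst.
by apply: cvgB; exact: spec_int_cvg.
Qed.

(** Positivity of (1 + e L)^-1, stated for every solution w of (1 + e L) w = g. In this form it can
    be checked on the differential operator once L is identified with it. *)
Definition resolvent_positive : Prop := forall e g w, 0 < e -> L2 g -> L2 w ->
  {ae mu, forall x, 0 <= g x} ->
  spectral_integral E id w (fun x => e^-1 * (g x - w x)) ->
  {ae mu, forall x, 0 <= w x}.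

Lemma resolvent_iter e g n : resolvent_positive -> 0 < e -> L2 g -> {ae mu, forall x, 0 <= g x} ->
  exists w, [/\ L2 w, {ae mu, forall x, 0 <= w x} &
    forall w', L2 w' -> dot w w' = spec_form E (fun l => (resolvent_mult e \_ D) l ^+ n) g w'].
Proof.
move=> resolvent_ge0 e0 hg g0; have hr := bounded_ge0_resolvent e0.
have hrn k : bounded_ge0 1 (fun l => (resolvent_mult e \_ D) l ^+ k).
  have [mr rC] := hr; split; first exact: measurable_funX.
  by move=> x; have /andP[? ?] := rC x; rewrite exprn_ge0//= exprn_ile1.
elim: n => [|n [w [hw w0 wE]]].
  exists g; split => // w' hw'; rewrite -(spec_form1 E hg hw').
  by congr (spec_form E _ g w'); apply/funext => x; rewrite expr0.
have [v hv vE] := resolvent_exists E e0 hw.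
exists v; split => //.
  by apply: (resolvent_ge0 _ _ _ e0 hw hv w0); exact: resolvent_spectral_integral.
move=> w' hw'; rewrite vE// (spec_form_density_bounded (hrn n) hr hg hw hw' wE).
by congr (spec_form E _ g w'); apply/funext => x; rewrite exprS.
Qed.

(** Nonnegativity is tested by pairing with w >= 0, so weak convergence of the resolvent powers
    suffices, and this is dominated convergence of their multipliers. *)
Lemma semigroup_ge0 t g v : resolvent_positive -> 0 < t -> L2 g -> {ae mu, forall x, 0 <= g x} ->
  spectral_integral E (fun l => expR (- t * l)) g v ->
  {ae mu, forall x, 0 <= v x}.
Proof.
move=> resolvent_ge0 t0 hg g0; have ht := bounded_ge0_semigroup (ltW t0).
move=> /(spectral_integralP _ _ _ ht)[_ hv vE].
apply: dotL2_ge0_ae => // w hw w0; rewrite vE//.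
have e0 n : 0 < t / n.+1%:R by rewrite divr_gt0.
have hrn n : bounded_ge0 1 (fun l => (resolvent_mult (t / n.+1%:R) \_ D) l ^+ n.+1).
  have [mr rC] := bounded_ge0_resolvent (e0 n); split; first exact: measurable_funX.
  by move=> x; have /andP[? ?] := rC x; rewrite exprn_ge0//= exprn_ile1.
have c : spec_form E (fun l => (resolvent_mult (t / n.+1%:R) \_ D) l ^+ n.+1) g w
    @[n --> \oo] --> spec_form E ((fun l => expR (- t * l)) \_ D) g w.
  apply: spec_form_cvg => // x.
  have [x0|x0] := leP 0 x.
    have xD : x \in D by rewrite mem_set//= in_itv/= x0.
    under eq_fun do rewrite patchE xD; rewrite patchE xD.
    by apply: resolvent_mult_pow_cvg => //; exact: ltW.
  have xD : (x \in D) = false by apply/negP; rewrite inE/= in_itv/= leNgt x0.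
  (* Off [0, +oo[ the cut multiplier is 0, and so are its powers because the exponent n + 1 is never
     0. *)
  under eq_fun do rewrite patchE xD -[point]/(0 : R) expr0n/=; rewrite patchE xD.
  exact: cvg_cst.
rewrite -(cvg_lim _ c)//; apply: limr_ge; first by apply/cvg_ex;
  exists (spec_form E ((fun l => expR (- t * l)) \_ D) g w).
near=> n; have [z [hz z0 zE]] := resolvent_iter n.+1 resolvent_ge0 (e0 n) hg g0.
rewrite -zE//; apply: dotL2_ae_ge0 => //; [exact: L2_measurable hz|exact: L2_measurable hw].
Unshelve. all: by end_near. Qed.

End semigroup.

(** * Measurability and Haar measure *)

Section approximation.
Context (R : realType).

(** The approximants take countably many values on measurable cells, so they are measurable whatever
    the values are. This is how continuity yields measurability for the sigma-algebra generated by
    coordinates; convergence is asked on D only, so sample points may fall outside D. *)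
Lemma measurable_fun_countable_approx d (T : measurableType d) (I : countType)
    (D : set T) (i_ : nat -> T -> I) (c_ : nat -> I -> R) (f : T -> R) :
  measurable D -> (forall k z, measurable (i_ k @^-1` [set z])) ->
  (forall x, D x -> c_ k (i_ k x) @[k --> \oo] --> f x) ->
  measurable_fun D f.
Proof.
move=> mD mi cf; apply: (@measurable_fun_cvg _ _ _ _ (fun k x => c_ k (i_ k x))) => // k _ Y mY.
apply: measurableI => //.
have -> : (fun x => c_ k (i_ k x)) @^-1` Y =
    \bigcup_n (if unpickle n is Some z then
      (if `[< Y (c_ k z) >] then i_ k @^-1` [set z] else set0) else set0).
  apply/seteqP; split => [x Yx|x [n _]].
    exists (pickle (i_ k x)) => //; rewrite pickleK.
    by rewrite (_ : `[< _ >] = true)//; apply/asboolP.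
  by case: (unpickle n) => // z; case: asboolP => // Yz /= ->.
apply: bigcupT_measurable => n; case: (unpickle n) => [z|]; last exact: measurable0.
by case: ifPn => _; [exact: mi|exact: measurable0].
Qed.

Definition grid (k : nat) (x : R) : int := Num.floor (k.+1%:R * x).
Definition ungrid (k : nat) (z : int) : R := z%:~R / k.+1%:R.

Lemma grid_bound k x : `|ungrid k (grid k x) - x| <= k.+1%:R^-1.
Proof.
have k0 : 0 < k.+1%:R :> R by [].
have /andP[h1 h2] := floor_itv (k.+1%:R * x).
rewrite /ungrid /grid; set z := Num.floor _ in h1 h2 *.
rewrite -(ler_pM2l k0) mulfV ?gt_eqF// -[X in X * _](@ger0_norm _ k.+1%:R)//.
rewrite -normrM mulrBr mulrCA mulfV ?gt_eqF// mulr1 distrC.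
rewrite ger0_norm ?subr_ge0// lerBlDr addrC.
by move: h2; rewrite intrD => /ltW.
Qed.

Lemma cvg_grid (x : R) : ungrid k (grid k x) @[k --> \oo] --> x.
Proof.
apply/cvgrPdist_le => e e0; near=> k; rewrite distrC (le_trans (grid_bound k x))//.
near: k; have := @near_infty_natSinv_lt R (PosNum e0); apply: filterS => k /= h.
exact: ltW.
Unshelve. all: by end_near. Qed.

Lemma measurable_grid k z : measurable ((grid k : measurableTypeR R -> int) @^-1` [set z]).
Proof.
rewrite (_ : _ @^-1` _ = `[ungrid k z, ungrid k (z + 1)[%classic)//.
apply/seteqP; split => x /=; rewrite in_itv/= /ungrid /grid.
  move=> <-; have /andP[h1 h2] := floor_itv (k.+1%:R * x).
  by rewrite ler_pdivrMr// ltr_pdivlMr// ![x * _]mulrC h1 h2.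
rewrite ler_pdivrMr// ltr_pdivlMr// ![x * _]mulrC => h.
by apply/floor_def.
Qed.

Lemma cvg_rV n (I : Type) (F : set_system I) (FF : Filter F) (f : I -> 'rV[R]_n) (v : 'rV[R]_n) :
  (forall j, f i ord0 j @[i --> F] --> v ord0 j) -> f @ F --> v.
Proof.
move=> H A [P hP PA]; rewrite nbhs_filterE/=.
have : \forall i \near F, forall j, P ord0 j (f i ord0 j).
  by apply: filter_forall => j; apply: (H j); exact: hP.
apply: filterS => i hi; apply: PA => i0 j0; rewrite ord1; exact: hi.
Qed.

Lemma cvg_to_pair (I : Type) (F : set_system I) (FF : Filter F) (U V : topologicalType)
    (f : I -> U) (g : I -> V) (u : U) (v : V) :
  f @ F --> u -> g @ F --> v -> (f i, g i) @[i --> F] --> (u, v).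
Proof.
move=> cf cg A [[P Q] [/= Pu Qv] PQA].
exact: (@filterS2 I F FF (f @^-1` P) (g @^-1` Q) _ (fun i Pi Qi => PQA (f i, g i) (conj Pi Qi))
  (cf _ Pu) (cg _ Qv)).
Qed.

Definition gridV n (k : nat) (v : 'rV[R]_n) : 'rV[int]_n := map_mx (grid k) v.
Definition ungridV n (k : nat) (z : 'rV[int]_n) : 'rV[R]_n := map_mx (ungrid k) z.

Lemma cvg_gridV n (v : 'rV[R]_n) : ungridV k (gridV k v) @[k --> \oo] --> v.
Proof.
apply: cvg_rV => j; under eq_fun do rewrite !mxE.
exact: cvg_grid.
Qed.

Lemma measurable_gridV n k z : measurable ((@gridV n k) @^-1` [set z] : set 'rV[R]_n).
Proof.
rewrite (_ : _ @^-1` _ = \bigcap_(j in [set: 'I_n])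
   ((fun v : 'rV[R]_n => v ord0 j) @^-1` ((grid k : measurableTypeR R -> int) @^-1`
     [set z ord0 j]))).
  apply: fin_bigcap_measurable => // j _; rewrite -[X in measurable X]setTI.
  by apply: measurable_coord => //; exact: measurable_grid.
apply/seteqP; split => v /=; first by move=> <- j _ /=; rewrite mxE.
by move=> h; apply/rowP => j; rewrite mxE; exact: h.
Qed.

Lemma continuous_measurable_rV n (f : 'rV[R]_n -> R) : continuous f ->
  measurable_fun setT f.
Proof.
move=> cf; apply: (@measurable_fun_countable_approx _ _ _ setT (@gridV n)
  (fun k z => f (ungridV k z))) => //.
  exact: measurable_gridV.
by move=> v _; apply: (@cvg_comp _ _ _ (fun k => ungridV k (gridV k v)) f);
  [exact: cvg_gridV|exact: cf].
Qed.

Lemma measurable_preimageX d1 d2 (T1 : measurableType d1) (T2 : measurableType d2)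
    (I J : Type) (i : T1 -> I) (j : T2 -> J) (z : I * J) :
  measurable (i @^-1` [set z.1]) -> measurable (j @^-1` [set z.2]) ->
  measurable ((fun p : T1 * T2 => (i p.1, j p.2)) @^-1` [set z]).
Proof.
move=> mi mj; rewrite (_ : _ @^-1` _ = (i @^-1` [set z.1]) `*` (j @^-1` [set z.2])).
  exact: measurableX.
by apply/seteqP; split => -[x y] /=; case: z {mi mj} => z1 z2/= [-> ->].
Qed.

Lemma continuous_measurable_rV2 n p (f : 'rV[R]_n * 'rV[R]_p -> R) : continuous f ->
  measurable_fun setT f.
Proof.
move=> cf; apply: (@measurable_fun_countable_approx _ _ _ setT
  (fun k q => (gridV k q.1, gridV k q.2)) (fun k z => f (ungridV k z.1, ungridV k z.2))) => //.
  by move=> k z; apply: measurable_preimageX; exact: measurable_gridV.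
move=> [v w] _ /=.
apply: (@cvg_comp _ _ _ (fun k => (ungridV k (gridV k v), ungridV k (gridV k w))) f);
  last exact: cf.
by apply: cvg_to_pair; exact: cvg_gridV.
Qed.

Lemma measurable_fun_half_space n (f : R^o * 'rV[R]_n -> R) :
  (forall p, 0 < p.1 -> {for p, continuous f}) ->
  measurable_fun (`]0, +oo[%classic `*` setT : set (measurableTypeR R * 'rV[R]_n)) f.
Proof.
move=> cf; apply: (@measurable_fun_countable_approx _ _ _ _
  (fun k q => (grid k q.1, gridV k q.2)) (fun k z => f (ungrid k z.1, ungridV k z.2))) => //.
- exact: measurableX.
- by move=> k z; apply: measurable_preimageX; [exact: measurable_grid|exact: measurable_gridV].
move=> [t v] [/=]; rewrite in_itv/= andbT => t0 _.
apply: (@cvg_comp _ _ _ (fun k => (ungrid k (grid k t) : R^o, ungridV k (gridV k v))) f);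
  last exact: cf.
by apply: cvg_to_pair; [exact: cvg_grid|exact: cvg_gridV].
Qed.

End approximation.

(** * Lebesgue measure through boxes *)

Section lebesgue_box.
Context (R : realType) (n : nat).
Local Notation TR := (measurableTypeR R).
Local Notation V := ('rV[R]_n).

Definition box (A : 'I_n -> set TR) : set V := [set v | forall i, A i (v ord0 i)].

Lemma measurable_box A : (forall i, measurable (A i)) -> measurable (box A).
Proof.
move=> mA; rewrite (_ : box A = \bigcap_(i in [set: 'I_n])
    ((fun v : V => v ord0 i) @^-1` A i)).
  apply: fin_bigcap_measurable => // i _.
  by rewrite -[X in measurable X]setTI; apply: measurable_coord => //; exact: mA.
by apply/seteqP; split => [v /= H i _|v H i /=]; exact: H.
Qed.

Definition cube (k : nat) : set V := box (fun=> `]- k%:R, k%:R[%classic).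

Lemma measurable_cube k : measurable (cube k).
Proof. by apply: measurable_box => i; exact: measurable_itv. Qed.

Lemma cube_lty k : (leb R n (cube k) < +oo)%E.
Proof.
rewrite leb_box; last by move=> i; exact: measurable_itv.
rewrite (eq_bigr (fun=> (k%:R - - k%:R)%:E)); last first.
  move=> i _; rewrite lebesgue_measure_itv/= lte_fin; case: ifPn => //.
  by rewrite -leNgt => k0; congr EFin; have := ler0n R k; lra.
by rewrite prodEFin ltry.
Qed.

Lemma cube_bigcup : \bigcup_k cube k = setT.
Proof.
apply/seteqP; split => // v _.
exists (\max_(i < n) Num.bound `|v ord0 i|) => // i /=.
rewrite in_itv/= -ltr_norml (lt_le_trans (archi_boundP (normr_ge0 _)))//.
by rewrite ler_nat (leq_bigmax i).
Qed.

Let boxes := [set box A | A in [set A | forall i, measurable (A i)]].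

Lemma measurable_boxes : @measurable _ V = <<s boxes >>.
Proof.
apply/seteqP; split; apply: smallest_sub.
- exact: smallest_sigma_algebra.
- move=> B; rewrite -bigcup_seq => -[i _ [C mC <-]] /=.
  apply: sub_sigma_algebra; exists (fun j => if j == i then C else setT) => /=.
    by move=> j; case: ifP.
  rewrite setTI; apply/seteqP; split => v /=.
    by move/(_ i); rewrite eqxx.
  by move=> h j; case: eqP => // ->.
- exact: sigma_algebra_measurable.
- by move=> _ [A mA <-]; exact: measurable_box.
Qed.

Lemma leb_unique (m : {measure set V -> \bar R}) :
  (forall A, (forall i, measurable (A i)) -> m (box A) = leb R n (box A)) ->
  forall B, measurable B -> m B = leb R n B.
Proof.
move=> H B mB; apply: (measure_unique boxes cube) => //.
- exact: measurable_boxes.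
- move=> _ _ [A mA <-] [C mC <-]; exists (fun i => A i `&` C i).
    by move=> i; apply: measurableI; [exact: mA|exact: mC].
  apply/seteqP; split => v /=; first by move=> h; split => i; have [] := h i.
  by move=> [h1 h2] i; split; [exact: h1|exact: h2].
- by move=> k; exists (fun=> `]- k%:R, k%:R[%classic) => // i; exact: measurable_itv.
- exact: cube_bigcup.
- by move=> _ [A mA <-]; exact: H.
- move=> k; rewrite H; last by move=> i; exact: measurable_itv.
  exact: cube_lty.
Qed.

Lemma leb_sigma_finite : sigma_finite setT (leb R n).
Proof.
exists cube; first by rewrite cube_bigcup.
by move=> k; split; [exact: measurable_cube|exact: cube_lty].
Qed.

(* [leb] under a name that carries its sigma-finiteness. *)
Definition lebesgue : set V -> \bar R := leb R n.

HB.instance Definition _ := Measure.on lebesgue.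
HB.instance Definition _ := @Measure_isSigmaFinite.Build _ _ _ lebesgue leb_sigma_finite.

Lemma measurable_oppT (A : set TR) : measurable A -> measurable (-%R @^-1` A : set TR).
Proof. by move=> mA; rewrite -[X in measurable X]setTI; exact: (@oppr_measurable R setT). Qed.

Lemma leb_opp (B : set V) : measurable B -> leb R n (-%R @^-1` B) = leb R n B.
Proof.
move=> mB.
have mo : measurable_fun setT (-%R : V -> V).
  apply: measurable_fun_coordP => i; under eq_fun do rewrite mxE.
  apply: measurableT_comp; last exact: measurable_coord.
  exact: (@oppr_measurable R setT).
pose f : {mfun V >-> V} := mfun_Sub (mem_set mo).
apply: (@leb_unique (pushforward (leb R n) f)) => // A mA.
transitivity (leb R n (box (fun i => -%R @^-1` A i))).
  rewrite /= /pushforward; apply: (congr1 (leb R n)).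
  by apply/seteqP; split => v /= h i; move: (h i); rewrite /= mxE.
rewrite !leb_box//; last by move=> i; exact: measurable_oppT.
by apply: eq_bigr => i _; have := @lebesgue_measureN R (A i) (mA i); exact.
Qed.

End lebesgue_box.

Section preserving.
Context d (T : measurableType d) (R : realType) (mu : {measure set T -> \bar R}).

Lemma ge0_integral_preserving (phi : T -> T) (f : T -> \bar R) :
  measurable_fun setT phi ->
  (forall A, measurable A -> mu (phi @^-1` A) = mu A) ->
  measurable_fun setT f -> (forall x, (0 <= f x)%E) ->
  (\int[mu]_x f (phi x) = \int[mu]_x f x)%E.
Proof.
move=> mphi pphi mf f0.
rewrite -[LHS](@ge0_integral_pushforward _ _ _ _ _ _ mphi mu setT f) => //.
pose g : {mfun T >-> T} := mfun_Sub (mem_set mphi).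
by apply: (@eq_measure_integral _ _ _ setT mu (pushforward mu g)) => A mA _; exact: pphi.
Qed.

Lemma integral_preserving (phi : T -> T) (f : T -> \bar R) :
  measurable_fun setT phi ->
  (forall A, measurable A -> mu (phi @^-1` A) = mu A) ->
  measurable_fun setT f ->
  (\int[mu]_x f (phi x) = \int[mu]_x f x)%E.
Proof.
move=> mphi pphi mf; rewrite [LHS]integralE [RHS]integralE.
have e1 := ge0_integral_preserving mphi pphi (measurable_funepos mf) (fun _ => funepos_ge0 _ _).
have e2 := ge0_integral_preserving mphi pphi (measurable_funeneg mf) (fun _ => funeneg_ge0 _ _).
rewrite -[in RHS]e1 -[in RHS]e2; congr (_ - _)%E.
  by apply: eq_integral => x _; rewrite !funeposE.
by apply: eq_integral => x _; rewrite !funenegE.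
Qed.

End preserving.

Section continuous_map.
Context (R : realType).

Lemma continuous_measurable_map n p (f : 'rV[R]_n -> 'rV[R]_p) : continuous f ->
  measurable_fun setT f.
Proof.
move=> cf; apply: measurable_fun_coordP => i.
apply: continuous_measurable_rV => x.
by apply: (@continuous_comp _ _ _ f (fun v : 'rV[R]_p => v ord0 i));
  [exact: cf|exact: coord_continuous].
Qed.

Lemma continuous_measurable_map2 n p q (f : 'rV[R]_n * 'rV[R]_p -> 'rV[R]_q) :
  continuous f -> measurable_fun setT f.
Proof.
move=> cf; apply: measurable_fun_coordP => i.
apply: continuous_measurable_rV2 => x.
by apply: (@continuous_comp _ _ _ f (fun v : 'rV[R]_q => v ord0 i));
  [exact: cf|exact: coord_continuous].
Qed.

End continuous_map.

(** * Group law and right invariance of Lebesgue measure *)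

Section carnot.
Context (R : realType) (n : nat) (G : carnot_group R n).
Local Notation V := ('rV[R]_n).
Implicit Types (x y a : V).

Lemma cg_opV x : G x (- x) = 0.
Proof. by have := cg_exp G x 1 (-1); rewrite scale1r scaleN1r subrr scale0r. Qed.

Lemma cg_opKV x y : G x (G (- x) y) = y.
Proof. by rewrite cg_opA cg_opV cg_op0l. Qed.

Lemma cg_oppM x y : G x y = - G (- y) (- x).
Proof.
rewrite -[LHS](cg_op0r G) -(cg_opV (G (- y) (- x))) cg_opA.
by rewrite -(cg_opA _ x) cg_opKV cg_opV cg_op0l.
Qed.

Lemma cg_continuous2 : continuous (fun p : V * V => G p.1 p.2).
Proof. by move=> p; have [] := cg_smooth G nil (x := p) I. Qed.

Lemma cg_continuous_comp (T : topologicalType) (f g : T -> V) :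
  continuous f -> continuous g -> continuous (fun t => G (f t) (g t)).
Proof.
move=> cf cg t; apply: (@continuous_comp _ _ _ (fun t => (f t, g t)) (fun p : V * V => G p.1 p.2)).
  by apply: cvg_to_pair; [exact: cf|exact: cg].
exact: cg_continuous2.
Qed.

Lemma cg_continuousr a : continuous (G a).
Proof. by apply: (@cg_continuous_comp _ (fun=> a) id);
  [exact: cst_continuous|move=> t; exact: cvg_id]. Qed.

Lemma cg_continuousl a : continuous (G^~ a).
Proof. by apply: (@cg_continuous_comp _ id (fun=> a));
  [move=> t; exact: cvg_id|exact: cst_continuous]. Qed.

(** Group inversion is x -> -x, which preserves Lebesgue measure and conjugates right translation by
    a into left translation by -a. *)
Lemma cg_leb_right a (A : set V) : measurable A ->
  leb R n ((G^~ a) @^-1` A) = leb R n A.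
Proof.
move=> mA; have mo (B : set V) : measurable B -> measurable (-%R @^-1` B).
  move=> mB; rewrite -[X in measurable X]setTI.
  by apply: (@continuous_measurable_map _ _ _ (-%R : V -> V)) => //; exact: opp_continuous.
rewrite -[RHS](leb_opp mA) -[RHS](cg_haar G (- a) (mo _ mA)).
have -> : (G^~ a) @^-1` A = -%R @^-1` (G (- a) @^-1` (-%R @^-1` A)).
  by apply/seteqP; split => x; rewrite /= [G x a]cg_oppM.
rewrite leb_opp// -[X in measurable X]setTI.
by apply: continuous_measurable_map => //; [exact: cg_continuousr|exact: mo].
Qed.

Lemma cg_integral_right a (f : V -> \bar R) : measurable_fun setT f ->
  (\int[leb R n]_x f (G x a) = \int[leb R n]_x f x)%E.
Proof.
move=> mf; apply: (integral_preserving (phi := G^~ a)) => //.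
  by apply: continuous_measurable_map; exact: cg_continuousl.
exact: cg_leb_right.
Qed.

End carnot.

(** * The sub-Laplacian on test functions *)

Section line.
Context (R : realType) (V W : normedModType R).

Let lineE (f : V -> W) (y v : V) (t : R) :
  (fun h : R => h^-1 *: (((fun s : R => f (y + s *: v)) \o shift t) (h *: 1) - f (y + t *: v))) =
  (fun h : R => h^-1 *: ((f \o shift (y + t *: v)) (h *: v) - f (y + t *: v))).
Proof.
apply/funext => h /=; congr (_ *: (f _ - _)).
by rewrite scalerDl addrCA [h *: 1]mulr1.
Qed.

Lemma derivable_line (f : V -> W) (y v : V) (t : R) :
  derivable f (y + t *: v) v <-> derivable (fun s : R => f (y + s *: v)) t 1.
Proof. by rewrite /derivable lineE. Qed.

Lemma derive_line (f : V -> W) (y v : V) (t : R) :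
  'D_v f (y + t *: v) = 'D_1 (fun s : R => f (y + s *: v)) t.
Proof. by rewrite /derive lineE. Qed.

Lemma is_derive_line (f : V -> W) (y v : V) (t : R) :
  derivable f (y + t *: v) v ->
  is_derive t 1 (fun s : R => f (y + s *: v)) ('D_v f (y + t *: v)).
Proof. by move=> df; split; [exact/derivable_line|rewrite derive_line]. Qed.

End line.

(** * Functions with continuous directional derivatives *)

Section C1.
Context (R : realType) (n : nat).
Local Notation V := ('rV[R]_n).
Implicit Types (f g : V -> R) (x y v : V).

Lemma mvt_line f y v (a : R) : (forall z, derivable f z v) ->
  exists2 c, `|c| <= `|a| & f (y + a *: v) - f y = a * 'D_v f (y + c *: v).
Proof.
move=> df; have dg t := is_derive_line (df (y + t *: v)).
have cg (i : interval R) : {within [set` i], continuous (fun s : R => f (y + s *: v))}.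
  by apply: derivable_within_continuous => t _; exact: (@ex_derive _ _ _ _ _ _ _ (dg t)).
have [a0|a0] := leP 0 a.
  have [c /itvP c0a] := MVT_segment a0 (fun t _ => dg t) (cg _).
  rewrite scale0r addr0 subr0 mulrC => ->; exists c => //.
  by rewrite !ger0_norm ?c0a.
have [c /itvP c0a] := MVT_segment (ltW a0) (fun t _ => dg t) (cg _).
rewrite scale0r addr0 sub0r mulrN mulrC => /eqP;
  rewrite -subr_eq0 opprK addrC addr_eq0 opprB => /eqP E.
exists c; first by rewrite !ler0_norm ?lerN2 ?c0a// ltW.
by rewrite E.
Qed.

Definition C1 f := forall v, (forall x, derivable f x v) /\ continuous ('D_v f).

Lemma coord_norm_le v i : `|v ord0 i| <= `|v|.
Proof. by rewrite [leRHS]mx_normrE; exact: (le_bigmax _ (fun ij => `|v ij.1 ij.2|) (ord0, i)). Qed.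

Lemma rV_norm_le v (c : R) : 0 <= c -> (forall i, `|v ord0 i| <= c) -> `|v| <= c.
Proof.
move=> c0 h; rewrite [leLHS]mx_normrE; apply: bigmax_le => // -[i j] _ /=.
by rewrite ord1.
Qed.

(** The corners of the staircase from 0 to h along the coordinate axes. *)
Definition trunc (k : nat) (h : V) : V := \row_i (if (i < k)%N then h ord0 i else 0).

Lemma truncS (i : 'I_n) h : trunc i.+1 h = trunc i h + h ord0 i *: delta_mx ord0 i.
Proof.
apply/rowP => j; rewrite !mxE eqxx/= ltnS leq_eqVlt -val_eqE/=.
case: eqVneq => [/val_inj ->|_] /=; first by rewrite ltnn add0r mulr1.
by rewrite mulr0 addr0.
Qed.

Lemma trunc_delta_norm (i : 'I_n) (h : V) (c : R) : `|c| <= `|h ord0 i| ->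
  `|trunc i h + c *: delta_mx ord0 i| <= `|h|.
Proof.
move=> ch; apply: rV_norm_le => // j; rewrite !mxE eqxx/= -val_eqE/=.
case: eqVneq => [/val_inj ->|_] /=.
  by rewrite ltnn add0r mulr1 (le_trans ch)// coord_norm_le.
by rewrite mulr0 addr0; case: ifP => _; rewrite ?normr0// coord_norm_le.
Qed.

Local Notation e_ i := (delta_mx ord0 i : V).

Lemma continuous_sum_fun (I : finType) (F : I -> V -> R) :
  (forall i, continuous (F i)) -> continuous (fun x => \sum_i F i x : R).
Proof.
move=> cF; elim: (index_enum I) => [|i s IH].
  by under eq_fun do rewrite big_nil; exact: cst_continuous.
under eq_fun do rewrite big_cons.
by move=> x; exact: (continuousD (cF i x) (IH x)).
Qed.

Let telescope_step (A B fx b b' S : R) : B - A = b' -> B - fx - (b + S) = A - fx - S + (b' - b).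
Proof. by move=> <-; ring. Qed.

(** The mean value theorem on each edge of the staircase replaces the increment by a partial
    derivative at a point within |h| of x, where continuity controls it. *)
Lemma C1_expand f x (eps : R) : C1 f -> 0 < eps ->
  \forall h \near (0 : V), `|f (h + x) - f x - \sum_i h ord0 i * 'D_(e_ i) f x| <= eps * `|h|.
Proof.
(* The n edges cost at most n d <= eps; dividing by n + 1 keeps d meaningful for n = 0. *)
move=> cf eps0; pose d := eps / n.+1%:R.
have d0 : 0 < d by rewrite divr_gt0.
have : \forall z \near x, forall i : 'I_n, `|'D_(e_ i) f x - 'D_(e_ i) f z| < d.
  apply: (@filter_forall _ _ (fun (i : 'I_n) z => is_true (`|'D_(e_ i) f x - 'D_(e_ i) f z| < d))
    (nbhs x)) => i.
  by move/cvgrPdist_lt : ((cf (e_ i)).2 x); apply.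
move=> /nbhs_ballP[r /= r0 hr]; apply/nbhs_ballP; exists r => //= h.
rewrite -ball_normE/= sub0r normrN => hr'.
have step k : (k <= n)%N -> `|f (trunc k h + x) - f x -
    \sum_(i < n | (i < k)%N) h ord0 i * 'D_(e_ i) f x| <= k%:R * (d * `|h|).
  elim: k => [_|k IH kn].
    rewrite big_pred0// subr0 mul0r (_ : trunc 0 h = 0) ?add0r ?subrr ?normr0//.
    by apply/rowP => j; rewrite !mxE.
  pose i := Ordinal kn.
  rewrite (bigD1 i)//= (eq_bigl (fun j : 'I_n => (j < k)%N)); last first.
    by move=> j; rewrite ltnS -val_eqE/= ltn_neqAle andbC.
  have [c ch E] := mvt_line (trunc k h + x) (h ord0 i) (cf (e_ i)).1.
  have := IH (ltnW kn); set S := \sum_(_ < _ | _) _; set A := f (trunc k h + x) => IHk.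
  rewrite [trunc k.+1 h](truncS i h)/= [_ + _ + x]addrAC.
  have -> : f (trunc k h + x + h ord0 i *: e_ i) - f x - (h ord0 i * 'D_(e_ i) f x + S) =
      (A - f x - S) + h ord0 i * ('D_(e_ i) f (trunc k h + x + c *: e_ i) - 'D_(e_ i) f x).
    by rewrite mulrBr; exact: telescope_step.
  rewrite -natr1 mulrDl mul1r (le_trans (ler_normD _ _))// lerD// normrM mulrC.
  apply: ler_pM => //; last exact: coord_norm_le.
  rewrite distrC ltW// addrAC hr// -ball_normE/= opprD addrCA subrr addr0 normrN.
  exact: le_lt_trans (trunc_delta_norm ch) hr'.
have := step n (leqnn n).
rewrite (_ : trunc n h = h); last by apply/rowP => j; rewrite !mxE ltn_ord.
under [X in _ - X]eq_bigl do rewrite ltn_ord.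
move=> /le_trans; apply; rewrite mulrA ler_wpM2r// /d mulrCA ger_pMr//.
by rewrite ler_pdivrMr// mul1r ler_nat.
Qed.

Let C1_diff f x : C1 f -> differentiable f x /\
  forall v, 'd f x v = \sum_i v ord0 i * 'D_(e_ i) f x.
Proof.
move=> cf; pose Lf (h : V) : R := \sum_i h ord0 i * 'D_(e_ i) f x.
have Llin : linear Lf.
  move=> c u v; rewrite /Lf [X in _ = X + _](_ : _ = c * \sum_i u ord0 i * 'D_(e_ i) f x)//
    mulr_sumr -big_split/=; apply: eq_bigr => i _.
  by rewrite !mxE mulrDl mulrA.
pose L : {linear V -> R} := HB.pack Lf (GRing.isLinear.Build _ _ _ _ _ Llin).
have Lc : continuous L.
  apply: (@continuous_sum_fun _ (fun i (h : V) => h ord0 i * 'D_(e_ i) f x)) => i h.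
  by apply: (@continuousM _ _ (fun h : V => h ord0 i) (cst ('D_(e_ i) f x)));
    [exact: coord_continuous|exact: cst_continuous].
have E : f \o shift x = cst (f x) + L +o_ (0 : V) id.
  apply/eqaddoP => eps eps0; have := C1_expand x cf eps0; apply: filterS => h /=.
  by rewrite -!fctE opprD addrA.
have dL := diff_unique Lc E; split; last by move=> v; rewrite dL.
by apply/diff_locallyP; rewrite dL.
Qed.

Lemma C1_differentiable f x : C1 f -> differentiable f x.
Proof. by move=> cf; have [] := C1_diff x cf. Qed.

Lemma C1_diffE f x v : C1 f -> 'd f x v = \sum_i v ord0 i * 'D_(e_ i) f x.
Proof. by move=> cf; have [_] := C1_diff x cf; exact. Qed.

Lemma C1_continuous f : C1 f -> continuous f.
Proof. by move=> cf x; exact/differentiable_continuous/C1_differentiable. Qed.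

Lemma C1_cst c : C1 (cst c).
Proof.
move=> v; split=> x; first exact: derivable_cst.
suff -> : 'D_v (cst c) = cst 0 by exact: cst_continuous.
by apply/funext => z; rewrite derive_cst.
Qed.

Lemma C1_add f g : C1 f -> C1 g -> C1 (f \+ g).
Proof.
move=> cf cg v; have [df cdf] := cf v; have [dg cdg] := cg v.
split; first by move=> x; exact: derivableD.
rewrite (_ : 'D_v (f \+ g) = 'D_v f \+ 'D_v g); last first.
  by apply/funext => x; exact: deriveD.
by move=> x; exact: (continuousD (cdf x) (cdg x)).
Qed.

Lemma C1_mul f g : C1 f -> C1 g -> C1 (fun x => f x * g x).
Proof.
move=> cf cg v; have [df cdf] := cf v; have [dg cdg] := cg v.
split; first by move=> x; exact: (@derivableM _ _ f g).
rewrite (_ : 'D_v _ = fun x => f x * 'D_v g x + g x * 'D_v f x); last first.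
  by apply/funext => x; exact: (@deriveM _ _ f g).
move=> x; have cfx := C1_continuous cf (x := x); have cgx := C1_continuous cg (x := x).
exact: (continuousD (continuousM cfx (cdg x)) (continuousM cgx (cdf x))).
Qed.

Lemma C1_sum (I : finType) (F : I -> V -> R) : (forall i, C1 (F i)) ->
  C1 (fun x => \sum_i F i x).
Proof.
move=> cF; elim: (index_enum I) => [|i s IH].
  by under eq_fun do rewrite big_nil; exact: C1_cst.
by under eq_fun do rewrite big_cons; exact: C1_add.
Qed.

End C1.

Section coordinates.
Context (R : realType) (n : nat) (U : normedModType R).
Local Notation V := ('rV[R]_n).

Lemma is_derive_coord (f : U -> V) x u i : derivable f x u ->
  is_derive x u (fun z => f z ord0 i : R) ('D_u f x ord0 i).
Proof.
move=> df; have c : h^-1 *: (f (h *: u + x) ord0 i - f x ord0 i) @[h --> 0^'] --> 'D_u f x ord0 i.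
  have e : (fun h : R => h^-1 *: (f (h *: u + x) ord0 i - f x ord0 i)) =
      (fun v : V => v ord0 i) \o (fun h : R => h^-1 *: ((f \o shift x) (h *: u) - f x)).
    by apply/funext => h /=; rewrite !mxE.
  rewrite e; apply: cvg_comp; first exact: df.
  exact: coord_continuous.
split; last exact/cvg_lim.
by apply/cvg_ex; exists ('D_u f x ord0 i).
Qed.

End coordinates.

Section smooth_C1.
Context (R : realType) (n : nat).
Local Notation V := ('rV[R]_n).

Lemma smooth_C1 (f : V -> R) : smooth_on setT (f : V -> R^o) -> C1 f.
Proof.
move=> sf v; split=> x; first by have [_] := sf [::] x I; exact.
by have [] := sf [:: v] x I.
Qed.

Lemma smooth_C1_derive (f : V -> R) u : smooth_on setT (f : V -> R^o) -> C1 ('D_u f).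
Proof.
move=> sf v; split=> x; first by have [_] := sf [:: u] x I; exact.
by have [] := sf [:: v; u] x I.
Qed.

End smooth_C1.

(** * Left-invariant vector fields in coordinates *)

Section fields.
Context (R : realType) (n : nat) (G : carnot_group R n).
Local Notation V := ('rV[R]_n).
Local Notation F := (fun p : V * V => G p.1 p.2).
Local Notation e_ i := (delta_mx ord0 i : V).

(** The difference quotient of a left translation at 0 is one of the group law in the direction (0,
    v) at (x, 0); joint smoothness of the law thus gives regularity of the field in x. *)
Let fieldE v x : (fun h : R => h^-1 *: ((G x \o shift 0) (h *: v) - G x 0)) =
  (fun h : R => h^-1 *: ((F \o shift (x, 0)) (h *: (0, v)) - F (x, 0))).
Proof. by apply/funext => h /=; rewrite scaler0 add0r. Qed.

Lemma left_field_derivable v x : derivable (G x) 0 v.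
Proof.
rewrite /derivable fieldE.
by have [_] := cg_smooth G [::] (x := (x, 0)) I; exact.
Qed.

Lemma left_fieldE v x : left_field G v x = 'D_(0, v) F (x, 0).
Proof. by rewrite /left_field /derive fieldE. Qed.

Let fieldDE v u x :
  (fun h : R => h^-1 *: ((left_field G v \o shift x) (h *: u) - left_field G v x)) =
  (fun h : R => h^-1 *: (('D_(0, v) F \o shift (x, 0)) (h *: (u, 0)) - 'D_(0, v) F (x, 0))).
Proof.
apply/funext => h; have e : (h *: u + x, 0) = h *: (u, 0) + (x, 0) :> V * V.
  by rewrite [RHS]surjective_pairing/= scaler0 addr0.
by rewrite /comp /shift !left_fieldE e.
Qed.

Lemma continuous_slice (g : V * V -> V) :
  continuous g -> continuous (fun x => g (x, 0)).
Proof.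
move=> cg x; apply: (@continuous_comp V (V * V)%type V (fun x : V => (x, 0 : V)) g); last exact: cg.
apply: (@cvg_to_pair V (nbhs x) _ V V id (fun=> 0) x 0); first exact: cvg_id.
exact: (@cst_continuous V V 0 x).
Qed.

Lemma left_field_C1 v i : C1 (fun x => left_field G v x ord0 i).
Proof.
move=> u; have sF := cg_smooth G.
have df x : derivable (left_field G v) x u.
  by rewrite /derivable fieldDE; have [_] := sF [:: (0, v)] (x, 0) I; exact.
have Ds x := is_derive_coord i (df x).
split=> [x|]; first exact: (@ex_derive _ _ _ _ _ _ _ (Ds x)).
have -> : 'D_u (fun x => left_field G v x ord0 i) =
    fun x => 'D_(u, 0) ('D_(0, v) F) (x, 0) ord0 i.
  apply/funext => x; rewrite (@derive_val _ _ _ _ _ _ _ (Ds x)).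
  by rewrite [in LHS]/derive fieldDE.
move=> x; apply: (@continuous_comp _ _ _ (fun x => 'D_(u, 0) ('D_(0, v) F) (x, 0))
  (fun v : V => v ord0 i)).
  apply: (continuous_slice (g := 'D_(u, 0) ('D_(0, v) F))) => p.
  by have [] := sF [:: (u, 0); (0, v)] p I.
exact: coord_continuous.
Qed.

Lemma is_derive_left v (f : V -> R) x : C1 f ->
  is_derive 0 v (fun z => f (G x z)) (\sum_i left_field G v x ord0 i * 'D_(e_ i) f x).
Proof.
move=> cf; pose c (s : R) := G x (0 + s *: v).
have dc : is_derive (0 : R) 1 c (left_field G v x).
  have := @is_derive_line _ _ _ (G x) 0 v 0; rewrite scale0r addr0; apply.
  exact: left_field_derivable.
have c0 : c 0 = x by rewrite /c scale0r addr0 cg_op0r.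
have dfc : differentiable c 0 by apply/derivable1_diffP; exact: (@ex_derive _ _ _ _ _ _ _ dc).
have dff : differentiable f (c 0) by exact: C1_differentiable.
have dd := differentiable_comp dfc dff.
have e := @derive_line _ _ _ (fun z => f (G x z)) 0 v 0.
have k := @derivable_line _ _ _ (fun z => f (G x z)) 0 v 0.
rewrite scale0r addr0 in e k.
split; first by apply/k; exact/derivable1_diffP.
rewrite e; transitivity ('d (f \o c) 0 1); first by rewrite -deriveE.
have -> : 'd (f \o c) 0 1 = 'd f (c 0) ('d c 0 1) by rewrite diff_comp.
rewrite C1_diffE// c0 -(deriveE _ dfc).
by rewrite (@derive_val _ _ _ _ _ _ _ dc).
Qed.

Lemma lie_deriveE v (f : V -> R) x : C1 f ->
  lie_derive G v f x = \sum_i left_field G v x ord0 i * 'D_(e_ i) f x.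
Proof. by move=> cf; exact: (@derive_val _ _ _ _ _ _ _ (is_derive_left v x cf)). Qed.

Lemma lie_derive_continuous v (f : V -> R) : C1 f -> continuous (lie_derive G v f).
Proof.
move=> cf; rewrite (_ : lie_derive G v f = fun x => \sum_i left_field G v x ord0 i * 'D_(e_ i) f x).
  apply: (@continuous_sum_fun _ _ _ (fun i x => left_field G v x ord0 i * 'D_(e_ i) f x)) => i x.
  exact: (continuousM (C1_continuous (left_field_C1 v i) (x := x)) ((cf (e_ i)).2 x)).
by apply/funext => x; exact: lie_deriveE.
Qed.

Lemma lie_derive_C1 v (f : V -> R) : C1 f -> (forall u, C1 ('D_u f)) -> C1 (lie_derive G v f).
Proof.
move=> cf cdf; rewrite (_ : lie_derive G v f = fun x => \sum_i left_field G v x ord0 i *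
  'D_(e_ i) f x).
  apply: (@C1_sum _ _ _ (fun i x => left_field G v x ord0 i * 'D_(e_ i) f x)) => i.
  exact: C1_mul (left_field_C1 v i) (cdf _).
by apply/funext => x; exact: lie_deriveE.
Qed.

(** Since s -> s v is a one-parameter subgroup, x ((s + h) v) = (x (s v)) (h v): the derivative at
    any time is the field at the point reached. *)
Lemma is_derive_orbit v (f : V -> R) x (s : R) : C1 f ->
  is_derive s 1 (fun t : R => f (G x (t *: v))) (lie_derive G v f (G x (s *: v))).
Proof.
move=> cf; have := is_derive_left v (G x (s *: v)) cf; rewrite -lie_deriveE//.
have e : (fun h : R => h^-1 *: (((fun t : R => f (G x (t *: v))) \o shift s) (h *: 1) - f
  (G x (s *: v)))) =
  (fun h : R => h^-1 *: (((fun z => f (G (G x (s *: v)) z)) \o shift 0) (h *: v) - f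
    (G (G x (s *: v)) 0))).
  apply/funext => h /=; rewrite cg_op0r addr0 -cg_opA cg_exp.
  by rewrite [h *: 1]mulr1 [h + s]addrC.
by move=> [d1 d2]; split; rewrite /derivable /derive e.
Qed.

End fields.

Section second_difference.
Context (R : realType).
Variables (psi psi1 psi2 : R -> R).
Hypothesis d1 : forall t : R, is_derive t 1 psi (psi1 t).
Hypothesis d2 : forall t : R, is_derive t 1 psi1 (psi2 t).

Let dcont (f f' : R -> R) (i : interval R) : (forall t : R, is_derive t 1 f (f' t)) ->
  {within [set` i], continuous f}.
Proof.
by move=> df; apply: derivable_within_continuous => t _; exact: (@ex_derive _ _ _ _ _ _ _ (df t)).
Qed.

Let dopp (t : R) : is_derive t 1 (fun t => psi (- t)) (- psi1 (- t)).
Proof.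
have := @is_derive1_comp R psi (-%R) t (psi1 (- t)) (-1) (d1 (- t)) _.
by rewrite mulrN1; apply.
Qed.

Let cancel (D y c s : R) : y * (c - - c) * s ^+ 2 - D * (2 * c) = 0 -> 2 * c * D = 2 * c *
  (s ^+ 2 * y).
Proof. by move/eqP; rewrite subr_eq0 => /eqP e; rewrite mulrC -e; ring. Qed.

(** Rolle's theorem for g, which vanishes at 0 and at s, gives c with (psi1 c - psi1 (-c)) s^2 = 2 c
    times the second difference; the mean value theorem for psi1 on [-c, c] then gives xi. *)
Lemma second_difference (s : R) : 0 < s -> exists2 xi, `|xi| <= s &
  psi s + psi (- s) - 2 * psi 0 = s ^+ 2 * psi2 xi.
Proof.
move=> s0; set Dl := psi s + psi (- s) - 2 * psi 0.
pose g t := (psi t + psi (- t) - 2 * psi 0) * s ^+ 2 - Dl * t ^+ 2.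
pose g' t := (psi1 t - psi1 (- t)) * s ^+ 2 - Dl * (2 * t).
have dg (t : R) : is_derive t 1 g (g' t).
  have := is_deriveB (is_deriveZ (s ^+ 2) (is_deriveB (is_deriveD (d1 t) (dopp t))
    (is_derive_cst (2 * psi 0) t 1)))
    (is_deriveZ Dl (is_deriveX 2 (is_derive_id t 1))).
  set G := (X in is_derive _ _ X _); have -> : G = g.
    by apply/funext => z; rewrite /G /g /= !fctE/= [s ^+ 2 *: _]mulrC.
  move=> dG; apply: (is_derive_eq dG); rewrite /g' subr0 expr1.
  by rewrite [s ^+ 2 *: _]mulrC [_ *: (1 : R)]mulr1.
have [c /itvP c0s dgc] : exists2 c, c \in `]0, s[ & is_derive c 1 g 0.
  apply: Rolle => //.
  - exact: dcont.
  - by rewrite /g oppr0 /Dl; ring.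
have gc0 : g' c = 0.
  by rewrite -(@derive_val _ _ _ _ _ _ _ (dg c)) (@derive_val _ _ _ _ _ _ _ dgc).
have c0 : 0 < c by rewrite c0s.
have [|xi + E] := @MVT_segment R psi1 psi2 (- c) c _ (fun t _ => d2 t) (@dcont _ _ _ d2).
  by rewrite ge0_cp// ltW.
rewrite in_itv/= -ler_norml => hxi; exists xi; first by rewrite (le_trans hxi)// ltW// c0s.
apply: (mulfI (_ : 2 * c != 0)); first by rewrite mulf_neq0// gt_eqF.
by move: gc0; rewrite /g' E; exact: cancel.
Qed.

End second_difference.

Section compact_support.
Context (R : realType) (n : nat).
Local Notation V := ('rV[R]_n).
Local Notation leb := (leb R n).

Lemma compact_continuous_bound (T : topologicalType) (K : set T) (g : T -> R) :
  compact K -> continuous g -> exists M, forall x, K x -> `|g x| <= M.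
Proof.
move=> cK cg.
have /compact_bounded[M [_ HM]] : compact (g @` K).
  by apply: continuous_compact => //; exact: continuous_subspaceT.
by exists (M + 1) => x Kx; apply: (HM (M + 1)); [rewrite ltrDl|exists x].
Qed.

Lemma compact_cube (K : set V) : compact K -> exists k, K `<=` @cube R n k.
Proof.
move=> /compact_bounded[M [_ HM]]; exists (Num.bound `|M + 1|) => x Kx i /=.
rewrite in_itv/= -ltr_norml (le_lt_trans (coord_norm_le x i))//.
rewrite (le_lt_trans (HM (M + 1) _ _ Kx)) ?ltrDl//.
exact: le_lt_trans (ler_norm _) (archi_boundP (normr_ge0 _)).
Qed.

Lemma bounded_cube_integrable (f : V -> R) M (k : nat) : measurable_fun setT f ->
  (forall x, `|f x| <= M) -> (forall x, f x != 0 -> @cube R n k x) ->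
  leb.-integrable setT (EFin \o f).
Proof.
move=> mf fM fk.
apply: (@le_integrable _ _ _ leb setT _ _ (fun x => (M * \1_(@cube R n k) x)%:E)) => //.
- exact/measurable_EFinP.
- move=> x _ /=; rewrite lee_fin indicE; have [->|/fk xk] := eqVneq (f x) 0.
    by rewrite normr0.
  by rewrite mem_set// mulr1 (le_trans (fM x))// ler_norm.
- have : leb.-integrable setT (EFin \o (\1_(@cube R n k) : V -> R)).
    have mk := @measurable_cube R n k.
    apply/integrableP; split; first exact/measurable_EFinP/measurable_indic.
    rewrite (eq_integral (fun x => (\1_(@cube R n k) x)%:E)); last first.
      by move=> x _; rewrite /= ger0_norm.
    by rewrite integral_indic// setIT cube_lty.
  by move=> h; exact: (integrableZl measurableT M h).
Qed.

Lemma bounded_cube_L2 (f : V -> R) M (k : nat) : measurable_fun setT f ->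
  (forall x, `|f x| <= M) -> (forall x, f x != 0 -> @cube R n k x) -> L2 leb f.
Proof.
move=> mf fM fk; apply/L2P; split => //.
have M0 : 0 <= M by apply: le_trans (fM 0).
have /integrableP[_] : leb.-integrable setT (EFin \o (fun x => f x ^+ 2)).
  apply: (@bounded_cube_integrable _ (M ^+ 2) k).
  - exact: measurable_funX.
  - by move=> x; rewrite normrX lerXn2r ?nnegrE.
  - by move=> x; rewrite expf_eq0/= => /fk.
apply: le_lt_trans; rewrite le_eqVlt; apply/orP; left; apply/eqP.
by apply: eq_integral => x _; rewrite /= ger0_norm ?sqr_ge0.
Qed.

End compact_support.

(** * Right translations and dissipativity *)

Section translate.
Context (R : realType) (n : nat) (G : carnot_group R n).
Local Notation V := ('rV[R]_n).
Local Notation leb := (leb R n).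
Local Notation dot := (dotL2 leb).

Definition translate (a : V) (f : V -> R) : V -> R := fun x => f (G x a).

Lemma measurable_translate a f : measurable_fun setT f -> measurable_fun setT (translate a f).
Proof.
move=> mf; apply: (measurableT_comp mf).
by apply: continuous_measurable_map; exact: cg_continuousl.
Qed.

Lemma translate_L2 a f : L2 leb f -> L2 leb (translate a f).
Proof.
move=> /L2P[mf f2]; apply/L2P; split; first exact: measurable_translate.
rewrite (cg_integral_right G a (f := fun x => (f x ^+ 2)%:E))//.
by apply/measurable_EFinP; exact: measurable_funX.
Qed.

Lemma translate_dot a f g : L2 leb f -> L2 leb g ->
  dot (translate a f) (translate a g) = dot f g.
Proof.
move=> /L2_measurable mf /L2_measurable mg; rewrite /dotL2 /Rintegral; congr fine.
apply: (cg_integral_right G a (f := fun x => (f x * g x)%:E)).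
by apply/measurable_EFinP; exact: measurable_funM.
Qed.

Lemma translateV a f : translate a (translate (- a) f) = f.
Proof. by apply/funext => x; rewrite /translate -cg_opA cg_opV cg_op0r. Qed.

(** Discrete integration by parts: by right invariance the pairing equals - <f - f(. a), g - g(.
    a)>, whose integrand has a sign as soon as f and g increase together. *)
Lemma second_difference_dot a f g : L2 leb f -> L2 leb g ->
  (forall x y, 0 <= (f x - f y) * (g x - g y)) ->
  dot (fun x => f (G x a) + f (G x (- a)) - 2 * f x) g <= 0.
Proof.
move=> hf hg fg0.
have hfa := translate_L2 a hf; have hfb := translate_L2 (- a) hf.
have hga := translate_L2 a hg.
have E : dot (translate (- a) f) g = dot f (translate a g).
  by rewrite -(translate_dot a hfb hg) translateV.
have -> : (fun x => f (G x a) + f (G x (- a)) - 2 * f x) =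
    (fun x => - 2 * f x + (translate a f \+ translate (- a) f) x).
  by apply/funext => x; rewrite /translate/=; ring.
rewrite dotL2_lin//.
rewrite dotL2D// E.
have : 0 <= dot (f \- translate a f) (g \- translate a g).
  by apply: Rintegral_ge0 => x _; exact: fg0.
have hgg := L2B hg hga.
rewrite dotL2B// ![dot _ (g \- _)]dotL2C !dotL2B// translate_dot//.
rewrite [dot g f]dotL2C [dot _ f]dotL2C [dot g (translate a f)]dotL2C.
lra.
Qed.

End translate.

Section dissipative.
Context (R : realType) (n : nat) (G : carnot_group R n).
Local Notation V := ('rV[R]_n).
Local Notation leb := (leb R n).
Local Notation dot := (dotL2 leb).

(** The sign is kept: the function is nonpositive and depends on f in a nondecreasing, 1-Lipschitz
    way. *)
Definition neg_part (f : V -> R) : V -> R := fun x => Num.min (f x) 0.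

Lemma neg_part_lip f g x : `|neg_part f x - neg_part g x| <= `|f x - g x|.
Proof.
rewrite /neg_part; case: (leP (f x) 0) => hx; case: (leP (g x) 0) => hy //.
- rewrite subr0 (ler0_norm hx) (ler0_norm (_ : f x - g x <= 0)); lra.
- rewrite sub0r normrN (ler0_norm hy) (ger0_norm (_ : 0 <= f x - g x)); lra.
- by rewrite subrr normr0.
Qed.

Lemma neg_part_mono f x y : 0 <= (f x - f y) * (neg_part f x - neg_part f y).
Proof.
rewrite /neg_part; case: (leP (f x) 0) => hx; case: (leP (f y) 0) => hy.
- by rewrite -expr2 sqr_ge0.
- by rewrite mulr_le0//; lra.
- by rewrite mulr_ge0//; lra.
- by rewrite subrr mulr0.
Qed.

Lemma neg_part_norm f x : `|neg_part f x| <= `|f x|.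
Proof. by rewrite /neg_part; case: (leP (f x) 0) => //; rewrite normr0. Qed.

Lemma measurable_neg_part f : measurable_fun setT f -> measurable_fun setT (neg_part f).
Proof. by move=> mf; exact: measurable_minr. Qed.

Let F (v : V) (f : V -> R) (i : nat) (x : V) : R :=
  i.+1%:R ^+ 2 * (f (G x (i.+1%:R^-1 *: v)) + f (G x (- (i.+1%:R^-1 *: v))) - 2 * f x).

(** The second derivative along v is the pointwise limit of second difference quotients with step 1
    / (i + 1), each with a nonpositive pairing. Integrability is part of the conclusion so that the
    sum over the fields can be split. *)
Lemma lie2_dot v (f : V -> R) : test_function f ->
  let g x := lie_derive G v (lie_derive G v f) x * neg_part f x in
  leb.-integrable setT (EFin \o g) /\ \int[leb]_x g x <= 0.
Proof.
move=> [sf cK] g; set K := closure _ in cK.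
have cf := smooth_C1 sf; have cXf := lie_derive_C1 G v cf (fun u => smooth_C1_derive u sf).
have fcont := C1_continuous cf.
set XX := lie_derive G v (lie_derive G v f) in g *.
have cXX : continuous XX by exact: lie_derive_continuous.
have fK x : f x != 0 -> K x by move=> fx; exact: subset_closure.
have [Mf fM] := compact_continuous_bound cK fcont.
have fM' x : `|f x| <= `|Mf|.
  have [->|/fK/fM/le_trans] := eqVneq (f x) 0; first by rewrite normr0.
  by apply; exact: ler_norm.
have [k Kk] := compact_cube cK.
have mf := continuous_measurable_rV fcont.
have hf : L2 leb f by apply: (@bounded_cube_L2 _ _ f `|Mf| k) => // x /fK/Kk.
have mb := measurable_neg_part mf.
have hb : L2 leb (neg_part f) by apply: (L2_le (v := f)) => //; exact: neg_part_norm.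
(* The intermediate points of the quotients may leave K, but they stay in the image of the compact
   set K x [-1, 1] under (x, xi) -> x (xi v). The factor [neg_part f] restricts x to K, so this
   bound dominates all quotients. *)
have [M XXM] : exists M, forall x xi, K x -> `|xi| <= 1 -> `|XX (G x (xi *: v))| <= M.
  have cKI : compact (K `*` (`[-1, 1]%classic : set R)).
    by apply: compact_setX => //; exact: segment_compact.
  have cm : continuous (fun p : V * R => XX (G p.1 (p.2 *: v))).
    move=> p; apply: (@continuous_comp _ _ _ (fun p : V * R => G p.1 (p.2 *: v)) XX);
      last exact: cXX.
    apply: (@cg_continuous_comp _ _ _ _ fst (fun p : V * R => p.2 *: v)) => q; first exact: cvg_fst.
    by apply: cvgZr_tmp; exact: cvg_snd.
  have [M HM] := compact_continuous_bound cKI cm.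
  exists M => x xi Kx hxi; apply: (HM (x, xi)); split => //=.
  by rewrite in_itv/= -ler_norml.
have FE i x : exists2 xi, `|xi| <= i.+1%:R^-1 & F v f i x = XX (G x (xi *: v)).
  have s0 : 0 < i.+1%:R^-1 :> R by rewrite invr_gt0.
  have [xi hxi E] := @second_difference R _ _ _ (fun t => is_derive_orbit G v x t cf)
    (fun t => is_derive_orbit G v x t cXf) _ s0.
  exists xi => //; move: E; rewrite scale0r cg_op0r scaleNr /F => ->.
  by rewrite mulrA exprVn mulfV ?mul1r// expf_neq0// pnatr_eq0.
have ib : leb.-integrable setT (fun x => (M * `|neg_part f x|)%:E).
  have : leb.-integrable setT (EFin \o neg_part f).
    apply: (@bounded_cube_integrable _ _ _ `|Mf| k) => //.
      by move=> x; exact: le_trans (neg_part_norm f x) (fM' x).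
    move=> x hx; apply/Kk/fK; apply: contra hx => /eqP fx0.
    by rewrite /neg_part fx0 minxx.
  by move=> /integrable_abse h; exact: (integrableZl measurableT M h).
have cvgF x : F v f i x * neg_part f x @[i --> \oo] --> g x.
  apply: cvgM; last exact: cvg_cst.
  apply/cvgrPdist_le => e e0.
  have cx : continuous (fun xi : R => XX (G x (xi *: v))).
    move=> p; apply: (@continuous_comp _ _ _ (fun p : R => G x (p *: v)) XX); last exact: cXX.
    apply: (@cg_continuous_comp _ _ _ _ (fun=> x) (fun p : R => p *: v));
      first exact: cst_continuous.
    by move=> q; apply: cvgZr_tmp; exact: cvg_id.
  have /cvgrPdist_le/(_ _ e0)/nbhs_ballP[r /= r0 hr] := cx 0.
  near=> i; have [xi hxi ->] := FE i x.
  have := hr xi; rewrite scale0r cg_op0r; apply.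
  rewrite -ball_normE/= sub0r normrN (le_lt_trans hxi)//.
  near: i; exact: (@near_infty_natSinv_lt R (PosNum r0)).
have bF i x : `|F v f i x * neg_part f x| <= M * `|neg_part f x|.
  rewrite normrM; have [E|fx0] := eqVneq (f x) 0.
    by rewrite /neg_part E minxx normr0 !mulr0.
  have [xi hxi ->] := FE i x; rewrite ler_wpM2r// XXM//; first exact: fK.
  by rewrite (le_trans hxi)// invf_le1// ler1n.
have mF i : measurable_fun setT (fun x => (F v f i x * neg_part f x)%:E).
  apply/measurable_EFinP; apply: measurable_funM => //; apply: measurable_funM => //.
  apply: measurable_funB; last exact: measurable_funM.
  by apply: measurable_funD; exact: (measurable_translate G).
have cE x : [set: V] x -> (F v f i x * neg_part f x)%:E @[i --> \oo] --> (g x)%:E.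
  by move=> _; apply: cvg_EFin; [exact: nearW|exact: cvgF].
have mg : measurable_fun setT g.
  by apply: measurable_funM => //; exact: continuous_measurable_rV.
split.
  apply: (@le_integrable _ _ _ leb setT _ _ (fun x => (M * `|neg_part f x|)%:E)) => //.
    exact/measurable_EFinP.
  move=> x _; rewrite lee_fin normrM [leRHS]normrM normr_id.
  have [E|fx0] := eqVneq (f x) 0; first by rewrite /neg_part E minxx normr0 !mulr0.
  rewrite ler_wpM2r// (le_trans _ (ler_norm _))//.
  by have := XXM x 0 (fK _ fx0); rewrite normr0 scale0r cg_op0r; apply.
have bfin (x : V) : [set: V] x -> (M * `|neg_part f x|)%:E \is a fin_num by [].
have dc := @dominated_cvg _ _ _ leb setT measurableT _ _ _ mF cE bfin ib (fun i x _ => bF i x).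
suff : (\int[leb]_x (g x)%:E <= 0)%E.
  by rewrite /Rintegral; case: integral => //= r; rewrite lee_fin.
rewrite -(cvg_lim _ dc)//; apply: lime_le; first by apply/cvg_ex; exists (\int[leb]_x (g x)%:E)%E.
near=> i.
have := second_difference_dot G (i.+1%:R^-1 *: v) hf hb (neg_part_mono f).
pose q x : R := f (G x (i.+1%:R^-1 *: v)) + f (G x (- (i.+1%:R^-1 *: v))) - 2 * f x.
have hq : L2 leb q.
  have h1 := translate_L2 G (i.+1%:R^-1 *: v) hf.
  have h2 := translate_L2 G (- (i.+1%:R^-1 *: v)) hf.
  exact: (L2B (L2D h1 h2) (L2Z 2 hf)).
rewrite -[(fun x => _)]/q => q0.
have -> : (\int[leb]_x (F v f i x * neg_part f x)%:E =
  (dot (fun x => i.+1%:R ^+ 2 * q x) (neg_part f))%:E)%E.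
  by rewrite dotL2E//; exact: L2Z.
by rewrite dotL2Z// lee_fin mulr_ge0_le0// exprn_ge0.
Unshelve. all: by end_near. Qed.

Lemma sublap_neg_part (m : nat) (X : m.-tuple V) (f : V -> R) : test_function f ->
  0 <= dot (sublap G X f) (neg_part f).
Proof.
move=> tf; pose S (s : seq V) x := \sum_(v <- s) lie_derive G v (lie_derive G v f) x.
have H s : leb.-integrable setT (EFin \o (fun x => S s x * neg_part f x)) /\
    \int[leb]_x (S s x * neg_part f x) <= 0.
  elim: s => [|v s [iS IS]].
    have E : (fun x => S [::] x * neg_part f x) = cst 0.
      by apply/funext => x; rewrite /S big_nil mul0r.
    rewrite E; split; first exact: integrable0.
    by rewrite /Rintegral integral0.
  have [iv Iv] := lie2_dot v tf.
  have E : (fun x => S (v :: s) x * neg_part f x) =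
      (fun x => lie_derive G v (lie_derive G v f) x * neg_part f x + S s x * neg_part f x).
    by apply/funext => x; rewrite /S big_cons mulrDl.
  rewrite E; split.
    exact: (integrableD measurableT iv iS).
  by rewrite RintegralD// -[leRHS]addr0 lerD.
have [iX IX] := H X.
have E : (fun x => sublap G X f x * neg_part f x) = (fun x => -1 * (S X x * neg_part f x)).
  by apply/funext => x; rewrite mulN1r -mulNr /sublap /S big_tuple.
by rewrite /dotL2 E RintegralZl// mulN1r oppr_ge0.
Qed.

End dissipative.

(** * Positivity of the heat kernel *)

Section resolvent.
Context (R : realType) (n m : nat) (G : carnot_group R n) (X : m.-tuple 'rV[R]_n).
Local Notation V := ('rV[R]_n).
Local Notation leb := (leb R n).
Local Notation dot := (dotL2 leb).

Lemma test_function_L2 (f : V -> R) : test_function f -> L2 leb f.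
Proof.
move=> [sf cK]; have fc := C1_continuous (smooth_C1 sf).
have [M fM] := compact_continuous_bound cK fc; have [k Kk] := compact_cube cK.
apply: (@bounded_cube_L2 _ _ f `|M| k).
- exact: continuous_measurable_rV.
- move=> x; have [->|fx] := eqVneq (f x) 0; first by rewrite normr0.
  by rewrite (le_trans (fM x _)) ?ler_norm//; exact: subset_closure.
- by move=> x fx; apply: Kk; exact: subset_closure.
Qed.

Lemma sublap_measurable (f : V -> R) : test_function f -> measurable_fun setT (sublap G X f).
Proof.
move=> [sf _]; have cf := smooth_C1 sf.
apply: continuous_measurable_rV; rewrite /sublap => x.
apply: (@continuousN _ _ _ (fun x => \sum_j lie_derive G (tnth X j) (lie_derive G (tnth X j) f) x)).
apply: continuous_sum_fun => j; apply: lie_derive_continuous.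
exact: lie_derive_C1 cf (fun u => smooth_C1_derive u sf).
Qed.

Lemma dot_le (u v : V -> R) : L2 leb u -> L2 leb v -> (forall x, `|u x| <= `|v x|) ->
  dot u u <= dot v v.
Proof.
move=> hu hv uv; apply: le_Rintegral => //; do ?exact: L2_integrableM.
by move=> x _; rewrite -!expr2 -(real_normK (num_real (u x))) -(real_normK (num_real (v x)))
  lerXn2r ?nnegrE.
Qed.

(** The inequality for test functions survives closure of the graph because the negative part is a
    contraction of L2, so both factors of the pairing converge strongly. *)
Lemma sublap_graph_neg_part w z : sublap_graph G X w z -> 0 <= dot z (neg_part w).
Proof.
move=> [hw hz [f [tf fw fz]]].
have hf k := test_function_L2 (tf k).
have hfw k := L2B (hf k) hw.
(* Convergence to 0 in the extended reals makes the norms finite only from some index on; shifting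
   by N puts every term in L2. *)
have [N _ HN] : \forall k \near \oo, (normL2 leb (sublap G X (f k) \- z)%R < +oo)%E.
  by have := fz; move/fine_cvgP => [+ _]; apply: filterS => k; rewrite fin_numElt => /andP[].
have hs k : L2 leb (sublap G X (f (k + N)%N) \- z).
  apply: normL2_lty_L2; last by apply: HN; rewrite /= leq_addl.
  by apply: measurable_funB; [exact: sublap_measurable|exact: L2_measurable hz].
have hs' k : L2 leb (sublap G X (f (k + N)%N)).
  have := L2D (hs k) hz; congr (L2 _ _); apply/funext => x /=; exact: subrK.
have hn k := L2_le (measurable_neg_part (L2_measurable (hf k))) (neg_part_norm (f k)) (hf k).
have hnw := L2_le (measurable_neg_part (L2_measurable hw)) (neg_part_norm w) hw.
have c1 : dot (sublap G X (f (k + N)%N) \- z) (sublap G X (f (k + N)%N) \- z) @[k --> \oo] -->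
  (0 : R).
  apply: (normL2_cvg0 _ hs).1.
  by rewrite (cvg_shiftn N (fun k => normL2 leb (sublap G X (f k) \- z)%R)).
have c2 : dot (neg_part (f (k + N)%N) \- neg_part w) (neg_part (f (k + N)%N) \- neg_part w)
  @[k --> \oo] --> (0 : R).
  have c3 : dot (f (k + N)%N \- w) (f (k + N)%N \- w) @[k --> \oo] --> (0 : R).
    apply: (normL2_cvg0 _ (fun k => hfw (k + N)%N)).1.
    by rewrite (cvg_shiftn N (fun k => normL2 leb (f k \- w)%R)).
  apply: (@squeeze_cvgr _ _ _ _ (fun=> 0) _ _ _ _ (cvg_cst _) c3).
  near=> k; rewrite dotL2_sqr_ge0/= dot_le//.
  by move=> x; exact: neg_part_lip.
have c : dot (sublap G X (f (k + N)%N)) (neg_part (f (k + N)%N)) @[k --> \oo] --> dot z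
  (neg_part w).
  by apply: dotL2_cvg => // k; exact: hn.
rewrite -(cvg_lim _ c)//; apply: limr_ge; first by apply/cvg_ex; exists (dot z (neg_part w)).
by near=> k; exact: sublap_neg_part.
Unshelve. all: by end_near. Qed.

(** With w' = min (w, 0), pairing L w = (g - w) / e with w' gives 0 <= <g, w'> - |w'|^2, while <g,
    w'> <= 0; hence w' = 0. *)
Lemma resolvent_ge0 e (g w : V -> R) : 0 < e -> L2 leb g -> L2 leb w ->
  {ae leb, forall x, 0 <= g x} ->
  sublap_graph G X w (fun x => e^-1 * (g x - w x)) ->
  {ae leb, forall x, 0 <= w x}.
Proof.
move=> e0 hg hw g0 /sublap_graph_neg_part.
have hnw := L2_le (measurable_neg_part (L2_measurable hw)) (neg_part_norm w) hw.
rewrite (dotL2Z e^-1 (L2B hg hw) hnw) pmulr_rge0 ?invr_gt0// dotL2B//.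
have -> : dot w (neg_part w) = dot (neg_part w) (neg_part w).
  apply: eq_Rintegral => x _; rewrite /neg_part.
  by case: (leP (w x) 0) => //; rewrite !mulr0.
have gn : dot g (neg_part w) <= 0.
  rewrite dotL2C -oppr_ge0 -mulN1r -dotL2Z// dotL2C; apply: dotL2_ae_ge0 => //.
  - exact: L2_measurable hg.
  - by apply: (L2_measurable (mu := leb)); exact: L2Z.
  - by move=> x; rewrite mulN1r oppr_ge0 /neg_part ge_min lexx orbT.
move=> h; have : dot (neg_part w) (neg_part w) = 0.
  by apply/eqP; rewrite eq_le dotL2_sqr_ge0 andbT; lra.
move=> /(dotL2_eq0 hnw); apply: filterS => x /(_ I)/=.
by rewrite /neg_part; case: (leP (w x) 0) => [wx -> //|/ltW].
Qed.

End resolvent.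

Section open_box.
Context (R : realType) (n : nat).
Local Notation V := ('rV[R]_n).

Definition obox (x : V) (r : R) : set V := box (fun i => `]x ord0 i - r, x ord0 i + r[%classic).

Lemma measurable_obox x r : measurable (obox x r).
Proof. by apply: measurable_box => i; exact: measurable_itv. Qed.

Lemma leb_obox x r : 0 < r -> leb R n (obox x r) = ((2 * r) ^+ n)%:E.
Proof.
move=> r0; rewrite leb_box; last by move=> i; exact: measurable_itv.
rewrite (eq_bigr (fun=> (2 * r)%:E)); last first.
  move=> i _; rewrite lebesgue_measure_itv/= lte_fin ltrD2l gtrN// -EFinD; congr EFin.
  by ring.
by rewrite prodEFin prodr_const card_ord.
Qed.

Lemma obox_ball x r y : 0 < r -> obox x (r / 2) y -> ball x r y.
Proof.
move=> r0 yB; rewrite -ball_normE/= (@le_lt_trans _ _ (r / 2))//; last by lra.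
apply: rV_norm_le => [|i]; first by rewrite divr_ge0// ltW.
have := yB i; rewrite /= in_itv/= !mxE distrC => /andP[h1 h2].
by rewrite ler_norml; lra.
Qed.

End open_box.

(** * Pointwise sign of the heat kernel *)

Section heat_kernel_positivity.
Context (R : realType) (n m : nat) (G : carnot_group R n) (X : m.-tuple 'rV[R]_n).
Context (E : spectral_family (leb R n)).
Local Notation V := ('rV[R]_n).
Local Notation leb := (leb R n).

(** A choice among spectral integrals is one of them as soon as one exists. *)
Lemma semigroup_integral t u : 0 < t -> L2 leb u ->
  spectral_integral E (fun l => expR (- t * l)) u (spectral_apply E (fun l => expR (- t * l)) u).
Proof.
move=> t0 hu; apply: xgetPex; have [v hv vE] := semigroup_exists E t0 hu.
by exists v => /=; apply/(spectral_integralP _ _ _ (bounded_ge0_semigroup (ltW t0))).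
Qed.

Hypothesis hE : spectral_resolution_of E (sublap_graph G X).

Lemma sublap_resolvent_positive : resolvent_positive E.
Proof.
move=> e g w e0 hg hw g0 hs; apply: (@resolvent_ge0 _ _ _ G X e g w) => //.
exact/hE.
Qed.

Variable h : R -> V -> R.
Hypothesis hh : heat_kernel G X E h.

Lemma heat_continuous t x : 0 < t -> {for (t, x), continuous (fun p : R^o * V => h p.1 p.2)}.
Proof. by move=> t0; have [/(_ [::] (t, x) t0)[+ _] _ _] := hh. Qed.

Lemma heat_continuous_slice t : 0 < t -> continuous (h t).
Proof.
move=> t0 x; apply: (@continuous_comp V (R^o * V)%type R (fun x : V => (t : R^o, x))
  (fun p => h p.1 p.2)).
  apply: (@cvg_to_pair V (nbhs x) _ R^o V (fun=> t) id t x); last exact: cvg_id.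
  exact: (@cst_continuous V R^o t x).
exact: heat_continuous.
Qed.

(** If h t x < 0, continuity of (y, z) -> h t (y^-1 z) at (0, x) keeps it below a negative constant
    on a product of boxes. Convolving the indicator of the box at 0 then gives negative values on a
    box of positive measure around x, whereas the semigroup applied to that indicator is nonnegative
    almost everywhere. *)
Lemma heat_kernel_ge0 t x : 0 < t -> 0 <= h t x.
Proof.
move=> t0; rewrite leNgt; apply/negP => hx.
pose c := - (h t x / 2); have c0 : 0 < c by rewrite /c; lra.
have cc : continuous (fun p : V * V => h t (G (- p.1) p.2)).
  move=> p; apply: (@continuous_comp _ _ _ (fun p : V * V => G (- p.1) p.2) (h t)).
    apply: (@cg_continuous_comp _ _ G _ (fun p : V * V => - p.1) snd) => q; last exact: cvg_snd.
    by apply: cvgN; exact: cvg_fst.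
  exact: heat_continuous_slice.
have /cvgrPdist_lt/(_ _ c0)/nbhs_ballP[r /= r0 hr] := cc (0, x).
have hB y z : obox 0 (r / 2) y -> obox x (r / 2) z -> c <= - h t (G (- y) z).
  move=> yB zB; have /= := hr (y, z) (conj (obox_ball r0 yB) (obox_ball r0 zB)).
  by rewrite oppr0 cg_op0l /c ltr_norml => /andP[h1 h2]; lra.
have r2 : 0 < r / 2 by rewrite divr_gt0.
pose B := obox (0 : V) (r / 2); have mB : measurable B by exact: measurable_obox.
pose u : V -> R := \1_B.
have hu : L2 leb u.
  apply/L2P; split; first exact: measurable_indic.
  rewrite (eq_integral (fun x => (\1_B x)%:E)); last first.
    by move=> z _; rewrite /u indicE; case: (_ \in _); rewrite ?expr1n ?expr0n.
  by rewrite integral_indic// setIT leb_obox// ltry.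
have neg z : obox x (r / 2) z -> (convolution G (EFin \o u) (EFin \o h t) z < 0)%E.
  move=> zB.
  have mh : measurable_fun setT (fun y => u y * - h t (G (- y) z)).
    apply: measurable_funM; first exact: measurable_indic.
    apply: measurableT_comp => //; apply: continuous_measurable_rV => y.
    apply: (@continuous_comp _ _ _ (fun y => (y, z)) (fun p : V * V => h t (G (- p.1) p.2)));
      last exact: cc.
    apply: (@cvg_to_pair V (nbhs y) _ V V id (fun=> z) y z); first exact: cvg_id.
    exact: (@cst_continuous V V z y).
  have pos y : 0 <= u y * - h t (G (- y) z).
    rewrite /u indicE; case: (boolP (y \in B)) => [/set_mem yB|_]; last by rewrite mul0r.
    by rewrite mul1r (le_trans (ltW c0))// hB.
  have -> : convolution G (EFin \o u) (EFin \o h t) z =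
      (- \int[leb]_y (u y * - h t (G (- y) z))%:E)%E.
    rewrite -integral_ge0N; last by move=> y _; rewrite lee_fin.
    by apply: eq_integral => y _; rewrite /= mulrN opprK.
  rewrite oppe_lt0; apply: (@lt_le_trans _ _ (\int[leb]_y (c * \1_B y)%:E)%E).
    under eq_integral do rewrite EFinM.
    rewrite ge0_integralZl//.
    - rewrite integral_indic// setIT leb_obox// mule_gt0 ?lte_fin// exprn_gt0//.
      by rewrite mulr_gt0.
    - exact/measurable_EFinP/measurable_indic.
    - by rewrite lee_fin ltW.
  apply: ge0_le_integral => //.
  - by move=> y _; rewrite lee_fin mulr_ge0// ltW.
  - by apply/measurable_EFinP; apply: measurable_funM => //; exact: measurable_indic.
  - exact/measurable_EFinP.
  - move=> y _; rewrite lee_fin /u indicE; case: (boolP (y \in B)) => [/set_mem yB|_].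
      by rewrite mulr1 mul1r hB.
    by rewrite mulr0 mul0r.
have [_ _ /(_ t u t0 hu) eqc] := hh.
have ge0 : {ae leb, forall x, 0 <= u x} by apply: aeW => z; rewrite /u indicE ler0n.
have sg := semigroup_ge0 sublap_resolvent_positive t0 hu ge0 (semigroup_integral t0 hu).
have : leb.-negligible (obox x (r / 2)).
  have : {ae leb, forall z, (0 <= convolution G (EFin \o u) (EFin \o h t) z)%E}.
    by apply: filterS2 eqc sg => z /(_ I) /= <-; rewrite lee_fin.
  apply: negligibleS => z zB /=; apply/negP; rewrite -ltNge; exact: neg.
move=> ng; have : leb (obox x (r / 2)) = 0%E by apply/negligibleP => //; exact: measurable_obox.
rewrite leb_obox// => -[] /eqP.
by rewrite expf_eq0 mulf_eq0 pnatr_eq0/= gt_eqF ?andbF.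
Qed.

End heat_kernel_positivity.

(** * Subordination *)

Section L2_of_pairing_bound.
Context (R : realType) (n : nat).
Local Notation V := ('rV[R]_n).
Local Notation leb := (leb R n).
Local Notation dot := (dotL2 leb).
Local Open Scope ereal_scope.

Lemma cube_mono k k' : (k <= k')%N -> @cube R n k `<=` @cube R n k'.
Proof.
move=> kk x xk i; have := xk i; rewrite /= !in_itv/= -!ltr_norml => /lt_le_trans; apply.
by rewrite ler_nat.
Qed.

Variables (conv : V -> \bar R) (M : R).
Hypotheses (measurable_conv : measurable_fun setT conv) (conv_ge0 : forall x, 0 <= conv x)
  (conv_bound : forall w, L2 leb w -> (forall x, (0 <= w x)%R) ->
    \int[leb]_x (conv x * (w x)%:E) <= ((M + dot w w) / 2)%:E).

Let half_le (d : R) : (d <= (M + d) / 2 -> d <= M)%R.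
Proof. by move=> h; lra. Qed.

Let trunc_conv (N : nat) (x : V) : R :=
  (fine (mine (conv x) N%:R%:E) * \1_(@cube R n N) x)%R.

Let trunc_convE N x : ((fine (mine (conv x) N%:R%:E))%:E = mine (conv x) N%:R%:E)%E.
Proof.
have m0 : 0 <= mine (conv x) N%:R%:E by rewrite le_min conv_ge0 lee_fin ler0n.
rewrite fineK// ge0_fin_numE//.
by rewrite gt_min ltry orbT.
Qed.

Let trunc_conv_ge0 N x : (0 <= trunc_conv N x)%R.
Proof.
by rewrite mulr_ge0// fine_ge0// le_min conv_ge0 lee_fin ler0n.
Qed.

Let trunc_conv_le N x : (trunc_conv N x)%:E <= conv x.
Proof.
rewrite /trunc_conv indicE; case: (_ \in _); rewrite ?mulr0// mulr1 trunc_convE.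
by rewrite ge_min lexx.
Qed.

Let trunc_conv_leN N x : (trunc_conv N x <= N%:R)%R.
Proof.
rewrite /trunc_conv indicE; case: (_ \in _); rewrite ?mulr0// mulr1.
by rewrite -lee_fin trunc_convE ge_min lexx orbT.
Qed.

Let trunc_conv_mono x N N' : (N <= N')%N -> (trunc_conv N x <= trunc_conv N' x)%R.
Proof.
move=> NN'; have c := @cube_mono _ _ NN' x.
rewrite /trunc_conv !indicE; case: (boolP (x \in cube N)) => [/set_mem/c xN'|_].
  rewrite mem_set// !mulr1 -lee_fin !trunc_convE le_min !ge_min lexx/=.
  by rewrite lee_fin ler_nat NN' orbT.
by rewrite mulr0; exact: trunc_conv_ge0.
Qed.

Let measurable_trunc_conv N : measurable_fun setT (trunc_conv N).
Proof.
apply: measurable_funM; last by apply: measurable_indic; exact: measurable_cube.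
by apply: measurableT_comp => //; exact: measurable_mine.
Qed.

Let trunc_conv_L2 N : L2 leb (trunc_conv N).
Proof.
apply: (@bounded_cube_L2 _ _ _ N%:R N) => //.
  by move=> x; rewrite ger0_norm.
move=> x; rewrite /trunc_conv indicE; case: (boolP (x \in cube N)) => [/set_mem//|_].
by rewrite mulr0 eqxx.
Qed.

(** The truncation is paired with itself: its squared norm d satisfies d <= (M + d) / 2, and d
    cancels because the truncation, bounded with bounded support, has finite d. *)
Let trunc_conv_dot N : (dot (trunc_conv N) (trunc_conv N) <= M)%R.
Proof.
have h := conv_bound (trunc_conv_L2 N) (trunc_conv_ge0 N).
have : (dot (trunc_conv N) (trunc_conv N))%:E <= ((M + dot (trunc_conv N) (trunc_conv N)) / 2)%:E.
  apply: le_trans h; rewrite dotL2E//; apply: ge0_le_integral => //.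
  - by move=> x _; rewrite lee_fin mulr_ge0.
  - by apply: (measurable_EFinP _ _).2; exact: measurable_funM.
  - by apply: emeasurable_funM => //; exact: (measurable_EFinP _ _).2.
  - by move=> x _; rewrite EFinM lee_pmul// ?lee_fin.
by rewrite lee_fin; exact: half_le.
Qed.

Let trunc_sqr N x := ((trunc_conv N x) ^+ 2)%:E.
Let trunc_sup x := limn (fun N => trunc_sqr N x).

Let trunc_sqr_nd x : nondecreasing_seq (fun N => trunc_sqr N x).
Proof.
by move=> N N' NN'; rewrite lee_fin lerXn2r ?nnegrE//; exact: trunc_conv_mono.
Qed.

Let trunc_sqr_sup N x : trunc_sqr N x <= trunc_sup x.
Proof.
have c := ereal_nondecreasing_cvgn (@trunc_sqr_nd x).
by rewrite /trunc_sup (cvg_lim _ c)//; apply: ereal_sup_ubound; exists N.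
Qed.

Let integral_trunc_sup : \int[leb]_x trunc_sup x <= M%:E.
Proof.
have ms N : measurable_fun setT (trunc_sqr N).
  by apply: (measurable_EFinP _ _).2; exact: measurable_funX.
have s0 N x : [set: V] x -> 0 <= trunc_sqr N x by move=> _; rewrite lee_fin sqr_ge0.
have nd x : [set: V] x -> nondecreasing_seq (fun N => trunc_sqr N x) by move=> _;
  exact: trunc_sqr_nd.
have c := @cvg_monotone_convergence _ _ _ leb setT measurableT _ ms s0 nd.
rewrite -(cvg_lim _ c)//; apply: lime_le; first by apply/cvg_ex; eexists; exact: c.
near=> N; rewrite (_ : \int[leb]_x _ = (dot (trunc_conv N) (trunc_conv N))%:E).
  by rewrite lee_fin.
by rewrite dotL2E//; apply: eq_integral => x _; rewrite /trunc_sqr expr2.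
Unshelve. all: by end_near. Qed.

Let fine_conv_sup x : ((fine (conv x)) ^+ 2)%:E <= trunc_sup x.
Proof.
have [N0 _ N0x] : (\bigcup_k @cube R n k) x by rewrite cube_bigcup.
have s0 : 0 <= trunc_sup x by apply: le_trans (trunc_sqr_sup 0 x); rewrite lee_fin sqr_ge0.
case E1 : (conv x) => [r| |]; rewrite ?expr0n//=.
pose N := maxn N0 (Num.bound r).
have r0 : (0 <= r)%R by rewrite -lee_fin -E1.
apply: le_trans (trunc_sqr_sup N x); rewrite /trunc_sqr /trunc_conv E1.
rewrite indicE mem_set/=; last by apply: (cube_mono (leq_maxl N0 _)).
rewrite mulr1 (min_idPl _)// lee_fin (le_trans (ltW (archi_boundP r0)))//.
by rewrite ler_nat leq_maxr.
Qed.

Let conv_infty x : conv x = +oo -> trunc_sup x = +oo.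
Proof.
move=> E1; have [N0 _ N0x] : (\bigcup_k @cube R n k) x by rewrite cube_bigcup.
have s0 : 0 <= trunc_sup x by apply: le_trans (trunc_sqr_sup 0 x); rewrite lee_fin sqr_ge0.
case E2 : (trunc_sup x) => [r| |] //; last by rewrite E2 in s0.
have r0 : (0 <= r)%R by rewrite -lee_fin -E2.
pose N := maxn N0 (Num.bound r).+1.
have := trunc_sqr_sup N x; rewrite E2 /trunc_sqr /trunc_conv E1 indicE mem_set/=; last first.
  by apply: (cube_mono (leq_maxl N0 _)).
rewrite mulr1 lee_fin leNgt => /negP[].
have rN : (r < N%:R)%R.
  by rewrite (lt_le_trans (archi_boundP r0))// ler_nat ltnW// leq_maxr.
rewrite (lt_le_trans rN)// expr2 ler_peMr//.
by rewrite ler1n leq_max orbT.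
Qed.

(** A converse of the Cauchy-Schwarz inequality. The squared truncations increase to a function of
    integral at most M; it is infinite wherever [conv] is, so [conv] is finite almost everywhere and
    square-integrable. *)
Lemma L2_of_pairing_bound :
  exists2 v, L2 leb v & EFin \o v = conv %[ae leb].
Proof.
have ms : measurable_fun setT trunc_sup.
  have c x : [set: V] x -> trunc_sqr N x @[N --> \oo] --> trunc_sup x.
    by move=> _; exact: (ereal_nondecreasing_is_cvgn (@trunc_sqr_nd x)).
  apply: (emeasurable_fun_cvg _ _ _ c) => N.
  by apply: (measurable_EFinP _ _).2; exact: measurable_funX.
have s0 x : 0 <= trunc_sup x.
  by apply: le_trans (trunc_sqr_sup 0 x); rewrite lee_fin sqr_ge0.
have isup : leb.-integrable setT trunc_sup.
  apply/integrableP; split => //; under eq_integral do rewrite gee0_abs//.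
  exact: le_lt_trans integral_trunc_sup (ltry _).
exists (fine \o conv).
  have mf : measurable_fun setT (fine \o conv) by exact: measurableT_comp.
  apply/L2P; split => //; apply: (le_lt_trans _ (le_lt_trans integral_trunc_sup (ltry _))).
  apply: ge0_le_integral => //.
  - by move=> x _; rewrite lee_fin sqr_ge0.
  - by apply: (measurable_EFinP _ _).2; exact: measurable_funX.
  - by move=> x _; exact: fine_conv_sup.
have := integrable_ae measurableT isup; apply: filterS => x /(_ I) xf _ /=.
rewrite fineK// ge0_fin_numE// ltey; apply: contraTneq xf => /conv_infty ->.
by [].
Qed.

End L2_of_pairing_bound.

(** * The Poisson multiplier as an average of semigroup multipliers *)

Section poisson_multiplier.
Context d (T : measurableType d) (R : realType).
Variable mu : {measure set T -> \bar R}.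
Variable E : spectral_family mu.
Variables (a y : R).
Hypotheses (ha : -1 < a < 1) (hy : 0 < y).
Implicit Types (u v w q : T -> R).
Local Notation L2 := (L2 mu).
Local Notation dot := (dotL2 mu).
Local Notation TR := (measurableTypeR R).
Local Notation D := (`[0, +oo[%classic : set R).
Local Notation lam := (@lebesgue_measure R).
Local Notation e t := ((fun l : R => expR (- t * l)) \_ D).
Local Open Scope ereal_scope.

Definition poisson_mult : R -> R :=
  fun l => phi a (theta a * y `^ (1 - a) * l `^ ((1 - a) / 2)).

(** Extension by zero lets Tonelli's theorem run on a product of whole spaces. *)
Definition poisson_density : R -> R := poisson_weight a y \_ `]0%R, +oo[%classic.

Local Notation p := (poisson_mult \_ D).
Local Notation K := poisson_density.
Local Notation C := (poisson_const a * y `^ (1 - a))%R.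

Lemma poisson_const_gt0 : (0 < C)%R.
Proof.
have s01 : (0 < (1 - a) / 2 < 1)%R by move: ha => /andP[? ?]; apply/andP; lra.
have [_ G0] := GammaE s01.
by rewrite mulr_gt0 ?powR_gt0// divr_gt0 ?powR_gt0.
Qed.

Lemma poisson_density_ge0 t : (0 <= K t)%R.
Proof. by rewrite /poisson_density patchE; case: ifPn => // _; exact: poisson_weight_ge0. Qed.

Lemma measurable_poisson_density : measurable_fun setT (K : TR -> R).
Proof.
apply/(measurable_restrictT _ (measurable_itv _)).
apply: subspace_continuous_measurable_fun; first exact: measurable_itv.
by apply: continuous_in_subspaceT => t /set_mem; exact: continuous_poisson_weight.
Qed.

Lemma integral_poisson_density : C%:E * \int[lam]_t (K t)%:E = 1.
Proof.
have -> : \int[lam]_t (K t)%:E = (C^-1)%:E.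
  rewrite -(integral_poisson_weight ha hy) [RHS]integral_mkcond.
  by apply: eq_integral => t _; rewrite /poisson_density !patchE; case: ifPn.
by rewrite -EFinM mulfV// gt_eqF// poisson_const_gt0.
Qed.

Lemma poisson_multE l : (p l)%:E = C%:E * \int[lam]_t (K t * e t l)%:E.
Proof.
rewrite patchE; case: ifPn => [|lD]; last first.
  under eq_integral do rewrite patchE (negbTE lD) mulr0.
  by rewrite integral0 mule0.
move=> /[dup] lD /set_mem/=; rewrite in_itv/= andbT => l0.
rewrite /poisson_mult phi_laplace//; congr (_ * _); rewrite [LHS]integral_mkcond.
apply: eq_integral => t _; rewrite /poisson_density !patchE lD.
by case: ifPn => // _; rewrite mul0r.
Qed.

Lemma measurable_poisson_kernel :
  measurable_fun setT (fun z : TR * TR => (K z.1 * e z.1 z.2)%R).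
Proof.
apply: measurable_funM; first exact: measurableT_comp measurable_poisson_density measurable_fst.
rewrite (_ : (fun z : TR * TR => e z.1 z.2) = (fun z => \1_D z.2 * expR (- z.1 * z.2))%R).
  apply: measurable_funM.
    by apply: measurableT_comp => //; apply: measurable_indic.
  apply: (measurableT_comp (@measurable_expR R)); apply: measurable_funM => //.
  by apply: measurableT_comp.
by apply/funext => -[t l] /=; rewrite patchE indicE; case: ifPn; rewrite ?mul1r ?mul0r.
Qed.

Lemma e_ge0 t l : (0 <= e t l)%R.
Proof. by rewrite patchE; case: ifPn => // _; rewrite expR_ge0. Qed.

Lemma poisson_density_eq0 t : (t <= 0)%R -> K t = 0%R.
Proof.
move=> t0; rewrite /poisson_density patchE ifF//.
by apply/negP; rewrite inE/= in_itv/= andbT ltNge t0.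
Qed.

Lemma poisson_density_integral t q : L2 q ->
  \int[specm E q]_l (K t * e t l)%:E = (K t * spec_int E (e t) q)%:E.
Proof.
move=> hq; have [t0|t0] := ltP 0%R t; last first.
  by under eq_integral do rewrite poisson_density_eq0// mul0r;
    rewrite integral0 poisson_density_eq0// mul0r.
have he := bounded_ge0_semigroup (ltW t0).
rewrite [RHS]EFinM -(spec_intE _ _ he) -ge0_integralZl//.
- by apply/measurable_EFinP; case: he.
- by move=> l _; rewrite lee_fin e_ge0.
- by rewrite lee_fin poisson_density_ge0.
Qed.

(** Tonelli's theorem asks for a measure with a sigma-finite structure; [specm], defined by cases,
    is identified here with the Stieltjes measure that carries one. *)
Lemma specm_sigma_finite q : L2 q -> exists S : {sigma_finite_measure set TR -> \bar R},
  (specm E q : set TR -> \bar R) = S.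
Proof.
move=> hq; exists (lebesgue_stieltjes_measure (spec_cumulative E hq)).
by rewrite /specm; case: pselect => // hq'; rewrite (Prop_irrelevance hq' hq).
Qed.

Let fubini_ker z := (K z.1 * e z.1 z.2)%:E.

Let measurable_ker : measurable_fun setT (fubini_ker : TR * TR -> \bar R).
Proof. apply/measurable_EFinP; exact: measurable_poisson_kernel. Qed.

Let ker_ge0 z : 0 <= fubini_ker z.
Proof. by rewrite lee_fin mulr_ge0 ?poisson_density_ge0 ?e_ge0. Qed.

Lemma spec_int_poisson q : L2 q ->
  \int[specm E q]_l (p l)%:E = C%:E * \int[lam]_t (K t * spec_int E (e t) q)%:E.
Proof.
move=> hq; under eq_integral do rewrite poisson_multE.
have C0 := poisson_const_gt0.
have mF := measurable_fun_fubini_tonelli_G (m1 := lam) _ measurable_ker ker_ge0.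
rewrite ge0_integralZl//; last 2 first.
- by move=> l _; apply: integral_ge0 => t _; exact: (ker_ge0 (t, l)).
- by rewrite lee_fin ltW.
congr (_ * _).
under [RHS]eq_integral do rewrite -poisson_density_integral//.
have [S ->] := specm_sigma_finite hq.
exact/esym/(@fubini_tonelli _ _ TR TR R lam S _ measurable_ker ker_ge0).
Qed.

(** Both facts come from the Laplace representation rather than from the Bessel formula:
    measurability by Tonelli's theorem, and the bound 1 from e^(-tl) <= 1 together with the
    normalised mass. *)
Lemma bounded_ge0_poisson : bounded_ge0 1 p.
Proof.
split.
  apply/measurable_EFinP; rewrite /comp; under eq_fun do rewrite poisson_multE.
  apply: measurable_funeM.
  exact: (measurable_fun_fubini_tonelli_G (m1 := lam) _ measurable_ker ker_ge0).
move=> l; rewrite -!lee_fin poisson_multE; have C0 := poisson_const_gt0.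
rewrite mule_ge0 ?lee_fin ?(ltW C0)//=; last first.
  by apply: integral_ge0 => t _; exact: (ker_ge0 (t, l)).
rewrite -integral_poisson_density lee_pmul2l ?lte_fin//.
apply: ge0_le_integral => //.
- by move=> t _; exact: (ker_ge0 (t, l)).
- apply/measurable_EFinP.
  apply: (measurableT_comp measurable_poisson_kernel
    (_ : measurable_fun setT (fun t : TR => (t, l) : TR * TR))).
  exact: measurable_fun_pair.
- by apply/measurable_EFinP; exact: measurable_poisson_density.
- move=> t _; rewrite lee_fin; have [t0|t0] := ltP 0%R t;
  last by rewrite poisson_density_eq0// mul0r.
  rewrite ler_piMr ?poisson_density_ge0//.
  by have [_ /(_ l)/andP[]] := bounded_ge0_semigroup (ltW t0).
Qed.

Lemma integrable_spec_int q : L2 q ->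
  lam.-integrable setT (EFin \o (fun t => K t * spec_int E (e t) q)%R).
Proof.
move=> hq; have C0 := poisson_const_gt0.
have k0 t : 0 <= (K t * spec_int E (e t) q)%:E.
  by rewrite -poisson_density_integral//; apply: integral_ge0 => l _; exact: (ker_ge0 (t, l)).
apply/integrableP; split.
  rewrite /comp; under eq_fun do rewrite -poisson_density_integral//.
  have [S ->] := specm_sigma_finite hq.
  exact: (measurable_fun_fubini_tonelli_F (m2 := S) _ measurable_ker ker_ge0).
rewrite (eq_integral (fun t : TR => (K t * spec_int E (e t) q)%:E)); last first.
  by move=> t _; rewrite -[RHS](gee0_abs (k0 t)).
rewrite -(@lte_pmul2l _ C%:E) ?lte_fin// -spec_int_poisson// (spec_intE _ _ bounded_ge0_poisson).
by rewrite gt0_muley ?lte_fin// ltry.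
Qed.

Lemma spec_int_poissonE q : L2 q ->
  spec_int E p q = (C * \int[lam]_t (K t * spec_int E (e t) q))%R.
Proof.
move=> hq; apply: EFin_inj; rewrite -(spec_intE _ _ bounded_ge0_poisson) spec_int_poisson//.
rewrite [RHS]EFinM /Rintegral fineK//.
exact: (integrable_fin_num measurableT (integrable_spec_int hq)).
Qed.

Let quarter_form (A B c : R) : ((c * A - c * B) / 4 = c * (4^-1 * (A - B)))%R.
Proof. by ring. Qed.

Lemma spec_form_poisson u w : L2 u -> L2 w ->
  lam.-integrable setT (EFin \o (fun t => K t * spec_form E (e t) u w)%R) /\
  spec_form E p u w = (C * \int[lam]_t (K t * spec_form E (e t) u w))%R.
Proof.
move=> hu hw; have i1 := integrable_spec_int (L2D hu hw);
  have i2 := integrable_spec_int (L2B hu hw).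
have eq : (fun t => K t * spec_form E (e t) u w)%R =
    (fun t => 4^-1 * ((K t * spec_int E (e t) (u \+ w)%R) - (K t * spec_int E (e t) (u \- w)%R)))%R.
  by apply/funext => t; rewrite /spec_form; ring.
have i3 : lam.-integrable setT (EFin \o (fun t => (K t * spec_int E (e t) (u \+ w)%R) -
  (K t * spec_int E (e t) (u \- w)%R))%R).
  exact: (integrableB measurableT i1 i2).
rewrite eq; split; first exact: (integrableZl measurableT 4^-1 i3).
rewrite RintegralZl// RintegralB// /spec_form.
rewrite (spec_int_poissonE (L2D hu hw)) (spec_int_poissonE (L2B hu hw)).
exact: quarter_form.
Qed.

(** For each t > 0 the form of e^(-tl) is an inner product with an actual vector, hence additive in
    w; averaging over t transfers additivity to the Poisson multiplier before it is known to define
    an operator. *)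
Lemma spec_form_poissonB u w1 w2 : L2 u -> L2 w1 -> L2 w2 ->
  spec_form E p u (w1 \- w2)%R = (spec_form E p u w1 - spec_form E p u w2)%R.
Proof.
move=> hu h1 h2; have [i1 ->] := spec_form_poisson hu h1; have [i2 ->] := spec_form_poisson hu h2.
have [_ ->] := spec_form_poisson hu (L2B h1 h2).
rewrite -mulrBr -RintegralB//; congr (_ * _)%R; apply: eq_Rintegral => t _.
have [t0|t0] := ltP 0%R t; last by rewrite poisson_density_eq0// !mul0r subr0.
have [v hv vE] := semigroup_exists E t0 hu.
rewrite -mulrBr -!vE//.
by rewrite ![dot v _]dotL2C dotL2B.
Qed.

End poisson_multiplier.

Lemma measurable_cg_shift (R : realType) (n : nat) (G : carnot_group R n)
    (d : measure_display) (S : measurableType d) (f g : S -> 'rV[R]_n) :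
  measurable_fun setT f -> measurable_fun setT g ->
  measurable_fun setT (fun s => G (- f s) (g s)).
Proof.
move=> mf mg.
have mG : measurable_fun setT (fun q : 'rV[R]_n * 'rV[R]_n => G (- q.1) q.2).
  apply: continuous_measurable_map2.
  apply: (@cg_continuous_comp _ _ G _ (fun q : 'rV[R]_n * 'rV[R]_n => - q.1) snd) => q;
    last exact: cvg_snd.
  by apply: cvgN; exact: cvg_fst.
exact: (measurableT_comp mG (measurable_fun_pair mf mg)).
Qed.

(** * Convolution with the Poisson kernel *)

Section poisson_convolution.
Context (R : realType) (n m : nat) (G : carnot_group R n) (X : m.-tuple 'rV[R]_n).
Context (E : spectral_family (leb R n)).
Local Notation V := ('rV[R]_n).
Local Notation leb := (leb R n).
Local Notation Leb := (@lebesgue R n).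
Local Notation dot := (dotL2 leb).
Local Notation TR := (measurableTypeR R).
Local Notation lam := (@lebesgue_measure R).
Local Notation D := (`[0, +oo[%classic : set R).
Local Open Scope ereal_scope.
Variables (h : R -> V -> R) (a y : R).
Hypotheses (hE : spectral_resolution_of E (sublap_graph G X))
  (hh : heat_kernel G X E h) (ha : (-1 < a < 1)%R) (hy : (0 < y)%R).
Local Notation K := (poisson_density a y).
Local Notation C := (poisson_const a * y `^ (1 - a))%R.
Local Notation P := (poisson_kernel h a y).
Local Notation p := (poisson_mult a y \_ D).

(** Nothing is known about h at times t <= 0; setting it to 0 there gives a function that is jointly
    measurable and nonnegative everywhere. *)
Let hp : TR * V -> R := (fun q => h q.1 q.2) \_ (`]0%R, +oo[%classic `*` setT).

Let hpE t x : hp (t, x) = if (0 < t)%R then h t x else 0%R.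
Proof.
rewrite /hp patchE; case: ifPn => [/set_mem[/=]|].
  by rewrite in_itv/= andbT => ->.
by rewrite notin_setE/= in_itv/= andbT; case: ifP => // t0 [].
Qed.

Let hp_ge0 q : (0 <= hp q)%R.
Proof.
by case: q => t x; rewrite hpE; case: ifPn => // t0; exact: (heat_kernel_ge0 hE hh).
Qed.

Let measurable_hp : measurable_fun setT hp.
Proof.
apply/(measurable_restrictT _ (measurableX (measurable_itv _) measurableT)).
apply: measurable_fun_half_space => -[t x] /= t0.
exact: (heat_continuous hh).
Qed.

Lemma poisson_kernelE x : P x = C%:E * \int[lam]_t (K t * hp (t, x))%:E.
Proof.
rewrite /poisson_kernel; congr (_ * _); rewrite [LHS]integral_mkcond.
apply: eq_integral => t _; rewrite /poisson_density !patchE hpE; case: ifPn => [/set_mem/=|_].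
  by rewrite in_itv/= andbT => ->.
by rewrite mul0r.
Qed.

Lemma poisson_kernel_ge0 x : 0 <= P x.
Proof.
rewrite poisson_kernelE mule_ge0//; first by rewrite lee_fin ltW// poisson_const_gt0.
by apply: integral_ge0 => t _; rewrite lee_fin mulr_ge0 ?poisson_density_ge0.
Qed.

Section nonnegative.
Variable u : V -> R.
Hypotheses (hu : L2 leb u) (u0 : forall x, (0 <= u x)%R).
Let mu : measurable_fun setT u. Proof. exact: L2_measurable hu. Qed.

(** The convolution of u with h t as one function of (t, x), for joint measurability. *)
Let orbit_int (q : TR * V) : \bar R := \int[leb]_z (u z * hp (q.1, G (- z) q.2))%:E.

Let orbit_int_ge0 q : 0 <= orbit_int q.
Proof. by apply: integral_ge0 => z _; rewrite lee_fin mulr_ge0. Qed.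

Let measurable_orbit_int : measurable_fun setT orbit_int.
Proof.
pose f (q : (TR * V) * V) : \bar R := (u q.2 * hp (q.1.1, G (- q.2) q.1.2))%:E.
have mf : measurable_fun setT f.
  apply/measurable_EFinP; apply: measurable_funM.
    exact: (measurableT_comp mu measurable_snd).
  apply: (measurableT_comp measurable_hp); apply: measurable_fun_pair => /=.
    exact: (measurableT_comp measurable_fst measurable_fst).
  apply: measurable_cg_shift; first exact: measurable_snd.
  exact: (measurableT_comp measurable_snd measurable_fst).
have f0 q : 0 <= f q by rewrite lee_fin mulr_ge0.
exact: (measurable_fun_fubini_tonelli_F (m2 := Leb) f mf f0).
Qed.

Let conv := convolution G (EFin \o u) P.

Lemma convolution_poisson x : conv x = C%:E * \int[lam]_t ((K t)%:E * orbit_int (t, x)).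
Proof.
have C0 := poisson_const_gt0 ha hy.
have K0 t := poisson_density_ge0 a y t.
pose f (q : V * TR) : \bar R := (u q.1 * (K q.2 * hp (q.2, G (- q.1) x)))%:E.
have mKh : measurable_fun setT (fun q : V * TR => K q.2 * hp (q.2, G (- q.1) x))%R.
  apply: measurable_funM.
    exact: (measurableT_comp (measurable_poisson_density a y) measurable_snd).
  apply: (measurableT_comp measurable_hp); apply: measurable_fun_pair => //.
  by apply: measurable_cg_shift.
have mf : measurable_fun setT f.
  apply/measurable_EFinP; apply: measurable_funM => //.
  exact: (measurableT_comp mu measurable_fst).
have f0 q : 0 <= f q by rewrite lee_fin !mulr_ge0.
have mKz z : measurable_fun setT (fun t : TR => K t * hp (t, G (- z) x))%R.
  apply: (measurableT_comp mKh (_ : measurable_fun setT (fun t : TR => (z, t) : V * TR))).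
  exact: measurable_fun_pair.
transitivity (\int[leb]_z (C%:E * \int[lam]_t f (z, t))).
  apply: eq_integral => z _; rewrite poisson_kernelE muleCA; congr (_ * _).
  rewrite -ge0_integralZl ?lee_fin//.
  - exact/measurable_EFinP.
  - by move=> t _; rewrite lee_fin mulr_ge0.
have mF := measurable_fun_fubini_tonelli_F (m2 := lam) f mf f0.
rewrite ge0_integralZl//; last 2 first.
- by move=> z _; exact: integral_ge0.
- by rewrite lee_fin ltW.
congr (_ * _); rewrite [LHS](@fubini_tonelli _ _ V TR R Leb lam f mf f0).
apply: eq_integral => t _; rewrite -ge0_integralZl ?lee_fin//.
- by apply: eq_integral => z _; rewrite /f/= mulrCA.
- apply/measurable_EFinP; apply: measurable_funM => //.
  apply: (measurableT_comp measurable_hp); apply: measurable_fun_pair => //.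
  exact: measurable_cg_shift.
- by move=> z _; rewrite lee_fin mulr_ge0.
Qed.

Let conv_ge0 x : 0 <= conv x.
Proof. by apply: integral_ge0 => z _; rewrite mule_ge0 ?lee_fin ?poisson_kernel_ge0. Qed.

Let measurable_Kc : measurable_fun setT (fun q : TR * V => (K q.1)%:E * orbit_int q).
Proof.
apply: emeasurable_funM => //; apply: (measurable_EFinP _ _).2.
exact: (measurableT_comp (measurable_poisson_density a y) measurable_fst).
Qed.

Let Kc_ge0 q : 0 <= (K q.1)%:E * orbit_int q.
Proof. by rewrite mule_ge0 ?lee_fin ?poisson_density_ge0. Qed.

Let measurable_conv : measurable_fun setT conv.
Proof.
rewrite (_ : conv = fun x => C%:E * \int[lam]_t ((K t)%:E * orbit_int (t, x))); last first.
  by apply/funext => x; exact: convolution_poisson.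
apply: measurable_funeM.
exact: (measurable_fun_fubini_tonelli_G (m1 := lam) _ measurable_Kc Kc_ge0).
Qed.

Let orbit_int_dot t w : (0 < t)%R -> L2 leb w -> (forall x, (0 <= w x)%R) ->
  \int[leb]_x (orbit_int (t, x) * (w x)%:E) =
  (spec_form E ((fun l => expR (- t * l)) \_ D) u w)%:E.
Proof.
move=> t0 hw w0; have hv := semigroup_integral E t0 hu.
have [_ _ /(_ t u t0 hu) eqc] := hh.
move: hv eqc; set v := spectral_apply _ _ _.
move=> /(spectral_integralP _ _ _ (bounded_ge0_semigroup (ltW t0)))[_ hv vE] eqc.
rewrite -vE// dotL2E//; apply: ae_eq_integral => //.
- apply: emeasurable_funM; last by apply/measurable_EFinP; exact: L2_measurable hw.
  exact: (measurableT_comp measurable_orbit_int (measurable_pair1 t)).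
- by apply/measurable_EFinP; apply: measurable_funM;
  [exact: L2_measurable hv|exact: L2_measurable hw].
- apply: filterS eqc => x /(_ I)/= xv _; rewrite EFinM xv; congr (_ * _).
  by apply: eq_integral => z _; rewrite /= hpE t0.
Qed.

(** With w >= 0 all integrands are nonnegative, so the exchange of integrals requires no prior
    finiteness of the convolution; finiteness is a consequence, the right-hand side being real. *)
Lemma integral_conv_dot w : L2 leb w -> (forall x, (0 <= w x)%R) ->
  \int[leb]_x (conv x * (w x)%:E) = (spec_form E p u w)%:E.
Proof.
move=> hw w0; have C0 := poisson_const_gt0 ha hy.
have mw := L2_measurable hw.
pose f (q : TR * V) : \bar R := (K q.1)%:E * orbit_int q * (w q.2)%:E.
have mf : measurable_fun setT f.
  apply: emeasurable_funM => //; apply: (measurable_EFinP _ _).2.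
  exact: (measurableT_comp mw measurable_snd).
have f0 q : 0 <= f q by rewrite mule_ge0 ?lee_fin.
transitivity (\int[leb]_x (C%:E * \int[lam]_t f (t, x))).
  apply: eq_integral => x _; rewrite convolution_poisson -muleA; congr (_ * _).
  rewrite -ge0_integralZr ?lee_fin//.
  - exact: (measurableT_comp measurable_Kc (measurable_pair2 x)).
  - by move=> t _; exact: (Kc_ge0 (t, x)).
have mF := measurable_fun_fubini_tonelli_G (m1 := lam) f mf f0.
rewrite ge0_integralZl//; last 2 first.
- by move=> x _; exact: integral_ge0.
- by rewrite lee_fin ltW.
rewrite -[X in _ * X](@fubini_tonelli _ _ TR V R lam Leb f mf f0).
have [ip ->] := spec_form_poisson E ha hy hu hw.
rewrite [RHS]EFinM /Rintegral fineK; last exact: (integrable_fin_num measurableT ip).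
congr (_ * _); apply: eq_integral => t _.
have [t0|t0] := ltP 0%R t; last first.
  rewrite poisson_density_eq0// mul0r /f/= poisson_density_eq0//.
  by under eq_integral do rewrite !mul0e; rewrite integral0.
rewrite EFinM -orbit_int_dot// -ge0_integralZl//.
- by apply: eq_integral => x _; rewrite /f muleA.
- apply: emeasurable_funM; last exact/measurable_EFinP.
  exact: (measurableT_comp measurable_orbit_int (measurable_pair1 t)).
- by move=> x _; rewrite mule_ge0 ?lee_fin.
- by rewrite lee_fin poisson_density_ge0.
Qed.

Lemma convolution_poisson_L2 :
  exists2 v, L2 leb v & EFin \o v = convolution G (EFin \o u) P %[ae leb].
Proof.
apply: (L2_of_pairing_bound (M := dot u u) measurable_conv conv_ge0) => w hw w0.
rewrite integral_conv_dot// lee_fin (le_trans (ler_norm _))//.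
by have := spec_form_bound E (bounded_ge0_poisson ha hy) hu hw; rewrite mul1r.
Qed.

Lemma convolution_poisson_pairing (v w : V -> R) : L2 leb v ->
  EFin \o v = convolution G (EFin \o u) P %[ae leb] -> L2 leb w ->
  dot v w = spec_form E p u w.
Proof.
move=> hv ev hw; pose wp := (fun x => Num.max (w x) 0)%R; pose wn := (fun x => Num.max (- w x) 0)%R.
have mw := L2_measurable hw.
have hwp : L2 leb wp.
  apply: (L2_le (v := w)) => //; first exact: measurable_maxr.
  by move=> x; rewrite /wp; case: (leP (w x) 0%R) => // _; rewrite normr0.
have hwn : L2 leb wn.
  apply: (L2_le (v := w)) => //; first by apply: measurable_maxr => //; exact: measurableT_comp.
  move=> x; rewrite /wn; case: (leP (- w x)%R 0%R) => // _; first by rewrite normr0.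
  by rewrite normrN.
have wE : w = (wp \- wn)%R.
  apply/funext => x /=; rewrite /wp /wn; case: (leP (w x) 0%R) => h1;
    case: (leP (- w x)%R 0%R) => h2; lra.
have pos g : L2 leb g -> (forall x, (0 <= g x)%R) -> dot v g = spec_form E p u g.
  move=> hg g0; apply: EFin_inj; rewrite -integral_conv_dot// dotL2E//.
  have mg := L2_measurable hg; have mv := L2_measurable hv.
  apply: ae_eq_integral => //.
  - by apply: (measurable_EFinP _ _).2; exact: measurable_funM.
  - by apply: emeasurable_funM => //; exact: (measurable_EFinP _ _).2.
  - by apply: filterS ev => x /(_ I)/= xv _; rewrite EFinM xv.
rewrite wE spec_form_poissonB// dotL2C dotL2B// ![dot _ v]dotL2C !pos//.
- by move=> x; rewrite /wn le_max lexx orbT.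
- by move=> x; rewrite /wp le_max lexx orbT.
Qed.

End nonnegative.

(** As the kernel is nonnegative, the positive and negative parts of the integrand come from those
    of u. The identity is thus the definition of the extended integral and holds at every x,
    infinite values included. *)
Lemma convolution_poissonB (u : V -> R) x :
  convolution G (EFin \o u) P x =
  convolution G (EFin \o (fun z => Num.max (u z) 0)%R) P x -
  convolution G (EFin \o (fun z => Num.max (- u z) 0)%R) P x.
Proof.
rewrite {1}/convolution integralE; congr (_ - _); apply: eq_integral => z _ /=.
  rewrite funeposE; case: (leP (u z) 0%R) => uz.
    by rewrite mul0e max_r// mule_le0_ge0 ?lee_fin ?poisson_kernel_ge0.
  by rewrite max_l// mule_ge0 ?lee_fin ?(ltW uz) ?poisson_kernel_ge0.
rewrite funenegE -muleN; case: (leP (- u z)%R 0%R) => uz.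
  by rewrite mul0e max_r// mule_ge0_le0 ?oppe_le0 ?lee_fin ?poisson_kernel_ge0 -?oppr_le0.
rewrite max_l ?EFinN ?mulNe ?muleN// oppe_ge0 mule_le0_ge0 ?lee_fin ?poisson_kernel_ge0//.
by rewrite -oppr_ge0 ltW.
Qed.

Lemma spectral_apply_poisson (u : V -> R) : L2 leb u ->
  EFin \o spectral_apply E (poisson_mult a y) u = convolution G (EFin \o u) P %[ae leb].
Proof.
move=> hu; have mu := L2_measurable hu.
pose up := (fun x => Num.max (u x) 0)%R; pose un := (fun x => Num.max (- u x) 0)%R.
have hup : L2 leb up.
  apply: (L2_le (v := u)) => //; first exact: measurable_maxr.
  by move=> x; rewrite /up; case: (leP (u x) 0%R) => // _; rewrite normr0.
have hun : L2 leb un.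
  apply: (L2_le (v := u)) => //; first by apply: measurable_maxr => //; exact: measurableT_comp.
  move=> x; rewrite /un; case: (leP (- u x)%R 0%R) => // _; first by rewrite normr0.
  by rewrite normrN.
have uE : u = (up \- un)%R.
  apply/funext => x /=; rewrite /up /un; case: (leP (u x) 0%R) => h1;
    case: (leP (- u x)%R 0%R) => h2; lra.
have up0 x : (0 <= up x)%R by rewrite le_max lexx orbT.
have un0 x : (0 <= un x)%R by rewrite le_max lexx orbT.
have [vp hvp ep] := convolution_poisson_L2 hup up0.
have [vn hvn en] := convolution_poisson_L2 hun un0.
have hp1 := bounded_ge0_poisson ha hy.
have hv := L2B hvp hvn.
have vE w : L2 leb w -> dot (vp \- vn)%R w = spec_form E p u w.
  move=> hw; rewrite dotL2B// (convolution_poisson_pairing hup up0 hvp ep hw).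
  rewrite (convolution_poisson_pairing hun un0 hvn en hw).
  (* Additivity is available in the second argument; symmetry carries it to the first, where u
     splits. *)
  rewrite !(spec_formC E hp1 _ hw)// -(spec_form_poissonB E ha hy hw hup hun).
  by rewrite -uE.
(* The difference of the two convolutions is the vector that realises the multiplier at u, so the
   choice made by [spectral_apply] is a genuine spectral integral and agrees with it almost
   everywhere. *)
have si : spectral_integral E (poisson_mult a y) u (vp \- vn)%R.
  exact/(spectral_integralP _ _ _ hp1).
have /(spectral_integralP _ _ _ hp1)[_ hv' v'E] : spectral_integral E (poisson_mult a y) u
  (spectral_apply E (poisson_mult a y) u).
  by apply: xgetPex; exists (vp \- vn)%R.
have : spectral_apply E (poisson_mult a y) u = (vp \- vn)%R %[ae leb].
  by apply: dotL2_inj => // w hw; rewrite v'E// vE.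
move=> e; apply: filterS3 e ep en => x /(_ I)/= -> /(_ I)/= xp /(_ I)/= xn _.
by rewrite convolution_poissonB -xp -xn EFinB.
Qed.

End poisson_convolution.

Theorem theorem4p4 (R : realType) (n m : nat) (G : carnot_group R n)
    (X : m.-tuple 'rV[R]_n) (hX : basis_of (cg_layer G 1) X)
    (E : spectral_family (leb R n))
    (hE : spectral_resolution_of E (sublap_graph G X))
    (h : R -> 'rV[R]_n -> R) (hh : heat_kernel G X E h)
    (a : R) (ha : -1 < a < 1)
    (u : 'rV[R]_n -> R) (hu : L2 (leb R n) u)
    (y : R) (hy : 0 < y) :
  (forall x, (0 <= poisson_kernel h a y x)%E) /\
  EFin \o spectral_apply E
    (fun l => phi a (theta a * y `^ (1 - a) * l `^ ((1 - a) / 2))) u =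
  convolution G (EFin \o u) (poisson_kernel h a y) %[ae leb R n].
Proof.
split; first by move=> x; exact: (poisson_kernel_ge0 hE hh ha hy).
exact: (spectral_apply_poisson hE hh ha hy hu).
Qed.
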